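(* Let $h$, $A_h$ and the polynomial perturbations $g^{\pm}=(p^{\pm},q^{\pm},r^{\pm})$ (of degrees at most $m,n,p$ respectively) be as described in the context. Assume that $A_h(\theta)=0$ for all $\theta\in[0,2\pi)$ and that $g^+=g^-$, and consider the function $$\overline{M}_\delta(z)=-\int_0^{2\pi}\Big[h(\cos\theta,\sin\theta)\big(-\cos\theta\,q^+(\varsigma)+\sin\theta\,p^+(\varsigma)\big)+r^+(\varsigma)\Big]d\theta,$$ where $\varsigma=\left(\cos\theta,\ \sin\theta,\ z+\int_0^\theta h(\cos v,\sin v)\,dv\right)$ and $z\in\mathbb{R}$ (the right-hand side does not depend on $\delta$). Then, for each $z_0\in\mathbb{R}$ such that $\overline{M}_\delta(z_0)=0$ and $\overline{M}_\delta'(z_0)\ne0$, and for $|\varepsilon|\ne0$ sufficiently small, the smooth system $\dot X=f(X)+\varepsilon g^+(X)$, $X=(x,y,z)$, has a limit cycle bifurcating from the band of periodic solutions that fill the cylinder $C$ when $\varepsilon=0$. Moreover, if $\overline{M}_\delta$ is not identically zero, there exist at most $s=\max\{m,n,p\}$ values of $z$ for which $\overline{M}_\delta(z)=0$.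
   Context: **Unperturbed system.** Consider in $\mathbb{R}^3$ (minus the $z$-axis if $h$ is not defined or not $C^2$ at the origin) the system $$\dot x=-y+x(x^2+y^2-1),\quad \dot y=x+y(x^2+y^2-1),\quad \dot z=h(x,y),$$ whose vector field is denoted $f(X)$, $X=(x,y,z)$. Standing assumptions: $h$ is of class $C^2$ on $\mathbb{R}^2\setminus\{0\}$ and has the form $h(x,y)=\rho(x^2+y^2)\,\tilde h(x,y)$ with $\tilde h(x,y)=x\,\phi(x^2,y^2)+xy\,\chi(x^2,y^2)+y\,\psi(x^2,y^2)$, where $\phi,\chi,\psi$ are given by power series (so no monomial $x^iy^j$ with $i$ and $j$ both even occurs in $\tilde h$). Then the cylinder $C=\{(x,y,z)\in\mathbb{R}^3: x^2+y^2=1\}$ is invariant and filled by $2\pi$-periodic solutions, the one through $(1,0,z_0)$ being $x=\cos t$, $y=\sin t$, $z=z_0+\int_0^t h(\cos v,\sin v)\,dv$. **Perturbation.** $g^{\pm}=(p^{\pm},q^{\pm},r^{\pm})$ are polynomial maps with real coefficients: $$p^{\pm}=\sum_{i+j+k\le m}a^{\pm}_{ijk}x^iy^jz^k,\quad q^{\pm}=\sum_{i+j+k\le n}b^{\pm}_{ijk}x^iy^jz^k,\quad r^{\pm}=\sum_{i+j+k\le p}c^{\pm}_{ijk}x^iy^jz^k .$$ In general the perturbed system is $\dot X=f(X)+\varepsilon g(X)$ with $g=\frac12(g^++g^-)+\frac{\mathrm{sgn}(y)}{2}(g^+-g^-)$; when $g^+=g^-$ it reduces to $\dot X=f(X)+\varepsilon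 g^+(X)$. Here $\varepsilon$ is a small real parameter. **The function $A_h$.** $$A_h(\theta)=\cos\theta\,\frac{\partial h}{\partial x}(\cos\theta,\sin\theta)+\sin\theta\,\frac{\partial h}{\partial y}(\cos\theta,\sin\theta).$$ **Terminology.** A limit cycle is an isolated periodic orbit. ''Bifurcating from the band of periodic solutions of $C$'' (for the given $z_0$) means that, as $\varepsilon\to0$, the limit cycle tends to the periodic orbit of the unperturbed system on $C$ through $(1,0,z_0)$. How small $|\varepsilon|$ must be may depend on $h,g^+,z_0$. A prime denotes the derivative with respect to $z$. *)

(* Defs.v *)
From Stdlib Require Import Reals List.
From Coquelicot Require Import Coquelicot.
Open Scope R_scope.

Notation R3 := (R * R * R)%type.

(** Absolute convergence on the whole plane; terms are grouped by total
    degree, which is immaterial for an absolutely convergent double series. *)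
Definition is_power_series2 (F : R -> R -> R) : Prop :=
  exists c : nat -> nat -> R, forall u v : R,
    ex_series (fun d =>
      sum_n (fun i => Rabs (c i (d - i)%nat * u ^ i * v ^ (d - i))) d) /\
    is_series (fun d =>
      sum_n (fun i => c i (d - i)%nat * u ^ i * v ^ (d - i)) d) (F u v).

(** [h] is a total function; its value at the origin is irrelevant unless [h]
    happens to be of class C^2 there (see [phase_space]).  [ex_diff_n h 2]
    at every point of an open set means that [h] is C^2 on that set. *)
Definition admissible (h : R -> R -> R) : Prop :=
  (forall x y : R, (x, y) <> (0, 0) -> ex_diff_n h 2 x y) /\
  exists (rho : R -> R) (phi chi psi : R -> R -> R),
    is_power_series2 phi /\ is_power_series2 chi /\ is_power_series2 psi /\
    forall x y : R, (x, y) <> (0, 0) ->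
      h x y = rho (x ^ 2 + y ^ 2) *
              (x * phi (x ^ 2) (y ^ 2) + x * y * chi (x ^ 2) (y ^ 2)
               + y * psi (x ^ 2) (y ^ 2)).

(** R^3, minus the z-axis when [h] is not C^2 at the origin. *)
Definition phase_space (h : R -> R -> R) (X : R3) : Prop :=
  let '(x, y, _) := X in (x, y) <> (0, 0) \/ ex_diff_n h 2 0 0.

Definition unperturbed_field (h : R -> R -> R) (X : R3) : R3 :=
  let '(x, y, z) := X in
  (- y + x * (x ^ 2 + y ^ 2 - 1), x + y * (x ^ 2 + y ^ 2 - 1), h x y).

(** Sum of [a i j k * x^i * y^j * z^k] over [i + j + k <= d]; [sum_n] includes
    its upper bound. *)
Definition poly3 (d : nat) (a : nat -> nat -> nat -> R) (X : R3) : R :=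
  let '(x, y, z) := X in
  sum_n (fun i => sum_n (fun j => sum_n (fun k =>
    a i j k * x ^ i * y ^ j * z ^ k) (d - i - j)) (d - i)) d.

Definition poly_map (m n p : nat) (a b c : nat -> nat -> nat -> R)
    (X : R3) : R3 :=
  (poly3 m a X, poly3 n b X, poly3 p c X).

Definition perturbed_field (h : R -> R -> R) (g : R3 -> R3) (eps : R)
    (X : R3) : R3 :=
  plus (unperturbed_field h X) (scal eps (g X)).

Definition A_h (h : R -> R -> R) (theta : R) : R :=
  cos theta * Derive (fun x => h x (sin theta)) (cos theta) +
  sin theta * Derive (fun y => h (cos theta) y) (sin theta).

Definition cylinder_solution (h : R -> R -> R) (z t : R) : R3 :=
  (cos t, sin t, z + RInt (fun v => h (cos v) (sin v)) 0 t).

Definition cylinder_orbit (h : R -> R -> R) (z : R) (X : R3) : Prop :=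
  exists t : R, X = cylinder_solution h z t.

Definition Mbar (h : R -> R -> R) (m n p : nat)
    (a b c : nat -> nat -> nat -> R) (z : R) : R :=
  - RInt (fun theta =>
      h (cos theta) (sin theta) *
        (- cos theta * poly3 n b (cylinder_solution h z theta)
         + sin theta * poly3 m a (cylinder_solution h z theta))
      + poly3 p c (cylinder_solution h z theta)) 0 (2 * PI).

Definition is_solution (D : R3 -> Prop) (F : R3 -> R3) (X : R -> R3) : Prop :=
  forall t : R, D (X t) /\ is_derive X t (F (X t)).

Definition is_periodic_orbit (D : R3 -> Prop) (F : R3 -> R3)
    (O : R3 -> Prop) : Prop :=
  exists (X : R -> R3) (T : R),
    is_solution D F X /\ 0 < T /\
    (forall t : R, X (t + T) = X t) /\
    (exists t : R, X t <> X 0) /\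
    (forall P : R3, O P <-> exists t : R, P = X t).

Definition tube (O : R3 -> Prop) (delta : posreal) (P : R3) : Prop :=
  exists Q : R3, O Q /\ ball Q delta P.

(** Isolated means: the only periodic orbit contained in some neighbourhood
    of [O] is [O] itself.  Other periodic orbits may still pass through that
    neighbourhood, as happens near saddle cycles in dimension 3. *)
Definition is_limit_cycle (D : R3 -> Prop) (F : R3 -> R3)
    (O : R3 -> Prop) : Prop :=
  is_periodic_orbit D F O /\
  exists delta : posreal, forall O' : R3 -> Prop,
    is_periodic_orbit D F O' ->
    (forall P : R3, O' P -> tube O delta P) ->
    forall P : R3, O' P <-> O P.

(** Convergence of [Gamma eps] to [O] in the Hausdorff sense. *)
Definition orbits_tend_to (Gamma : R -> R3 -> Prop) (O : R3 -> Prop) : Prop :=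
  forall eta : posreal, locally' 0 (fun eps =>
    (forall P : R3, Gamma eps P -> tube O eta P) /\
    (forall P : R3, O P -> tube (Gamma eps) eta P)).

(* Main.v *)
Require Import Defs.
From Stdlib Require Import Reals List.
From Coquelicot Require Import Coquelicot.
From Stdlib Require Import ZArith Lra Lia Psatz IndefiniteDescription FunctionalExtensionality.
Open Scope R_scope.

(** In cylindrical coordinates, with the polar angle [t] as time, the cylinder
    [r = 1] repels ([r - 1] grows like [exp (2 t)]), and along it [z] runs through
    [z0 + H t], where [H] is the primitive of [loop_height h t = h (cos t) (sin t)].
    The symmetry of [h] makes the four reflections of a point of the circle cancel,
    so [loop_height h] has mean zero and these curves close up
    ([loop_height_mean_zero]).  The perturbation moves the closed curves in two ways:
    directly, by [- eps * Mbar z0] per turn, and through the displacement of [r],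
    which is of size [eps] and acts on [z] through [h].  The hypothesis [A_h = 0]
    says that [h] is radially flat on the circle; as [h] is C^2, the second effect is
    [O(eps^2)] ([radial_flatness]).  Hence simple zeros of [Mbar] select the curves
    that survive.

    Quantitatively, put [eps = sg * s^4] with [sg = 1] or [sg = -1], and
    [r = 1 + s^3 u], [z = z0 + H t + s y].  The exponents are chosen so that every
    coupling becomes weak as [s] tends to 0: the forcing of [u] is of size
    [eps / s^3 = s], and the quadratic effect of [r - 1] on [z], of size [s^6], is
    negligible against the linear effect [eps * s] of [y].  One step of averaging,
    [y = sg s^3 corrector + gauge v], then leaves
      [u' = 2 u + rest_u],  [v' = eps * mean_drift1 * v + rest_v],
    where [mean_drift1] is [- Mbar' z0 / (2 pi)] ([Mbar_derive]), hence is not zero,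
    and each rest is a small fraction of the linear term next to it, together with
    its Lipschitz constant ([rest_u_weakly_coupled], [rest_v_weakly_coupled]).  All
    these estimates come from a calculus of first order expansions, the predicate
    [jet], which is stable under the operations that build the vector field.

    Existence and isolation both follow from one remark, [maximum_principle]: at an
    extremum of a periodic solution of [y' = lam y + f] the derivative vanishes, so
    [|y| <= sup |f| / |lam|].  It bounds the periodic inverse of [d/dt - lam]
    uniformly, even for [lam = eps * mean_drift1], which makes Picard iteration
    converge to a loop ([weakly_coupled_periodic_solution]).  Applied to the
    difference between that loop and any nearby periodic orbit, of whatever period,
    it shows that the two coincide ([weakly_coupled_unique]); no monodromy matrix is
    computed, and orbits that wind several times need no separate treatment.

    The passage between the scaled coordinates and the given system is made by
    [cartesian_flow] for the loop, whose angle is a function of time by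
    [autonomous_flow], and by [polar_flow] for the competitors, whose angle is lifted to
    the line by [polar_lift].

    The bound on the number of zeros holds because [Mbar] is a polynomial in [z]: the
    coordinate [z] enters the integrand only through the polynomials, shifted by [H t]
    ([Mbar_polynomial]). *)

(** * Periodic functions and the maximum principle *)

Definition periodic (T : R) (f : R -> R) : Prop := forall t, f (t + T) = f t.

Lemma periodic_nat T f (n : nat) t : periodic T f -> f (t + INR n * T) = f t.
Proof.
intros Hp; induction n as [|n IH].
- f_equal; simpl; ring.
- rewrite S_INR; replace (t + (INR n + 1) * T) with ((t + INR n * T) + T) by ring.
  now rewrite Hp.
Qed.

Lemma periodic_Z T f (k : Z) t : periodic T f -> f (t + IZR k * T) = f t.
Proof.
intros Hp.
destruct (Z_le_gt_dec 0 k) as [Hk|Hk].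
- rewrite <- (Z2Nat.id k Hk), <- INR_IZR_INZ; now apply periodic_nat.
- rewrite <- (periodic_nat T f (Z.to_nat (- k)) (t + IZR k * T) Hp).
  rewrite INR_IZR_INZ, Z2Nat.id by lia; rewrite opp_IZR; f_equal; ring.
Qed.

Lemma reduce_period T a t : 0 < T -> exists k : Z, a <= t + IZR k * T < a + T.
Proof.
intros HT; destruct (floor_ex ((t - a) / T)) as [n Hn]; exists (- n)%Z.
rewrite opp_IZR.
assert (t - a = (t - a) / T * T) by (field; lra).
nra.
Qed.

Lemma periodic_max T f :
  0 < T -> periodic T f -> (forall t, continuous f t) ->
  exists t0, forall t, f t <= f t0.
Proof.
intros HT Hp Hc.
destruct (continuity_ab_maj f 0 T) as [t0 [Ht0 _]]; [lra| |].
{ intros c _; apply continuity_pt_filterlim, Hc. }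
exists t0; intros t; destruct (reduce_period T 0 t HT) as [k Hk].
rewrite <- (periodic_Z T f k t Hp); apply Ht0; lra.
Qed.

Lemma periodic_bounded T f :
  0 < T -> periodic T f -> (forall t, continuous f t) ->
  exists K, 0 <= K /\ forall t, Rabs (f t) <= K.
Proof.
intros HT Hp Hc.
destruct (periodic_max T (fun t => Rabs (f t)) HT) as [t0 Ht0].
- intros t; now rewrite Hp.
- intros t; apply (continuous_comp f Rabs); [apply Hc|apply continuous_Rabs].
- exists (Rabs (f t0)); split; [apply Rabs_pos|exact Ht0].
Qed.

Lemma is_derive_cont (f : R -> R) t l : is_derive f t l -> continuous f t.
Proof. intros H; apply (ex_derive_continuous (V := R_NormedModule) f t); now exists l. Qed.

Lemma is_derive_max_zero (f : R -> R) t0 l :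
  is_derive f t0 l -> (forall t, f t <= f t0) -> l = 0.
Proof.
intros Hd Hm; apply is_derive_Reals in Hd.
pose (pr := exist _ l Hd : derivable_pt f t0).
change (derive_pt f t0 pr = 0).
apply (deriv_maximum f (t0 - 1) (t0 + 1)); try lra; auto.
Qed.

(** At a maximum of [y^2] the derivative of [y] is zero, so [lam * y + F] is zero
    there unless [y] is.  The positive factor [om] does not move the zeros of
    the derivative; it lets solutions be followed in a time other than the angle. *)
Lemma maximum_principle T lam M (y om F : R -> R) :
  0 < T -> lam <> 0 -> periodic T y ->
  (forall t, 0 < om t) -> (forall t, Rabs (F t) <= M) ->
  (forall t, is_derive y t (om t * (lam * y t + F t))) ->
  forall t, Rabs (y t) <= M / Rabs lam.
Proof.
intros HT Hl Hp Hom HF Hd.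
assert (Hd2 : forall t, is_derive (fun t => y t * y t) t
                          (2 * y t * (om t * (lam * y t + F t)))).
{ intros t; evar_last; [apply (is_derive_mult y y t); [apply Hd|apply Hd|]|].
  - intros; apply Rmult_comm.
  - unfold plus, mult; simpl; ring. }
destruct (periodic_max T (fun t => y t * y t) HT) as [t0 Ht0].
{ intros t; now rewrite Hp. }
{ intros t; eapply is_derive_cont, Hd2. }
assert (Hle : forall t, Rabs (y t) <= Rabs (y t0)).
{ intros t; apply Rsqr_le_abs_0, Ht0. }
assert (Hz := is_derive_max_zero _ _ _ (Hd2 t0) Ht0).
assert (Hpos : 0 < Rabs lam) by now apply Rabs_pos_lt.
intros t; eapply Rle_trans; [apply Hle|].
apply Rmult_le_reg_r with (Rabs lam); [exact Hpos|].
replace (M / Rabs lam * Rabs lam) with M by (field; lra).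
rewrite <- Rabs_mult.
specialize (Hom t0); specialize (HF t0).
destruct (Req_dec (y t0) 0) as [H0|H0].
- rewrite H0, Rmult_0_l, Rabs_R0; eapply Rle_trans; [apply Rabs_pos|exact HF].
- assert (lam * y t0 + F t0 = 0).
  { destruct (Rmult_integral _ _ Hz) as [H1|H1]; [lra|].
    destruct (Rmult_integral _ _ H1); lra. }
  replace (y t0 * lam) with (- F t0) by lra; now rewrite Rabs_Ropp.
Qed.

(** * The periodic inverse of [d/dt - lam] *)

Definition prim (f : R -> R) (x : R) : R := RInt f 0 x.

Lemma cont_ex_RInt (f : R -> R) a b : (forall t, continuous f t) -> ex_RInt f a b.
Proof. intros Hc; apply (ex_RInt_continuous (V := R_CompleteNormedModule)); auto. Qed.

Lemma prim_derive (f : R -> R) x :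
  (forall t, continuous f t) -> is_derive (prim f) x (f x).
Proof.
intros Hc; apply (is_derive_RInt (V := R_NormedModule) f (prim f) 0 x).
- apply filter_forall; intros b.
  apply (RInt_correct (V := R_CompleteNormedModule)), cont_ex_RInt, Hc.
- apply Hc.
Qed.

Lemma prim_diff (f : R -> R) a b :
  (forall t, continuous f t) -> RInt f a b = prim f b - prim f a.
Proof.
intros Hc; unfold prim.
assert (H := RInt_Chasles (V := R_CompleteNormedModule) f 0 a b
               (cont_ex_RInt f 0 a Hc) (cont_ex_RInt f a b Hc)).
unfold plus in H; simpl in H; lra.
Qed.

Lemma zero_derive_const (f : R -> R) :
  (forall t, is_derive f t 0) -> forall a b, f a = f b.
Proof.
intros Hd.
assert (Hlt : forall a b, a < b -> f a = f b).
{ intros a b Hab; apply (eq_is_derive (V := R_NormedModule) f a b); auto. }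
intros a b; destruct (Rtotal_order a b) as [H|[H|H]].
- now apply Hlt.
- now rewrite H.
- symmetry; now apply Hlt.
Qed.

Lemma is_derive_shift (f : R -> R) T x l :
  is_derive f (x + T) l -> is_derive (fun t => f (t + T)) x l.
Proof.
intros H; evar_last.
- apply (is_derive_comp f (fun t => t + T)); [exact H|].
  apply (is_derive_plus (fun t => t) (fun _ => T)); [apply is_derive_id|apply is_derive_const].
- unfold scal, plus, one, zero; simpl; unfold mult; simpl; ring.
Qed.

Lemma continuous_shift (f : R -> R) T :
  (forall t, continuous f t) -> forall t, continuous (fun t => f (t + T)) t.
Proof.
intros Hc t; apply (continuous_comp (fun t => t + T) f); [|apply Hc].
apply (continuous_plus (fun t => t) (fun _ => T)); [apply continuous_id|apply continuous_const].
Qed.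

Lemma prim_shift (f : R -> R) T x :
  (forall t, continuous f t) ->
  prim f (x + T) - prim f T = prim (fun t => f (t + T)) x.
Proof.
intros Hc.
pose (D := fun x => prim f (x + T) - prim (fun t => f (t + T)) x).
assert (H : D x = D 0).
{ apply zero_derive_const; intros t; unfold D; evar_last.
  - apply (is_derive_minus (fun x => prim f (x + T))).
    + apply is_derive_shift, prim_derive, Hc.
    + apply prim_derive, continuous_shift, Hc.
  - unfold minus, plus, opp; simpl; ring. }
unfold D in H.
replace (prim (fun t => f (t + T)) 0) with 0 in H
  by (unfold prim; now rewrite RInt_point).
replace (0 + T) with T in H by ring; lra.
Qed.

Lemma prim_periodic (f : R -> R) T :
  periodic T f -> (forall t, continuous f t) -> prim f T = 0 ->
  periodic T (prim f).
Proof.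
intros Hp Hc H0 x.
assert (H := prim_shift f T x Hc).
rewrite H0 in H.
replace (prim (fun t => f (t + T)) x) with (prim f x) in H; [lra|].
unfold prim; apply RInt_ext; intros t _; symmetry; apply Hp.
Qed.

(** The integral of [exp (lam * (x - .)) * f] over one period starting at [x],
    normalised so that it solves [y' = lam * y + f]; being an integral over a moving
    period, it is periodic as soon as [f] is. *)
Definition periodic_inverse (T lam : R) (f : R -> R) (x : R) : R :=
  / (exp (- lam * T) - 1) * exp (lam * x) *
  (prim (fun s => exp (- lam * s) * f s) (x + T) -
   prim (fun s => exp (- lam * s) * f s) x).

Lemma is_derive_exp_scal lam x : is_derive (fun x => exp (lam * x)) x (lam * exp (lam * x)).
Proof. auto_derive; [trivial|ring]. Qed.

Lemma continuous_exp_mult lam (f : R -> R) :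
  (forall t, continuous f t) -> forall t, continuous (fun s => exp (- lam * s) * f s) t.
Proof.
intros Hc t; apply (continuous_mult (fun s => exp (- lam * s)) f); [|apply Hc].
eapply is_derive_cont, is_derive_exp_scal.
Qed.

Lemma exp_neq_1 x : x <> 0 -> exp x <> 1.
Proof. intros Hx H; apply Hx, exp_inv; now rewrite exp_0. Qed.

Lemma periodic_inverse_derive T lam f x :
  0 < T -> lam <> 0 -> periodic T f -> (forall t, continuous f t) ->
  is_derive (periodic_inverse T lam f) x (lam * periodic_inverse T lam f x + f x).
Proof.
intros HT Hl Hp Hc; unfold periodic_inverse.
set (g := fun s => exp (- lam * s) * f s).
assert (Hg : forall t, continuous g t) by now apply continuous_exp_mult.
assert (HlT : exp (- lam * T) <> 1).
{ apply exp_neq_1; intros H; destruct (Rmult_integral _ _ H); lra. }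
evar_last.
- apply (is_derive_mult (fun x => / (exp (- lam * T) - 1) * exp (lam * x))
           (fun x => prim g (x + T) - prim g x)).
  + apply (is_derive_scal (fun x => exp (lam * x))), is_derive_exp_scal.
  + apply (is_derive_minus (fun x => prim g (x + T)) (prim g)).
    * apply is_derive_shift, prim_derive, Hg.
    * apply prim_derive, Hg.
  + intros; apply Rmult_comm.
- unfold plus, mult, minus, opp; simpl; unfold plus, mult, opp; simpl.
  unfold g at 3 4; rewrite Hp.
  replace (exp (- lam * (x + T))) with (exp (- lam * T) * exp (- lam * x))
    by (rewrite <- exp_plus; f_equal; ring).
  assert (He : exp (lam * x) * exp (- lam * x) = 1)
    by (rewrite <- exp_plus, <- exp_0; f_equal; ring).
  replace (f x) with (f x * (exp (lam * x) * exp (- lam * x))) at 3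
    by (rewrite He; ring).
  field; lra.
Qed.

Lemma periodic_inverse_periodic T lam f :
  periodic T f -> (forall t, continuous f t) -> periodic T (periodic_inverse T lam f).
Proof.
intros Hp Hc x; unfold periodic_inverse.
set (g := fun s => exp (- lam * s) * f s).
assert (Hg : forall t, continuous g t) by now apply continuous_exp_mult.
assert (Hs : forall y, prim g (y + T) - prim g T = exp (- lam * T) * prim g y).
{ intros y; rewrite prim_shift by exact Hg.
  unfold prim.
  rewrite <- (RInt_scal (V := R_CompleteNormedModule)) by apply cont_ex_RInt, Hg.
  apply RInt_ext; intros t _; unfold g, scal; simpl; unfold mult; simpl.
  rewrite Hp, <- Rmult_assoc, <- exp_plus; f_equal; f_equal; ring. }
assert (H1 := Hs (x + T)); assert (H2 := Hs x).
replace (prim g (x + T + T) - prim g (x + T))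
  with (exp (- lam * T) * (prim g (x + T) - prim g x)) by lra.
replace (lam * (x + T)) with (lam * x + lam * T) by ring.
rewrite exp_plus.
replace (exp (- lam * T)) with (/ exp (lam * T)) at 2
  by (rewrite <- exp_Ropp; f_equal; ring).
assert (0 < exp (lam * T)) by apply exp_pos.
generalize (/ (exp (- lam * T) - 1)); intros c; field; lra.
Qed.

Lemma periodic_inverse_bound T lam M f :
  0 < T -> lam <> 0 -> periodic T f -> (forall t, continuous f t) ->
  (forall t, Rabs (f t) <= M) ->
  forall x, Rabs (periodic_inverse T lam f x) <= M / Rabs lam.
Proof.
intros HT Hl Hp Hc HM.
apply (maximum_principle T lam M _ (fun _ => 1) f); auto.
- now apply periodic_inverse_periodic.
- intros; lra.
- intros t; rewrite Rmult_1_l; now apply periodic_inverse_derive.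
Qed.

Lemma periodic_inverse_diff T lam M f g :
  0 < T -> lam <> 0 -> periodic T f -> periodic T g ->
  (forall t, continuous f t) -> (forall t, continuous g t) ->
  (forall t, Rabs (f t - g t) <= M) ->
  forall x, Rabs (periodic_inverse T lam f x - periodic_inverse T lam g x) <= M / Rabs lam.
Proof.
intros HT Hl Hf Hg Cf Cg HM.
apply (maximum_principle T lam M _ (fun _ => 1) (fun t => f t - g t)); auto.
- intros t; now rewrite !periodic_inverse_periodic.
- intros; lra.
- intros t; rewrite Rmult_1_l; evar_last.
  + apply (is_derive_minus (periodic_inverse T lam f) (periodic_inverse T lam g));
      now apply periodic_inverse_derive.
  + unfold minus, plus, opp; simpl; ring.
Qed.

(** * Geometric convergence of functions *)

Lemma geometric_limit (a : nat -> R) C :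
  (forall n, Rabs (a (S n) - a n) <= C * (/ 2) ^ n) ->
  exists l, forall n, Rabs (a n - l) <= 2 * C * (/ 2) ^ n.
Proof.
intros H.
assert (Hs : forall n k, Rabs (a (n + k)%nat - a n) <= 2 * C * ((/ 2) ^ n - (/ 2) ^ (n + k))).
{ intros n k; induction k as [|k IH].
  - rewrite Nat.add_0_r, !Rminus_diag, Rabs_R0; lra.
  - rewrite Nat.add_succ_r; simpl.
    replace (a (S (n + k)) - a n) with ((a (S (n + k)) - a (n + k)%nat) + (a (n + k)%nat - a n)) by ring.
    eapply Rle_trans; [apply Rabs_triang|].
    specialize (H (n + k)%nat); lra. }
assert (HC : 0 <= C).
{ specialize (H 0%nat); simpl in H; assert (Hp := Rabs_pos (a 1%nat - a 0%nat)); lra. }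
assert (Hpow : forall n, 0 < (/ 2) ^ n) by (intros; apply pow_lt; lra).
assert (Hs2 : forall n k, Rabs (a (n + k)%nat - a n) <= 2 * C * (/ 2) ^ n).
{ intros n k; eapply Rle_trans; [apply Hs|].
  apply Rmult_le_compat_l; [lra|]. specialize (Hpow (n + k)%nat); lra. }
assert (Hlim : is_lim_seq (fun n => 2 * C * (/ 2) ^ n) 0).
{ replace (Finite 0) with (Rbar_mult (2 * C) 0) by (simpl; f_equal; ring).
  apply is_lim_seq_scal_l, is_lim_seq_geom; rewrite Rabs_pos_eq; lra. }
assert (Hex : ex_finite_lim_seq a).
{ apply ex_lim_seq_cauchy_corr; intros eps.
  apply is_lim_seq_spec in Hlim; destruct (Hlim (mkposreal (eps / 2) (is_pos_div_2 eps))) as [N HN].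
  exists N; intros n m Hn Hm.
  specialize (HN N (Nat.le_refl N)); simpl in HN; rewrite Rminus_0_r in HN.
  assert (H1 := Hs2 N (n - N)%nat); assert (H2 := Hs2 N (m - N)%nat).
  replace (N + (n - N))%nat with n in H1 by lia.
  replace (N + (m - N))%nat with m in H2 by lia.
  replace (a n - a m) with ((a n - a N) - (a m - a N)) by ring.
  eapply Rle_lt_trans; [apply Rabs_triang|]; rewrite Rabs_Ropp.
  apply Rabs_def2 in HN; lra. }
destruct Hex as [l Hl]; exists l; intros n.
assert (Hl2 : is_lim_seq (fun k => Rabs (a n - a (k + n)%nat)) (Rabs (a n - l))).
{ apply (is_lim_seq_abs _ (a n - l)).
  apply is_lim_seq_minus'; [apply is_lim_seq_const|].
  now apply (is_lim_seq_incr_n a n l). }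
assert (Hle : Rbar_le (Rabs (a n - l)) (2 * C * (/ 2) ^ n)); [|exact Hle].
eapply is_lim_seq_le; [|exact Hl2|apply is_lim_seq_const].
intros k; simpl; rewrite Rabs_minus_sym, Nat.add_comm; apply Hs2.
Qed.

Lemma half_pow_small C eta : 0 < eta -> exists n : nat, C * (/ 2) ^ n < eta.
Proof.
intros He.
assert (Hlim : is_lim_seq (fun n => C * (/ 2) ^ n) 0).
{ replace (Finite 0) with (Rbar_mult C 0) by (simpl; f_equal; ring).
  apply is_lim_seq_scal_l, is_lim_seq_geom; rewrite Rabs_pos_eq; lra. }
apply is_lim_seq_spec in Hlim; destruct (Hlim (mkposreal eta He)) as [N HN].
exists N; specialize (HN N (Nat.le_refl N)); simpl in HN; rewrite Rminus_0_r in HN.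
apply Rabs_def2 in HN; lra.
Qed.

Lemma uniform_limit_continuous (a : nat -> R -> R) (l : R -> R) C :
  (forall n t, continuous (a n) t) ->
  (forall n t, Rabs (a n t - l t) <= C * (/ 2) ^ n) ->
  forall t, continuous l t.
Proof.
intros Hc Hl t; apply filterlim_locally; intros eps.
assert (He : 0 < eps / 3) by (assert (H := cond_pos eps); lra).
destruct (half_pow_small C (eps / 3) He) as [n Hn].
assert (H := Hc n t); apply (proj1 (filterlim_locally _ _)) with (eps := mkposreal _ He) in H.
eapply filter_imp; [|exact H]; intros x Hx.
change (Rabs (a n x - a n t) < eps / 3) in Hx.
change (Rabs (l x - l t) < eps).
assert (H1 := Hl n x); assert (H2 := Hl n t).
replace (l x - l t) with ((a n x - a n t) - (a n x - l x) + (a n t - l t)) by ring.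
eapply Rle_lt_trans; [apply Rabs_triang|].
assert (H3 := Rabs_triang (a n x - a n t) (- (a n x - l x))); rewrite Rabs_Ropp in H3.
unfold Rminus in *; lra.
Qed.

(** * Weakly coupled systems: existence and uniqueness of loops *)

Definition half_loop (T : R) (u : R -> R) : Prop :=
  periodic T u /\ (forall t, continuous u t) /\ (forall t, Rabs (u t) <= / 2).

Section System.
Variables (T l1 l2 : R) (F1 F2 : R -> R -> R -> R).
Hypothesis period_pos : 0 < T.

(** [F] stays a small fraction of the linear term [l * u] it is added to, and so does
    its variation; the fractions 1/2 and 1/4 make the inverse of [d/dt - l] preserve
    loops bounded by 1/2 and contract by 1/2.  The bounds are asked on the larger box
    of size 1 so that competitors near a loop are covered by the uniqueness result. *)
Record weakly_coupled (l : R) (F : R -> R -> R -> R) : Prop := {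
  wc_neq : l <> 0;
  wc_periodic : forall t u v, F (t + T) u v = F t u v;
  wc_continuous : forall u v : R -> R,
    (forall t, continuous u t) -> (forall t, continuous v t) ->
    (forall t, Rabs (u t) <= / 2) -> (forall t, Rabs (v t) <= / 2) ->
    forall t, continuous (fun t => F t (u t) (v t)) t;
  wc_bound : forall t u v, Rabs u <= 1 -> Rabs v <= 1 -> Rabs (F t u v) <= Rabs l / 2;
  wc_lip : forall t u v u' v',
    Rabs u <= 1 -> Rabs v <= 1 -> Rabs u' <= 1 -> Rabs v' <= 1 ->
    Rabs (F t u v - F t u' v') <= Rabs l / 4 * (Rabs (u - u') + Rabs (v - v')) }.

Definition update (l : R) (F : R -> R -> R -> R) (u v : R -> R) : R -> R :=
  periodic_inverse T l (fun t => F t (u t) (v t)).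

Lemma wc_loop l F u v :
  weakly_coupled l F -> half_loop T u -> half_loop T v ->
  periodic T (fun t => F t (u t) (v t)) /\
  (forall t, continuous (fun t => F t (u t) (v t)) t).
Proof.
intros W [Pu [Cu Bu]] [Pv [Cv Bv]]; split.
- intros t; now rewrite Pu, Pv, (wc_periodic _ _ W).
- now apply (wc_continuous _ _ W).
Qed.

Lemma update_derive l F u v :
  weakly_coupled l F -> half_loop T u -> half_loop T v ->
  forall t, is_derive (update l F u v) t (l * update l F u v t + F t (u t) (v t)).
Proof.
intros W Hu Hv t; destruct (wc_loop l F u v W Hu Hv) as [HP HC].
apply (periodic_inverse_derive T l (fun t => F t (u t) (v t)));
  auto; apply (wc_neq _ _ W).
Qed.

Lemma update_loop l F u v :
  weakly_coupled l F -> half_loop T u -> half_loop T v -> half_loop T (update l F u v).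
Proof.
intros W Hu Hv; destruct (wc_loop l F u v W Hu Hv) as [HP HC].
assert (Hl := wc_neq _ _ W); assert (Hl' := Rabs_pos_lt _ Hl).
split; [|split].
- now apply periodic_inverse_periodic.
- intros t; eapply is_derive_cont, update_derive; eassumption.
- intros t; unfold update.
  replace (/ 2) with (Rabs l / 2 / Rabs l) by (field; lra).
  apply periodic_inverse_bound; auto.
  destruct Hu as [_ [_ Bu]], Hv as [_ [_ Bv]].
  intros x; apply (wc_bound _ _ W);
    [specialize (Bu x)|specialize (Bv x)]; lra.
Qed.

Lemma update_contracts l F u v u' v' M :
  weakly_coupled l F -> half_loop T u -> half_loop T v ->
  half_loop T u' -> half_loop T v' ->
  (forall t, Rabs (u t - u' t) <= M) -> (forall t, Rabs (v t - v' t) <= M) ->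
  forall t, Rabs (update l F u v t - update l F u' v' t) <= M * / 2.
Proof.
intros W Hu Hv Hu' Hv' Mu Mv t.
destruct (wc_loop l F u v W Hu Hv) as [HP HC].
destruct (wc_loop l F u' v' W Hu' Hv') as [HP' HC'].
assert (Hl := wc_neq _ _ W); assert (Hl' := Rabs_pos_lt _ Hl).
replace (M * / 2) with (Rabs l / 4 * (M + M) / Rabs l) by (field; lra).
apply periodic_inverse_diff; auto.
destruct Hu as [_ [_ Bu]], Hv as [_ [_ Bv]], Hu' as [_ [_ Bu']], Hv' as [_ [_ Bv']].
intros x.
specialize (Bu x); specialize (Bv x); specialize (Bu' x); specialize (Bv' x).
eapply Rle_trans; [apply (wc_lip _ _ W); lra|].
apply Rmult_le_compat_l; [lra|]; specialize (Mu x); specialize (Mv x); lra.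
Qed.

Hypothesis W1 : weakly_coupled l1 F1.
Hypothesis W2 : weakly_coupled l2 F2.

Fixpoint picard (n : nat) : (R -> R) * (R -> R) :=
  match n with
  | O => (fun _ => 0, fun _ => 0)
  | S n => (update l1 F1 (fst (picard n)) (snd (picard n)),
            update l2 F2 (fst (picard n)) (snd (picard n)))
  end.

Lemma picard_loop n : half_loop T (fst (picard n)) /\ half_loop T (snd (picard n)).
Proof.
induction n as [|n [IH1 IH2]]; simpl.
- assert (H : half_loop T (fun _ => 0)); [|now split].
  split; [|split]; [now intros t|intros t; apply continuous_const|].
  intros t; rewrite Rabs_R0; lra.
- split; now apply update_loop.
Qed.

Lemma picard_step n t :
  Rabs (fst (picard (S n)) t - fst (picard n) t) <= / 2 * (/ 2) ^ n /\
  Rabs (snd (picard (S n)) t - snd (picard n) t) <= / 2 * (/ 2) ^ n.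
Proof.
revert t; induction n as [|n IH]; intros t.
- destruct (picard_loop 1) as [[_ [_ H1]] [_ [_ H2]]].
  specialize (H1 t); specialize (H2 t).
  change (fst (picard 0) t) with 0; change (snd (picard 0) t) with 0.
  rewrite !Rminus_0_r; simpl pow; lra.
- destruct (picard_loop n) as [A1 A2]; destruct (picard_loop (S n)) as [B1 B2].
  replace (/ 2 * (/ 2) ^ S n) with (/ 2 * (/ 2) ^ n * / 2) by (simpl; ring).
  split.
  + apply (update_contracts l1 F1 (fst (picard (S n))) (snd (picard (S n)))
             (fst (picard n)) (snd (picard n))); auto; intros x; apply IH.
  + apply (update_contracts l2 F2 (fst (picard (S n))) (snd (picard (S n)))
             (fst (picard n)) (snd (picard n))); auto; intros x; apply IH.
Qed.

Lemma limit_loop (a : nat -> R -> R) l :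
  (forall n, half_loop T (a n)) ->
  (forall n t, Rabs (a n t - l t) <= 2 * / 2 * (/ 2) ^ n) -> half_loop T l.
Proof.
intros Ha Hl.
split; [|split].
- intros t; apply cond_eq; intros eps He.
  destruct (half_pow_small (2 * / 2) (eps / 2)) as [n Hn]; [lra|].
  assert (H1 := Hl n (t + T)); assert (H2 := Hl n t).
  rewrite (proj1 (Ha n)) in H1.
  replace (l (t + T) - l t) with ((a n t - l t) - (a n t - l (t + T))) by ring.
  eapply Rle_lt_trans; [apply Rabs_triang|]; rewrite Rabs_Ropp; lra.
- apply uniform_limit_continuous with (a := a) (C := 2 * / 2); [|exact Hl].
  intros n; apply (Ha n).
- intros t; apply Rnot_lt_le; intros Hlt.
  destruct (half_pow_small (2 * / 2) (Rabs (l t) - / 2)) as [n Hn]; [lra|].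
  destruct (Ha n) as [_ [_ B]]; specialize (B t); specialize (Hl n t).
  replace (l t) with (a n t - (a n t - l t)) in Hn at 1 by ring.
  assert (Ht := Rabs_triang (a n t) (- (a n t - l t))); rewrite Rabs_Ropp in Ht.
  unfold Rminus in *; lra.
Qed.

(** The limit of the iterates is not differentiated: it is continuous, hence
    may be updated once more, and the update is close to all late iterates, so it is
    the limit itself and inherits the differential equation from [update]. *)
Lemma limit_fixed l F (a u v : nat -> R -> R) au uu vv :
  weakly_coupled l F ->
  (forall n, half_loop T (u n)) -> (forall n, half_loop T (v n)) ->
  half_loop T uu -> half_loop T vv ->
  (forall n t, Rabs (u n t - uu t) <= 2 * / 2 * (/ 2) ^ n) ->
  (forall n t, Rabs (v n t - vv t) <= 2 * / 2 * (/ 2) ^ n) ->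
  (forall n t, Rabs (a n t - au t) <= 2 * / 2 * (/ 2) ^ n) ->
  (forall n, a (S n) = update l F (u n) (v n)) ->
  forall t, au t = update l F uu vv t.
Proof.
intros W Hu Hv Huu Hvv Lu Lv La Ha t; apply cond_eq; intros eps He.
destruct (half_pow_small (2 * / 2) eps He) as [n Hn].
assert (H1 := La (S n) t); rewrite Ha in H1.
assert (H2 := update_contracts l F (u n) (v n) uu vv _ W (Hu n) (Hv n) Huu Hvv
                (Lu n) (Lv n) t).
replace (2 * / 2 * (/ 2) ^ S n) with (2 * / 2 * (/ 2) ^ n * / 2) in H1 by (simpl; ring).
replace (au t - update l F uu vv t) with
  ((update l F (u n) (v n) t - update l F uu vv t) - (update l F (u n) (v n) t - au t)) by ring.
eapply Rle_lt_trans; [apply Rabs_triang|]; rewrite Rabs_Ropp; lra.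
Qed.

Lemma weakly_coupled_periodic_solution :
  exists u v, half_loop T u /\ half_loop T v /\
    (forall t, is_derive u t (l1 * u t + F1 t (u t) (v t))) /\
    (forall t, is_derive v t (l2 * v t + F2 t (u t) (v t))).
Proof.
destruct (functional_choice (fun t l => forall n, Rabs (fst (picard n) t - l) <= 2 * / 2 * (/ 2) ^ n))
  as [u Hu].
{ intros t; apply geometric_limit; intros n; apply picard_step. }
destruct (functional_choice (fun t l => forall n, Rabs (snd (picard n) t - l) <= 2 * / 2 * (/ 2) ^ n))
  as [v Hv].
{ intros t; apply geometric_limit; intros n; apply picard_step. }
assert (Lu : half_loop T u).
{ apply limit_loop with (fun n => fst (picard n)); [intros n; apply picard_loop|auto]. }
assert (Lv : half_loop T v).
{ apply limit_loop with (fun n => snd (picard n)); [intros n; apply picard_loop|auto]. }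
assert (Eu : forall t, u t = update l1 F1 u v t).
{ apply limit_fixed with (a := fun n => fst (picard n)) (u := fun n => fst (picard n))
    (v := fun n => snd (picard n)); auto; intros n; apply picard_loop. }
assert (Ev : forall t, v t = update l2 F2 u v t).
{ apply limit_fixed with (a := fun n => snd (picard n)) (u := fun n => fst (picard n))
    (v := fun n => snd (picard n)); auto; intros n; apply picard_loop. }
exists u, v; split; [exact Lu|split; [exact Lv|split]]; intros t.
- apply (is_derive_ext (update l1 F1 u v) u); [intros; symmetry; apply Eu|].
  rewrite (Eu t) at 1; now apply update_derive.
- apply (is_derive_ext (update l2 F2 u v) v); [intros; symmetry; apply Ev|].
  rewrite (Ev t) at 1; now apply update_derive.
Qed.

(** The period [S] of the difference is unrelated to the period [T] of the system, and
    [th] may turn any number of times during [S]: only the maxima of the two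
    differences are compared. *)
Lemma weakly_coupled_unique (S : R) (th om u v u' v' : R -> R) :
  0 < S -> (forall t, 0 < om t) ->
  (forall t, Rabs (u t) <= 1) -> (forall t, Rabs (v t) <= 1) ->
  (forall t, Rabs (u' t) <= 1) -> (forall t, Rabs (v' t) <= 1) ->
  periodic S (fun t => u t - u' t) -> periodic S (fun t => v t - v' t) ->
  (forall t, is_derive u t (om t * (l1 * u t + F1 (th t) (u t) (v t)))) ->
  (forall t, is_derive v t (om t * (l2 * v t + F2 (th t) (u t) (v t)))) ->
  (forall t, is_derive u' t (om t * (l1 * u' t + F1 (th t) (u' t) (v' t)))) ->
  (forall t, is_derive v' t (om t * (l2 * v' t + F2 (th t) (u' t) (v' t)))) ->
  forall t, u t = u' t /\ v t = v' t.
Proof.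
intros HS Hom Bu Bv Bu' Bv' Pu Pv Du Dv Du' Dv'.
assert (Aux : forall a b : R -> R, (forall t, is_derive a t (b t)) -> forall t, continuous a t).
{ intros a b H t; eapply is_derive_cont, H. }
assert (Hmax : forall f g df dg : R -> R, (forall t, is_derive f t (df t)) ->
  (forall t, is_derive g t (dg t)) -> periodic S (fun t => f t - g t) ->
  exists t0, forall t, Rabs (f t - g t) <= Rabs (f t0 - g t0)).
{ intros f g df dg Df Dg P.
  apply (periodic_max S (fun t => Rabs (f t - g t)) HS).
  - intros t; cbv beta. now rewrite (P t).
  - intros t; apply (continuous_comp (fun t => f t - g t) Rabs); [|apply continuous_Rabs].
    apply (continuous_minus f g); eapply Aux; eauto. }
destruct (Hmax _ _ _ _ Du Du' Pu) as [a Ha].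
destruct (Hmax _ _ _ _ Dv Dv' Pv) as [b Hb].
set (A := Rabs (u a - u' a)) in *; set (B := Rabs (v b - v' b)) in *.
assert (Hgen : forall l F (f g : R -> R), weakly_coupled l F -> periodic S (fun t => f t - g t) ->
  (forall t, is_derive f t (om t * (l * f t + F (th t) (u t) (v t)))) ->
  (forall t, is_derive g t (om t * (l * g t + F (th t) (u' t) (v' t)))) ->
  forall t, Rabs (f t - g t) <= (A + B) / 4).
{ intros l F f g W P Df Dg.
  assert (Hl := Rabs_pos_lt _ (wc_neq _ _ W)).
  replace ((A + B) / 4) with (Rabs l / 4 * (A + B) / Rabs l) by (field; lra).
  apply (maximum_principle S l _ (fun t => f t - g t) om
           (fun t => F (th t) (u t) (v t) - F (th t) (u' t) (v' t))); auto.
  - apply (wc_neq _ _ W).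
  - intros t; eapply Rle_trans; [now apply (wc_lip _ _ W)|].
    apply Rmult_le_compat_l; [lra|]; specialize (Ha t); specialize (Hb t); lra.
  - intros t; evar_last; [apply (is_derive_minus f g); auto|].
    unfold minus, plus, opp; simpl; ring. }
assert (HA := Hgen _ _ _ _ W1 Pu Du Du').
assert (HB := Hgen _ _ _ _ W2 Pv Dv Dv').
assert (HA0 := Rabs_pos (u a - u' a)); assert (HB0 := Rabs_pos (v b - v' b)).
assert (HAa := HA a); assert (HBb := HB b); fold A in HAa, HA0; fold B in HBb, HB0.
intros t; split; apply Rminus_diag_uniq; apply Rabs_eq_0.
- apply Rle_antisym; [eapply Rle_trans; [apply HA|lra]|apply Rabs_pos].
- apply Rle_antisym; [eapply Rle_trans; [apply HB|lra]|apply Rabs_pos].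
Qed.

End System.

(** * Calculus of one-variable functions *)

Lemma cont_plus (f g : R -> R) t :
  continuous f t -> continuous g t -> continuous (fun t => f t + g t) t.
Proof. exact (continuous_plus f g t). Qed.
Lemma cont_minus (f g : R -> R) t :
  continuous f t -> continuous g t -> continuous (fun t => f t - g t) t.
Proof. exact (continuous_minus f g t). Qed.
Lemma cont_mult (f g : R -> R) t :
  continuous f t -> continuous g t -> continuous (fun t => f t * g t) t.
Proof. exact (continuous_mult f g t). Qed.
Lemma cont_opp (f : R -> R) t : continuous f t -> continuous (fun t => - f t) t.
Proof. exact (continuous_opp f t). Qed.
Lemma cont_const (c t : R) : continuous (fun _ : R => c) t.
Proof. apply continuous_const. Qed.
Lemma cont_inv (f : R -> R) t :
  f t <> 0 -> continuous f t -> continuous (fun t => / f t) t.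
Proof. intros H Hf; now apply (continuous_comp f Rinv); [|apply continuous_Rinv]. Qed.
Lemma cont_cos t : continuous (fun t => cos t) t.
Proof. apply continuous_cos. Qed.
Lemma cont_sin t : continuous (fun t => sin t) t.
Proof. apply continuous_sin. Qed.
Lemma cont_exp (f : R -> R) t : continuous f t -> continuous (fun t => exp (f t)) t.
Proof. intros H; now apply (continuous_comp f exp); [|apply continuous_exp]. Qed.

Lemma is_derive_cos_comp (th : R -> R) (t l : R) :
  is_derive th t l -> is_derive (fun t => cos (th t)) t (- l * sin (th t)).
Proof.
intros H; evar_last; [apply (is_derive_comp cos th); [apply is_derive_cos|exact H]|].
unfold scal; simpl; unfold mult; simpl; ring.
Qed.

Lemma is_derive_sin_comp (th : R -> R) (t l : R) :
  is_derive th t l -> is_derive (fun t => sin (th t)) t (l * cos (th t)).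
Proof.
intros H; evar_last; [apply (is_derive_comp sin th); [apply is_derive_sin|exact H]|].
unfold scal; simpl; unfold mult; simpl; ring.
Qed.

Lemma is_derive_Rmult (f g : R -> R) (t df dg : R) :
  is_derive f t df -> is_derive g t dg -> is_derive (fun t => f t * g t) t (df * g t + f t * dg).
Proof. intros Hf Hg; apply (is_derive_mult f g t); auto; intros; apply Rmult_comm. Qed.

Lemma is_derive_Rplus (f g : R -> R) (t df dg : R) :
  is_derive f t df -> is_derive g t dg -> is_derive (fun t => f t + g t) t (df + dg).
Proof. apply (is_derive_plus f g). Qed.

Lemma is_derive_Rminus (f g : R -> R) (t df dg : R) :
  is_derive f t df -> is_derive g t dg -> is_derive (fun t => f t - g t) t (df - dg).
Proof. apply (is_derive_minus f g). Qed.

Lemma is_derive_Rcomp (f g : R -> R) (t df dg : R) :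
  is_derive f (g t) df -> is_derive g t dg -> is_derive (fun t => f (g t)) t (dg * df).
Proof. intros Hf Hg; apply (is_derive_comp f g t df dg); auto. Qed.

Lemma is_derive_eq (f : R -> R) (t l l' : R) : is_derive f t l -> l = l' -> is_derive f t l'.
Proof. now intros H <-. Qed.

Lemma Rabs_mult_le a b A B : Rabs a <= A -> Rabs b <= B -> Rabs (a * b) <= A * B.
Proof. intros; rewrite Rabs_mult; apply Rmult_le_compat; auto using Rabs_pos. Qed.

Definition dz_poly3 (d : nat) (a : nat -> nat -> nat -> R) (x y z : R) : R :=
  sum_n (fun i => sum_n (fun j => sum_n (fun k =>
    a i j k * x ^ i * y ^ j * (INR k * z ^ pred k)) (d - i - j)) (d - i)) d.

Lemma continuous_pow (f : R -> R) k t :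
  continuous f t -> continuous (fun t => f t ^ k) t.
Proof.
intros H; induction k as [|k IH]; simpl; [apply continuous_const|].
now apply (continuous_mult f (fun t => f t ^ k)).
Qed.

Lemma continuous_sum_n (F : nat -> R -> R) d t :
  (forall k, continuous (F k) t) -> continuous (fun t => sum_n (fun k => F k t) d) t.
Proof.
intros H; induction d as [|d IH].
- apply (continuous_ext (F 0%nat)); [intros; now rewrite sum_O|apply H].
- apply (continuous_ext (fun t => plus (sum_n (fun k => F k t) d) (F (S d) t)));
    [intros; now rewrite sum_Sn|].
  now apply (continuous_plus (fun t => sum_n (fun k => F k t) d)).
Qed.

Lemma continuous_poly3 d a (X Y Z : R -> R) t :
  continuous X t -> continuous Y t -> continuous Z t ->
  continuous (fun t => poly3 d a (X t, Y t, Z t)) t.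
Proof.
intros HX HY HZ; unfold poly3.
apply continuous_sum_n; intros i; apply continuous_sum_n; intros j; apply continuous_sum_n; intros k.
apply (continuous_mult (fun t => a i j k * X t ^ i * Y t ^ j) (fun t => Z t ^ k));
  [|now apply continuous_pow].
apply (continuous_mult (fun t => a i j k * X t ^ i) (fun t => Y t ^ j));
  [|now apply continuous_pow].
apply (continuous_mult (fun t => a i j k) (fun t => X t ^ i));
  [apply continuous_const|now apply continuous_pow].
Qed.

Lemma continuous_dz_poly3 d a (X Y Z : R -> R) t :
  continuous X t -> continuous Y t -> continuous Z t ->
  continuous (fun t => dz_poly3 d a (X t) (Y t) (Z t)) t.
Proof.
intros HX HY HZ; unfold dz_poly3.
apply continuous_sum_n; intros i; apply continuous_sum_n; intros j; apply continuous_sum_n; intros k.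
apply (continuous_mult (fun t => a i j k * X t ^ i * Y t ^ j) (fun t => INR k * Z t ^ pred k)).
- apply (continuous_mult (fun t => a i j k * X t ^ i) (fun t => Y t ^ j));
    [|now apply continuous_pow].
  apply (continuous_mult (fun t => a i j k) (fun t => X t ^ i));
    [apply continuous_const|now apply continuous_pow].
- apply (continuous_mult (fun t => INR k) (fun t => Z t ^ pred k));
    [apply continuous_const|now apply continuous_pow].
Qed.

(* Syntactic matching keeps [cont_plus] from applying to a [poly3], which unfolds to a
   sum. *)
Ltac cont :=
  cbv beta;
  first
  [ assumption
  | match goal with
    | |- continuous (fun t => @?f t + @?g t) _ => apply cont_plus; cont
    | |- continuous (fun t => @?f t - @?g t) _ => apply cont_minus; cont
    | |- continuous (fun t => @?f t * @?g t) _ => apply cont_mult; cont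
    | |- continuous (fun t => - @?f t) _ => apply cont_opp; cont
    | |- continuous cos _ => apply cont_cos
    | |- continuous sin _ => apply cont_sin
    | |- continuous (fun t => cos t) _ => apply cont_cos
    | |- continuous (fun t => sin t) _ => apply cont_sin
    | |- continuous (fun t => exp (@?f t)) _ => apply cont_exp; cont
    | |- continuous (fun t => poly3 _ _ (@?f t)) _ => apply continuous_poly3; cont
    | |- continuous (fun t => dz_poly3 _ _ (@?f t) (@?g t) (@?k t)) _ => apply continuous_dz_poly3; cont
    | |- continuous (fun t => ?c) _ => apply cont_const
    end
  | idtac ].
Lemma exp_half_bound x : Rabs x <= / 2 -> exp x <= 7 / 4.
Proof.
(* [exp x ^ 2 <= exp 1 <= 3 < (7/4)^2] *)
intros Hx; apply Rabs_le_between in Hx.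
assert (H1 : exp x * exp x <= 3).
{ rewrite <- exp_plus; eapply Rle_trans; [|apply exp_le_3].
  destruct (Req_dec (x + x) 1) as [->|Hn]; [lra|left; apply exp_increasing; lra]. }
assert (H := exp_pos x); nra.
Qed.

Lemma is_derive_pair (U V : NormedModule R_AbsRing) (f : R -> U) (g : R -> V) t lf lg :
  is_derive f t lf -> is_derive g t lg ->
  is_derive (fun t => (f t, g t)) t ((lf, lg) : prod_NormedModule R_AbsRing U V).
Proof.
intros Hf Hg; unfold is_derive in *.
eapply filterdiff_ext_lin.
- apply (filterdiff_comp'_2 f g (fun x y => ((x, y) : prod_NormedModule R_AbsRing U V)) t
    _ _ (fun x y => (x, y)) Hf Hg).
  apply (filterdiff_ext (fun p : prod_NormedModule R_AbsRing U V => p)); [now intros [x y]|].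
  eapply filterdiff_ext_lin; [apply filterdiff_id|]; now intros [x y].
- intros y; reflexivity.
Qed.

Lemma is_derive_fst (U V : NormedModule R_AbsRing) (f : R -> prod_NormedModule R_AbsRing U V) t l :
  is_derive f t l -> is_derive (fun t => fst (f t)) t (fst l).
Proof.
intros H; unfold is_derive in *.
eapply filterdiff_ext_lin.
- apply (filterdiff_comp' f fst t _ _ H (filterdiff_linear _ is_linear_fst)).
- reflexivity.
Qed.

Lemma is_derive_snd (U V : NormedModule R_AbsRing) (f : R -> prod_NormedModule R_AbsRing U V) t l :
  is_derive f t l -> is_derive (fun t => snd (f t)) t (snd l).
Proof.
intros H; unfold is_derive in *.
eapply filterdiff_ext_lin.
- apply (filterdiff_comp' f snd t _ _ H (filterdiff_linear _ is_linear_snd)).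
- reflexivity.
Qed.

Lemma is_derive_R3 (x y z : R -> R) t (lx ly lz : R) :
  is_derive (fun t => (x t, y t, z t) : R3) t ((lx, ly, lz) : R3) <->
  is_derive x t lx /\ is_derive y t ly /\ is_derive z t lz.
Proof.
split.
- intros H; assert (H1 := is_derive_fst _ _ _ _ _ H); assert (H2 := is_derive_snd _ _ _ _ _ H).
  assert (H3 := is_derive_fst _ _ _ _ _ H1); assert (H4 := is_derive_snd _ _ _ _ _ H1).
  now split; [|split].
- intros [Hx [Hy Hz]].
  apply (is_derive_pair _ _ (fun t => (x t, y t)) z); [|exact Hz].
  now apply (is_derive_pair _ _ x y).
Qed.

Lemma ball_R3 (P Q : R3) (d : posreal) :
  ball P d Q <-> Rabs (fst (fst Q) - fst (fst P)) < d /\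
                 Rabs (snd (fst Q) - snd (fst P)) < d /\ Rabs (snd Q - snd P) < d.
Proof.
split; [intros [[H1 H2] H3]; now split; [|split]|intros [H1 [H2 H3]]; now split; [split|]].
Qed.

(** * The circle and polar coordinates *)

Lemma cos_sin_sqr t : cos t * cos t + sin t * sin t = 1.
Proof. assert (H := sin2_cos2 t); unfold Rsqr in H; lra. Qed.

Lemma ray_nonzero r c s : r <> 0 -> c * c + s * s = 1 -> (r * c, r * s) <> (0, 0).
Proof.
intros Hr H E; injection E; intros E1 E2.
destruct (Rmult_integral _ _ E1); [lra|]; destruct (Rmult_integral _ _ E2); [lra|].
subst; lra.
Qed.

Lemma cos_Z t k : cos (t + IZR k * (2 * PI)) = cos t.
Proof. apply (periodic_Z (2 * PI) cos); intros x.
rewrite cos_plus, cos_2PI, sin_2PI; ring. Qed.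

Lemma sin_Z t k : sin (t + IZR k * (2 * PI)) = sin t.
Proof. apply (periodic_Z (2 * PI) sin); intros x. rewrite sin_plus, cos_2PI, sin_2PI; ring. Qed.

Lemma twoPI_pos : 0 < 2 * PI.
Proof. assert (H := PI_RGT_0); lra. Qed.

Lemma cos_2PI_periodic t : cos (t + 2 * PI) = cos t.
Proof. replace (t + 2 * PI) with (t + IZR 1 * (2 * PI)) by ring; apply cos_Z. Qed.
Lemma sin_2PI_periodic t : sin (t + 2 * PI) = sin t.
Proof. replace (t + 2 * PI) with (t + IZR 1 * (2 * PI)) by ring; apply sin_Z. Qed.

Lemma loop_bounded (f : R -> R) :
  periodic (2 * PI) f -> (forall t, continuous f t) -> exists K, forall t, Rabs (f t) <= K.
Proof.
intros P C; destruct (periodic_bounded _ f twoPI_pos P C) as [K [_ H]]; now exists K.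
Qed.

(** A periodic function is a uniformly continuous function of the point of the circle:
    after translating both angles by periods, two angles whose difference exceeds
    [d1] have a cosine of the difference at most [cos d1 < 1]. *)
Lemma circle_uniform (f : R -> R) :
  periodic (2 * PI) f -> (forall t, continuous f t) -> forall eta, 0 < eta ->
  exists delta, 0 < delta /\ forall al be,
    Rabs (cos al - cos be) < delta -> Rabs (sin al - sin be) < delta ->
    Rabs (f al - f be) < eta.
Proof.
intros Hp Hc eta Heta.
assert (HPI := PI_RGT_0).
destruct (Heine_cor2 (f := f) (a := - (2 * PI)) (b := 4 * PI)) with (eps := mkposreal eta Heta)
  as [d Hd].
{ intros x _; apply continuity_pt_filterlim, Hc. }
simpl in Hd.
pose (d1 := Rmin d PI).
assert (Hd1 : 0 < d1) by (apply Rmin_pos; [apply cond_pos|lra]).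
assert (Hd1d : d1 <= d) by apply Rmin_l; assert (Hd1P : d1 <= PI) by apply Rmin_r.
assert (Hcd : cos d1 < 1).
{ rewrite <- cos_0; apply cos_decreasing_1; lra. }
pose (de := Rmin 1 (1 - cos d1)).
assert (Hde : 0 < de) by (apply Rmin_pos; lra).
assert (Hde1 : de <= 1) by apply Rmin_l; assert (Hde2 : de <= 1 - cos d1) by apply Rmin_r.
exists de; split; [exact Hde|]; intros al be Hcos Hsin.
destruct (reduce_period (2 * PI) 0 be) as [j Hj]; [lra|].
destruct (reduce_period (2 * PI) (- PI) (al - be)) as [k Hk]; [lra|].
rewrite <- (periodic_Z _ _ j be Hp), <- (periodic_Z _ _ (k + j) al Hp).
rewrite plus_IZR.
set (x := al - be + IZR k * (2 * PI)) in *.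
replace (al + (IZR k + IZR j) * (2 * PI)) with (be + IZR j * (2 * PI) + x) by (unfold x; ring).
set (b := be + IZR j * (2 * PI)) in *.
assert (Hx : cos x = cos al * cos be + sin al * sin be).
{ unfold x; rewrite cos_Z; apply cos_minus. }
assert (Hsmall : 1 - cos x < de).
{ assert (A1 := cos_sin_sqr al); assert (A2 := cos_sin_sqr be).
  apply Rabs_def2 in Hcos; apply Rabs_def2 in Hsin; nra. }
assert (Hxd : Rabs x < d).
{ apply Rnot_le_lt; intros Hle.
  assert (Hc1 : cos (Rabs x) = cos x) by (unfold Rabs; destruct (Rcase_abs x); [apply cos_neg|easy]).
  assert (Hxp : Rabs x <= PI) by (apply Rabs_le; lra).
  assert (cos (Rabs x) <= cos d1) by (apply cos_decr_1; lra).
  lra. }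
apply Hd; [lra|lra|].
replace (b + x - b) with x by ring; exact Hxd.
Qed.

Lemma circle_function (f : R -> R) al be :
  periodic (2 * PI) f -> (forall t, continuous f t) ->
  cos al = cos be -> sin al = sin be -> f al = f be.
Proof.
intros Hp Hc Ec Es; apply cond_eq; intros eta Heta.
destruct (circle_uniform f Hp Hc eta Heta) as [d [Hd H]].
apply H; rewrite ?Ec, ?Es, Rminus_diag, Rabs_R0; exact Hd.
Qed.

Lemma angle_exists c s : c * c + s * s = 1 -> exists th, cos th = c /\ sin th = s.
Proof.
intros H; assert (Hc : -1 <= c <= 1) by nra.
assert (Hs : sin (acos c) = Rabs s).
{ rewrite sin_acos by exact Hc.
  replace (1 - c²) with (s²) by (unfold Rsqr; lra); apply sqrt_Rsqr_abs. }
destruct (Rle_lt_dec 0 s) as [H0|H0].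
- exists (acos c); rewrite cos_acos, Hs, Rabs_pos_eq by lra; now split.
- exists (- acos c); rewrite cos_neg, sin_neg, cos_acos, Hs, Rabs_left by lra; split; [easy|ring].
Qed.

Lemma is_derive_radius (x y : R -> R) t dx dy :
  0 < x t * x t + y t * y t -> is_derive x t dx -> is_derive y t dy ->
  is_derive (fun t => sqrt (x t * x t + y t * y t)) t
    ((x t * dx + y t * dy) / sqrt (x t * x t + y t * y t)).
Proof.
intros Hp Hx Hy.
assert (Hs := sqrt_lt_R0 _ Hp).
evar_last.
- apply (is_derive_comp sqrt (fun t => x t * x t + y t * y t)).
  + apply is_derive_sqrt; [apply is_derive_id|exact Hp].
  + apply (is_derive_plus (fun t => x t * x t) (fun t => y t * y t)).
    * apply (is_derive_mult x x); [exact Hx|exact Hx|intros; apply Rmult_comm].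
    * apply (is_derive_mult y y); [exact Hy|exact Hy|intros; apply Rmult_comm].
- unfold scal, plus, mult, one; simpl; unfold mult; simpl; field; lra.
Qed.

(** The angle is defined by integrating the angular speed.  It is correct because the
    components of the unit vector along and across the direction [th] have zero
    derivative, and are 1 and 0 at the start. *)
Lemma polar_lift (x y dx dy : R -> R) :
  (forall t, is_derive x t (dx t)) -> (forall t, is_derive y t (dy t)) ->
  (forall t, continuous dx t) -> (forall t, continuous dy t) ->
  (forall t, 0 < x t * x t + y t * y t) ->
  exists th : R -> R, forall t,
    is_derive th t ((x t * dy t - y t * dx t) / (x t * x t + y t * y t)) /\
    x t = sqrt (x t * x t + y t * y t) * cos (th t) /\
    y t = sqrt (x t * x t + y t * y t) * sin (th t).
Proof.
intros Dx Dy Cx Cy Hp.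
pose (q := fun t => x t * x t + y t * y t); pose (r := fun t => sqrt (q t)).
assert (Hr : forall t, 0 < r t) by (intros; apply sqrt_lt_R0, Hp).
assert (Hrr : forall t, r t * r t = q t) by (intros; apply sqrt_sqrt; left; apply Hp).
pose (w := fun t => (x t * dy t - y t * dx t) * / q t).
assert (Cw : forall t, continuous w t).
{ intros t; assert (X := is_derive_cont _ _ _ (Dx t)); assert (Y := is_derive_cont _ _ _ (Dy t)).
  assert (X' := Cx t); assert (Y' := Cy t).
  unfold w; cont; apply (cont_inv q); [specialize (Hp t); unfold q; lra|unfold q; cont]. }
destruct (angle_exists (x 0 / r 0) (y 0 / r 0)) as [th0 [Hc Hs]].
{ replace (x 0 / r 0 * (x 0 / r 0) + y 0 / r 0 * (y 0 / r 0)) with (q 0 / (r 0 * r 0))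
    by (unfold q; field; specialize (Hr 0); lra).
  rewrite Hrr; field; specialize (Hp 0); unfold q; lra. }
pose (th := fun t => th0 + prim w t); exists th.
assert (Dth : forall t, is_derive th t (w t)).
{ intros t; eapply is_derive_eq.
  - apply (is_derive_Rplus (fun _ => th0) (prim w)); [apply (is_derive_const th0)|now apply prim_derive].
  - apply Rplus_0_l. }
assert (Dr : forall t, is_derive (fun t => / r t) t (- ((x t * dx t + y t * dy t) / r t) / (r t) ^ 2)).
{ intros t; apply (is_derive_inv r); [now apply is_derive_radius|specialize (Hr t); lra]. }
pose (A := fun t => (x t * cos (th t) + y t * sin (th t)) * / r t).
pose (B := fun t => (y t * cos (th t) - x t * sin (th t)) * / r t).
assert (DA : forall t, is_derive A t 0).
{ intros t; eapply is_derive_eq.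
  - apply is_derive_Rmult; [|apply Dr].
    apply is_derive_Rplus; apply is_derive_Rmult.
    + apply Dx.
    + apply is_derive_cos_comp, Dth.
    + apply Dy.
    + apply is_derive_sin_comp, Dth.
  - assert (R0 := Hr t); assert (R1 := Hrr t).
    unfold w; rewrite <- R1; unfold q in R1.
    apply (Rmult_eq_reg_r (r t * (r t * r t))); [|apply Rmult_integral_contrapositive_currified; nra].
    field_simplify; [|lra].
    replace (r t ^ 2) with (x t * x t + y t * y t) by (rewrite <- R1; ring). ring. }
assert (DB : forall t, is_derive B t 0).
{ intros t; eapply is_derive_eq.
  - apply is_derive_Rmult; [|apply Dr].
    apply is_derive_Rminus; apply is_derive_Rmult.
    + apply Dy.
    + apply is_derive_cos_comp, Dth.
    + apply Dx.
    + apply is_derive_sin_comp, Dth.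
  - assert (R0 := Hr t); assert (R1 := Hrr t).
    unfold w; rewrite <- R1; unfold q in R1.
    apply (Rmult_eq_reg_r (r t * (r t * r t))); [|apply Rmult_integral_contrapositive_currified; nra].
    field_simplify; [|lra].
    replace (r t ^ 2) with (x t * x t + y t * y t) by (rewrite <- R1; ring). ring. }
assert (Hth0 : th 0 = th0) by (unfold th, prim; rewrite RInt_point; apply Rplus_0_r).
intros t; assert (R0 := Hr t); assert (R00 := Hr 0).
assert (HA : A t = 1).
{ rewrite (zero_derive_const A DA t 0); unfold A; rewrite Hth0, Hc, Hs.
  replace ((x 0 * (x 0 / r 0) + y 0 * (y 0 / r 0)) * / r 0) with (q 0 / (r 0 * r 0))
    by (unfold q; field; lra).
  rewrite Hrr; field; specialize (Hp 0); unfold q; lra. }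
assert (HB : B t = 0).
{ rewrite (zero_derive_const B DB t 0); unfold B; rewrite Hth0, Hc, Hs; field; lra. }
assert (HA' : x t * cos (th t) + y t * sin (th t) = r t).
{ apply (Rmult_eq_reg_r (/ r t)); [|apply Rinv_neq_0_compat; lra].
  change (A t = r t * / r t); rewrite HA; field; lra. }
assert (HB' : y t * cos (th t) - x t * sin (th t) = 0).
{ apply (Rmult_eq_reg_r (/ r t)); [|apply Rinv_neq_0_compat; lra].
  change (B t = 0 * / r t); rewrite HB; ring. }
assert (Hcs := cos_sin_sqr (th t)).
split; [apply Dth|]; change (sqrt (x t * x t + y t * y t)) with (r t); rewrite <- HA'.
split.
- replace (x t) with (x t * (cos (th t) * cos (th t) + sin (th t) * sin (th t))) at 1 by (rewrite Hcs; ring).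
  replace (x t * (cos (th t) * cos (th t) + sin (th t) * sin (th t))) with
    ((x t * cos (th t) + y t * sin (th t)) * cos (th t)
     - (y t * cos (th t) - x t * sin (th t)) * sin (th t)) by ring.
  rewrite HB'; ring.
- replace (y t) with (y t * (cos (th t) * cos (th t) + sin (th t) * sin (th t))) at 1 by (rewrite Hcs; ring).
  replace (y t * (cos (th t) * cos (th t) + sin (th t) * sin (th t))) with
    ((x t * cos (th t) + y t * sin (th t)) * sin (th t)
     + (y t * cos (th t) - x t * sin (th t)) * cos (th t)) by ring.
  rewrite HB'; ring.
Qed.

Lemma polar_unique r r' al be :
  0 < r -> 0 < r' -> r * cos al = r' * cos be -> r * sin al = r' * sin be ->
  r = r' /\ cos al = cos be /\ sin al = sin be.
Proof.
intros Hr Hr' Ec Es.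
assert (A := cos_sin_sqr al); assert (B := cos_sin_sqr be).
assert (E : r * r = r' * r').
{ replace (r * r) with (r * cos al * (r * cos al) + r * sin al * (r * sin al))
    by (transitivity (r * r * (cos al * cos al + sin al * sin al)); [ring|rewrite A; ring]).
  rewrite Ec, Es.
  transitivity (r' * r' * (cos be * cos be + sin be * sin be)); [ring|rewrite B; ring]. }
assert (Er : r = r') by nra.
rewrite <- Er in Ec, Es; split; [exact Er|split].
- apply (Rmult_eq_reg_l r); lra.
- apply (Rmult_eq_reg_l r); lra.
Qed.

Lemma polar_close r r' al be d :
  0 < r -> / 2 <= r' ->
  Rabs (r * cos al - r' * cos be) < d -> Rabs (r * sin al - r' * sin be) < d ->
  Rabs (r - r') <= 2 * d /\ Rabs (cos al - cos be) <= 6 * d /\ Rabs (sin al - sin be) <= 6 * d.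
Proof.
intros Hr Hr' Hc Hs.
assert (A := cos_sin_sqr al); assert (B := cos_sin_sqr be).
set (c := cos al) in *; set (s := sin al) in *; set (c' := cos be) in *; set (s' := sin be) in *.
assert (Bc : Rabs c <= 1) by (apply Rabs_le; apply COS_bound).
assert (Bs : Rabs s <= 1) by (apply Rabs_le; apply SIN_bound).
assert (Bc' : Rabs c' <= 1) by (apply Rabs_le; apply COS_bound).
assert (Bs' : Rabs s' <= 1) by (apply Rabs_le; apply SIN_bound).
assert (Hd : c * c' + s * s' <= 1).
{ assert (A1 := Rle_0_sqr (c - c')); assert (A2 := Rle_0_sqr (s - s')); unfold Rsqr in A1, A2; lra. }
assert (P : forall e f, Rabs e <= 1 -> Rabs f <= 1 ->
  Rabs ((r * c - r' * c') * e + (r * s - r' * s') * f) <= 2 * d).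
{ intros e f He Hf; eapply Rle_trans; [apply Rabs_triang|].
  assert (H1 := Rabs_mult_le _ _ _ _ (Rlt_le _ _ Hc) He).
  assert (H2 := Rabs_mult_le _ _ _ _ (Rlt_le _ _ Hs) Hf); lra. }
assert (Hrr : Rabs (r - r') <= 2 * d).
{ assert (P1 := P c s Bc Bs); assert (P2 := P c' s' Bc' Bs').
  apply Rabs_le_between in P1; apply Rabs_le_between in P2; apply Rabs_le; split.
  - replace ((r * c - r' * c') * c' + (r * s - r' * s') * s') with
      (r * (c * c' + s * s') - r' * (c' * c' + s' * s')) in P2 by ring.
    rewrite B in P2; nra.
  - replace ((r * c - r' * c') * c + (r * s - r' * s') * s) with
      (r * (c * c + s * s) - r' * (c * c' + s * s')) in P1 by ring.
    rewrite A in P1; nra. }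
assert (Q : forall e e', Rabs e <= 1 -> Rabs (r * e - r' * e') < d -> Rabs (e - e') <= 6 * d).
{ intros e e' He H.
  apply (Rmult_le_reg_l r'); [lra|].
  rewrite <- (Rabs_pos_eq r') at 1 by lra; rewrite <- Rabs_mult.
  replace (r' * (e - e')) with ((r * e - r' * e') + - ((r - r') * e)) by ring.
  eapply Rle_trans; [apply Rabs_triang|]; rewrite Rabs_Ropp.
  assert (H1 := Rabs_mult_le _ _ _ _ Hrr He).
  assert (0 <= d) by (eapply Rle_trans; [apply Rabs_pos|left; exact H]).
  nra. }
split; [exact Hrr|split; now apply Q].
Qed.

(** * Motion on a line with prescribed speed *)

Lemma speed_surjective (f df : R -> R) al :
  0 < al -> (forall t, is_derive f t (df t)) -> (forall t, al <= df t) ->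
  (forall x y, x <= y -> al * (y - x) <= f y - f x) /\ forall v, exists t, f t = v.
Proof.
intros Hal Hd Hb.
assert (Hc : forall t, continuity_pt f t).
{ intros t; apply continuity_pt_filterlim; eapply is_derive_cont, Hd. }
assert (Hm : forall x y, x <= y -> al * (y - x) <= f y - f x).
{ intros x y Hxy; destruct (MVT_gen f x y df) as [c [_ ->]]; auto.
  apply Rmult_le_compat_r; [lra|apply Hb]. }
split; [exact Hm|]; intros v.
pose (L := Rabs (v - f 0) / al).
assert (HL : al * L = Rabs (v - f 0)) by (unfold L; field; lra).
assert (HL0 : 0 <= L).
{ unfold L; apply Rmult_le_pos; [apply Rabs_pos|left; now apply Rinv_0_lt_compat]. }
assert (H1 := Hm 0 L HL0); assert (H2 := Hm (- L) 0 ltac:(lra)).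
assert (H3 := Rle_abs (v - f 0)); assert (H4 := Rle_abs (- (v - f 0))); rewrite Rabs_Ropp in H4.
destruct (IVT_gen f (- L) L v) as [t [_ Ht]].
- exact Hc.
- rewrite Rmin_left, Rmax_right; lra.
- now exists t.
Qed.

(** The time needed to reach [x] is the primitive of [1 / w]; the flow is its inverse. *)
Lemma autonomous_flow (w : R -> R) al be :
  0 < al -> (forall x, continuous w x) -> (forall x, al <= w x <= be) ->
  exists th : R -> R, (forall t, is_derive th t (w (th t))) /\
    (forall t, prim (fun x => / w x) (th t) = t) /\
    (forall x, th (prim (fun x => / w x) x) = x).
Proof.
intros Hal Hw Hb.
assert (Hbe : 0 < be) by (specialize (Hb 0); lra).
set (T := prim (fun x => / w x)).
assert (HT : forall x, is_derive T x (/ w x)).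
{ intros x; apply (prim_derive (fun x => / w x)); intros t; apply cont_inv; [specialize (Hb t); lra|apply Hw]. }
assert (Hsp : forall x, / be <= / w x).
{ intros x; specialize (Hb x); apply Rinv_le_contravar; lra. }
assert (Hib : 0 < / be) by now apply Rinv_0_lt_compat.
destruct (speed_surjective T (fun x => / w x) (/ be) Hib HT Hsp) as [Hm Hs].
destruct (functional_choice (fun t x => T x = t) Hs) as [th Hth].
assert (Hlip : forall x y, Rabs (x - y) <= be * Rabs (T x - T y)).
{ assert (Aux : forall x y, x <= y -> Rabs (x - y) <= be * Rabs (T x - T y)).
  { intros x y Hxy; specialize (Hm x y Hxy).
    rewrite (Rabs_minus_sym x y), (Rabs_minus_sym (T x) (T y)).
    assert (be * (/ be * (y - x)) <= be * (T y - T x)) by (apply Rmult_le_compat_l; lra).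
    rewrite <- Rmult_assoc, Rinv_r, Rmult_1_l in H by lra.
    rewrite (Rabs_pos_eq (y - x)) by lra.
    eapply Rle_trans; [exact H|]; apply Rmult_le_compat_l; [lra|apply Rle_abs]. }
  intros x y; destruct (Rle_lt_dec x y); [now apply Aux|].
  rewrite (Rabs_minus_sym x y), (Rabs_minus_sym (T x) (T y)); apply Aux; lra. }
assert (Hinj : forall x y, T x = T y -> x = y).
{ intros x y E; specialize (Hlip x y); rewrite E, Rminus_diag, Rabs_R0, Rmult_0_r in Hlip.
  apply Rminus_diag_uniq, Rabs_eq_0, Rle_antisym; [exact Hlip|apply Rabs_pos]. }
exists th; split; [|split; [exact Hth|intros x; apply Hinj, Hth]].
intros t0; apply is_derive_Reals; intros e He.
set (x0 := th t0).
assert (Hx0 := Hb x0).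
assert (He' : 0 < e / (be * be)) by (apply Rdiv_lt_0_compat; nra).
destruct (proj1 (is_derive_Reals T x0 (/ w x0)) (HT x0) _ He') as [d Hd].
assert (Hdp : 0 < d / be) by (apply Rdiv_lt_0_compat; [apply cond_pos|lra]).
exists (mkposreal _ Hdp); intros tau Htau Htd; simpl in Htd.
set (k := th (t0 + tau) - x0).
assert (HTk : T (x0 + k) - T x0 = tau).
{ unfold k; replace (x0 + (th (t0 + tau) - x0)) with (th (t0 + tau)) by ring.
  unfold x0; rewrite !Hth; ring. }
assert (Hk0 : k <> 0).
{ intros E; rewrite E, Rplus_0_r, Rminus_diag in HTk; now apply Htau. }
assert (Hk : Rabs k <= be * Rabs tau).
{ rewrite <- HTk; replace k with (x0 + k - x0) at 1 by ring; apply Hlip. }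
assert (Hkd : Rabs k < d).
{ eapply Rle_lt_trans; [exact Hk|]; replace (pos d) with (be * (d / be)) by (field; lra).
  now apply Rmult_lt_compat_l. }
specialize (Hd k Hk0 Hkd); rewrite HTk in Hd.
replace (k / tau - w x0) with ((tau / k - / w x0) * (- (k / tau) * w x0)) by (field; lra).
rewrite Rabs_mult.
assert (Hkt : Rabs (- (k / tau) * w x0) <= be * be).
{ apply Rabs_mult_le; [|rewrite Rabs_pos_eq; lra].
  rewrite Rabs_Ropp; unfold Rdiv; rewrite Rabs_mult, Rabs_inv.
  assert (Htp := Rabs_pos_lt _ Htau).
  apply Rmult_le_reg_r with (Rabs tau); [exact Htp|].
  rewrite Rmult_assoc, Rinv_l, Rmult_1_r; lra. }
apply Rle_lt_trans with (Rabs (tau / k - / w x0) * (be * be)).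
- apply Rmult_le_compat_l; [apply Rabs_pos|exact Hkt].
- apply Rlt_le_trans with (e / (be * be) * (be * be)); [|right; field; lra].
  apply Rmult_lt_compat_r; [nra|exact Hd].
Qed.

(** * The height function on the circle *)

Lemma bounded_by_steps (f : R -> R) a b (delta : posreal) :
  a <= b ->
  (forall x x', a <= x <= b -> a <= x' <= b -> Rabs (x - x') < delta -> Rabs (f x - f x') <= 1) ->
  forall n x, a <= x <= b -> x - a < INR n * delta -> Rabs (f x - f a) <= INR n.
Proof.
intros Hab Hstep; assert (Hdp := cond_pos delta).
induction n as [|n IH]; intros x Hx Hl; [simpl in Hl; lra|].
rewrite S_INR in *.
assert (Hs : exists x', a <= x' <= b /\ Rabs (x - x') < delta /\
           (x' = a \/ x' - a < INR n * delta)).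
{ destruct (Rlt_le_dec (x - a) delta) as [H|H].
  - exists a; rewrite Rabs_pos_eq; lra.
  - (* a step slightly shorter than [delta], as the inequalities are strict *)
    pose (e := (INR n * delta + delta - (x - a)) / 2).
    assert (0 < e) by (unfold e; lra).
    exists (x - delta + Rmin e (delta / 2)).
    assert (Hm1 := Rmin_l e (delta / 2)); assert (Hm2 := Rmin_r e (delta / 2)).
    assert (0 < Rmin e (delta / 2)) by (apply Rmin_pos; lra).
    split; [lra|split; [rewrite Rabs_pos_eq; lra|right; unfold e in *; lra]]. }
destruct Hs as [x' [Hx' [Hxx Hs]]].
assert (H1 := Hstep x x' Hx Hx' Hxx).
assert (Hx0 : Rabs (f x' - f a) <= INR n).
{ destruct Hs as [->|Hs]; [rewrite Rminus_diag, Rabs_R0; apply pos_INR|now apply IH]. }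
replace (f x - f a) with ((f x - f x') + (f x' - f a)) by ring.
eapply Rle_trans; [apply Rabs_triang|lra].
Qed.

Lemma bounded_on_rectangle (f : R -> R -> R) a b c d :
  a <= b -> c <= d ->
  (forall x y, a <= x <= b -> c <= y <= d -> continuity_2d_pt f x y) ->
  exists K, forall x y, a <= x <= b -> c <= y <= d -> Rabs (f x y) <= K.
Proof.
intros Hab Hcd Hc.
destruct (uniform_continuity_2d f a b c d Hc (mkposreal 1 Rlt_0_1)) as [delta Hd].
simpl in Hd; assert (Hdp := cond_pos delta).
assert (Hn : forall L, exists n : nat, L < INR n * delta).
{ intros L; destruct (INR_unbounded (L / delta)) as [n Hn]; exists n.
  apply Rmult_lt_compat_r with (r := delta) in Hn; [|exact Hdp].
  unfold Rdiv in Hn; rewrite Rmult_assoc, Rinv_l in Hn; lra. }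
assert (Hz : forall x : R, Rabs (x - x) < delta) by (intros; rewrite Rminus_diag, Rabs_R0; lra).
destruct (Hn (b - a)) as [n1 Hn1]; destruct (Hn (d - c)) as [n2 Hn2].
exists (INR n2 + INR n1 + Rabs (f a c)); intros x y Hx Hy.
assert (H1 : Rabs (f x c - f a c) <= INR n1).
{ apply (bounded_by_steps (fun x => f x c) a b delta Hab); [|exact Hx|lra].
  intros x1 x2 A1 A2 A; left; apply Hd; auto; lra. }
assert (H2 : Rabs (f x y - f x c) <= INR n2).
{ apply (bounded_by_steps (f x) c d delta Hcd); [|exact Hy|lra].
  intros y1 y2 A1 A2 A; left; apply Hd; auto; lra. }
replace (f x y) with ((f x y - f x c) + (f x c - f a c) + f a c) by ring.
eapply Rle_trans; [apply Rabs_triang|]; apply Rplus_le_compat_r.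
eapply Rle_trans; [apply Rabs_triang|lra].
Qed.

Lemma continuity_2d_continuous f x y :
  continuity_2d_pt f x y <-> continuous (fun p : R * R => f (fst p) (snd p)) (x, y).
Proof. apply continuity_2d_pt_filterlim. Qed.

Lemma locally_nonzero x y :
  (x, y) <> (0, 0) -> locally (x, y) (fun p : R * R => p <> (0, 0)).
Proof.
intros H.
assert (Hd : x <> 0 \/ y <> 0).
{ destruct (Req_dec x 0); [right|now left]; intros ->; subst; now apply H. }
destruct Hd as [Hx|Hy].
- exists (mkposreal _ (Rabs_pos_lt _ Hx)); intros [u v] [Hu _] E; injection E; intros _ ->.
  change (Rabs (0 - x) < Rabs x) in Hu.
  replace (0 - x) with (- x) in Hu by ring; rewrite Rabs_Ropp in Hu; lra.
- exists (mkposreal _ (Rabs_pos_lt _ Hy)); intros [u v] [_ Hv] E; injection E; intros -> _.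
  change (Rabs (0 - y) < Rabs y) in Hv.
  replace (0 - y) with (- y) in Hv by ring; rewrite Rabs_Ropp in Hv; lra.
Qed.

Definition dx (f : R -> R -> R) (x y : R) := Derive (fun u => f u y) x.
Definition dy (f : R -> R -> R) (x y : R) := Derive (fun v => f x v) y.

(** Continuous partial derivatives give differentiability in two variables, hence the
    chain rule along the ray of direction [(c, s)]. *)
Lemma ray_derive (f : R -> R -> R) r c s :
  (forall x y, (x, y) <> (0, 0) -> ex_diff_n f 1 x y) ->
  r <> 0 -> c * c + s * s = 1 ->
  is_derive (fun r => f (r * c) (r * s)) r
    (c * dx f (r * c) (r * s) + s * dy f (r * c) (r * s)).
Proof.
intros Hf Hr Hcs.
assert (Hnz := ray_nonzero r c s Hr Hcs).
assert (Hd : differentiable_pt_lim f (r * c) (r * s)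
               (dx f (r * c) (r * s)) (dy f (r * c) (r * s))).
{ apply filterdiff_differentiable_pt_lim.
  apply (is_derive_filterdiff f (r * c) (r * s) (dx f)).
  - eapply filter_imp; [|apply (locally_nonzero _ _ Hnz)].
    intros [u v] Huv; apply Derive_correct; now destruct (Hf u v Huv) as [_ [H _]].
  - apply Derive_correct; now destruct (Hf _ _ Hnz) as [_ [_ [H _]]].
  - apply continuity_2d_continuous; destruct (Hf _ _ Hnz) as [_ [_ [_ [[H _] _]]]]; exact H. }
apply is_derive_Reals.
replace (c * dx f (r * c) (r * s) + s * dy f (r * c) (r * s)) with
  (dx f (r * c) (r * s) * c + dy f (r * c) (r * s) * s) by ring.
apply (derivable_pt_lim_comp_2d f (fun r => r * c) (fun r => r * s)).
- exact Hd.
- apply is_derive_Reals; auto_derive; [trivial|ring].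
- apply is_derive_Reals; auto_derive; [trivial|ring].
Qed.

Lemma polar_continuity (g : R -> R -> R) t r :
  (forall x y, (x, y) <> (0, 0) -> continuity_2d_pt g x y) -> r <> 0 ->
  continuity_2d_pt (fun t r => g (r * cos t) (r * sin t)) t r.
Proof.
intros Hg Hr; apply continuity_2d_continuous; cbv beta.
apply (continuous_comp_2 (fun p : R * R => snd p * cos (fst p))
         (fun p : R * R => snd p * sin (fst p)) g).
- apply (continuous_mult (snd : R * R -> R) (fun p : R * R => cos (fst p))).
  + apply continuous_snd.
  + apply (continuous_comp fst cos); [apply continuous_fst|apply continuous_cos].
- apply (continuous_mult (snd : R * R -> R) (fun p : R * R => sin (fst p))).
  + apply continuous_snd.
  + apply (continuous_comp fst sin); [apply continuous_fst|apply continuous_sin].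
- apply continuity_2d_continuous, Hg, ray_nonzero; [exact Hr|apply cos_sin_sqr].
Qed.

Lemma increment_bound (f df : R -> R) a b K :
  (forall x, Rmin a b <= x <= Rmax a b -> is_derive f x (df x)) ->
  (forall x, Rmin a b <= x <= Rmax a b -> Rabs (df x) <= K) ->
  Rabs (f b - f a) <= K * Rabs (b - a).
Proof.
intros Hd HK; destruct (MVT_gen f a b df) as [x [Hx ->]].
- intros x Hx; apply Hd; lra.
- intros x Hx; apply continuity_pt_filterlim; eapply is_derive_cont, Hd; lra.
- rewrite Rabs_mult; apply Rmult_le_compat_r; [apply Rabs_pos|now apply HK].
Qed.

Lemma period_integral (f : R -> R) T x :
  periodic T f -> (forall t, continuous f t) -> prim f (x + T) - prim f x = prim f T.
Proof.
intros Hp Hc.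
assert (H := prim_shift f T x Hc).
replace (prim (fun t => f (t + T)) x) with (prim f x) in H; [lra|].
unfold prim; apply RInt_ext; intros t _; symmetry; apply Hp.
Qed.

Lemma affine_period_integral (f : R -> R) T e v :
  periodic T f -> (forall t, continuous f t) -> e = 1 \/ e = -1 ->
  RInt (fun t => f (e * t + v)) 0 T = RInt f 0 T.
Proof.
intros Hp Hc He.
assert (H := RInt_comp_lin (V := R_CompleteNormedModule) f e v 0 T (cont_ex_RInt f _ _ Hc)).
rewrite RInt_scal, (prim_diff f) in H; auto.
- unfold scal in H; simpl in H; unfold mult in H; simpl in H.
  assert (Hv := period_integral f T v Hp Hc); assert (Hw := period_integral f T (v - T) Hp Hc).
  change (RInt f 0 T) with (prim f T).
  destruct He as [-> | ->].
  + replace (1 * T + v) with (v + T) in H by ring; replace (1 * 0 + v) with v in H by ring.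
    set (J := RInt (fun t => f (1 * t + v)) 0 T) in *; apply Rminus_diag_uniq; lra.
  + replace (-1 * T + v) with (v - T) in H by ring; replace (-1 * 0 + v) with (v - T + T) in H by ring.
    set (J := RInt (fun t => f (-1 * t + v)) 0 T) in *; apply Rminus_diag_uniq; lra.
- apply cont_ex_RInt; intros t.
  apply (continuous_comp (fun t => e * t + v) f); [|apply Hc].
  eapply is_derive_cont with (l := e); auto_derive; [trivial|ring].
Qed.

Section Height.
Variable h : R -> R -> R.
Hypothesis h_adm : admissible h.

Definition loop_height (t : R) : R := h (cos t) (sin t).

Lemma h_continuity x y : (x, y) <> (0, 0) -> continuity_2d_pt h x y.
Proof. intros H; destruct h_adm as [Hd _]; now destruct (Hd x y H) as [Hc _]. Qed.

Lemma loop_height_continuous t : continuous loop_height t.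
Proof.
apply (continuous_comp_2 cos sin h); [apply continuous_cos|apply continuous_sin|].
apply continuity_2d_continuous, h_continuity.
replace (cos t, sin t) with (1 * cos t, 1 * sin t) by (f_equal; ring).
apply ray_nonzero; [lra|apply cos_sin_sqr].
Qed.

Lemma loop_height_periodic : periodic (2 * PI) loop_height.
Proof.
intros t; unfold loop_height.
replace (t + 2 * PI) with (t + IZR 1 * (2 * PI)) by ring; now rewrite cos_Z, sin_Z.
Qed.

(** The radial derivative [A] of [h] has itself a bounded radial derivative [D] on the
    annulus [1/2 <= r <= 3/2], and [A] vanishes on the circle by hypothesis: so
    [|A| <= K * |r - 1|], and integrating once more gives a quadratic estimate. *)
Lemma radial_flatness :
  (forall t, 0 <= t < 2 * PI -> A_h h t = 0) ->
  exists K, 0 <= K /\ forall t a b, Rabs a <= / 2 -> Rabs b <= / 2 ->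
    Rabs (h ((1 + a) * cos t) ((1 + a) * sin t) -
          h ((1 + b) * cos t) ((1 + b) * sin t))
    <= K * (Rabs a + Rabs b) * Rabs (a - b).
Proof.
intros HA; destruct h_adm as [Hd _].
assert (D0 : forall x y, (x, y) <> (0, 0) -> ex_diff_n h 1 x y).
{ intros x y H; destruct (Hd x y H) as [C [E1 [E2 [E3 E4]]]].
  split; [exact C|split; [exact E1|split; [exact E2|split]]]; split; trivial.
  - now destruct E3.
  - now destruct E4. }
assert (D1 : forall x y, (x, y) <> (0, 0) -> ex_diff_n (dx h) 1 x y).
{ intros x y H; now destruct (Hd x y H) as [C [E1 [E2 [E3 E4]]]]. }
assert (D2 : forall x y, (x, y) <> (0, 0) -> ex_diff_n (dy h) 1 x y).
{ intros x y H; now destruct (Hd x y H) as [C [E1 [E2 [E3 E4]]]]. }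
pose (A := fun t r => cos t * dx h (r * cos t) (r * sin t) + sin t * dy h (r * cos t) (r * sin t)).
pose (D := fun t r =>
  cos t * (cos t * dx (dx h) (r * cos t) (r * sin t) + sin t * dy (dx h) (r * cos t) (r * sin t)) +
  sin t * (cos t * dx (dy h) (r * cos t) (r * sin t) + sin t * dy (dy h) (r * cos t) (r * sin t))).
assert (HhA : forall t r, r <> 0 -> is_derive (fun r => h (r * cos t) (r * sin t)) r (A t r)).
{ intros t r Hr; apply ray_derive; auto; apply cos_sin_sqr. }
assert (HAD : forall t r, r <> 0 -> is_derive (A t) r (D t r)).
{ intros t r Hr; apply (is_derive_plus (fun r => cos t * dx h (r * cos t) (r * sin t))).
  - apply (is_derive_scal (fun r => dx h (r * cos t) (r * sin t))).
    apply ray_derive; auto; apply cos_sin_sqr.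
  - apply (is_derive_scal (fun r => dy h (r * cos t) (r * sin t))).
    apply ray_derive; auto; apply cos_sin_sqr. }
assert (Hcos : forall t r, continuity_2d_pt (fun t _ => cos t) t r).
{ intros; apply (continuity_1d_2d_pt_comp cos (fun t _ => t)).
  - apply continuity_pt_filterlim, continuous_cos.
  - apply continuity_2d_pt_id1. }
assert (Hsin : forall t r, continuity_2d_pt (fun t _ => sin t) t r).
{ intros; apply (continuity_1d_2d_pt_comp sin (fun t _ => t)).
  - apply continuity_pt_filterlim, continuous_sin.
  - apply continuity_2d_pt_id1. }
assert (HDc : forall t r, r <> 0 -> continuity_2d_pt D t r).
{ intros t r Hr; unfold D.
  apply continuity_2d_pt_plus; apply continuity_2d_pt_mult; auto;
  apply continuity_2d_pt_plus; apply continuity_2d_pt_mult; auto.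
  - apply (polar_continuity (dx (dx h))); auto.
    intros x y H; now destruct (D1 x y H) as [_ [_ [_ [[C _] _]]]].
  - apply (polar_continuity (dy (dx h))); auto.
    intros x y H; now destruct (D1 x y H) as [_ [_ [_ [_ [C _]]]]].
  - apply (polar_continuity (dx (dy h))); auto.
    intros x y H; now destruct (D2 x y H) as [_ [_ [_ [[C _] _]]]].
  - apply (polar_continuity (dy (dy h))); auto.
    intros x y H; now destruct (D2 x y H) as [_ [_ [_ [_ [C _]]]]]. }
assert (HPI := twoPI_pos).
destruct (bounded_on_rectangle D 0 (2 * PI) (/ 2) (3 / 2)) as [K HK]; [lra|lra| |].
{ intros t r _ Hr; apply HDc; lra. }
assert (HK0 : 0 <= K).
{ eapply Rle_trans; [apply Rabs_pos|apply (HK 0 1); lra]. }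
assert (HA1 : forall t x, 0 <= t < 2 * PI -> Rabs x <= / 2 -> Rabs (A t (1 + x)) <= K * Rabs x).
{ intros t x Ht Hx; apply Rabs_le_between in Hx.
  assert (HA0 : A t 1 = 0).
  { rewrite <- (HA t Ht); unfold A, A_h, dx, dy; now rewrite !Rmult_1_l. }
  replace (A t (1 + x)) with (A t (1 + x) - A t 1) by (rewrite HA0; ring).
  replace (Rabs x) with (Rabs (1 + x - 1)) by (f_equal; ring).
  assert (Hr : forall r, Rmin 1 (1 + x) <= r <= Rmax 1 (1 + x) -> / 2 <= r <= 3 / 2).
  { intros r; unfold Rmin, Rmax; destruct (Rle_dec 1 (1 + x)); lra. }
  apply (increment_bound (A t) (D t)).
  - intros r H; apply HAD; specialize (Hr r H); lra.
  - intros r H; apply HK; [lra|now apply Hr]. }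
exists K; split; [exact HK0|].
intros t a b Ha Hb.
destruct (reduce_period (2 * PI) 0 t HPI) as [k Hk].
rewrite <- (cos_Z t k), <- (sin_Z t k).
set (t' := t + IZR k * (2 * PI)) in *.
replace (a - b) with ((1 + a) - (1 + b)) by ring.
assert (Hs : forall r, Rmin (1 + b) (1 + a) <= r <= Rmax (1 + b) (1 + a) ->
  Rabs (r - 1) <= / 2 /\ Rabs (r - 1) <= Rabs a + Rabs b).
{ intros r Hr; unfold Rabs in *; unfold Rmin, Rmax in Hr.
  destruct (Rle_dec (1 + b) (1 + a)); destruct (Rcase_abs a); destruct (Rcase_abs b);
  destruct (Rcase_abs (r - 1)); lra. }
apply (increment_bound (fun r => h (r * cos t') (r * sin t')) (A t')).
- intros r Hr; apply HhA; destruct (Hs r Hr) as [H _]; apply Rabs_le_between in H; lra.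
- intros r Hr; destruct (Hs r Hr) as [H1 H2].
  replace r with (1 + (r - 1)) by ring.
  eapply Rle_trans; [apply HA1; [lra|exact H1]|now apply Rmult_le_compat_l].
Qed.

(** The values of [h] at the four points [(+-x, +-y)] add up to zero, and the four
    corresponding substitutions of the angle preserve the integral over a period. *)
Lemma loop_height_mean_zero : RInt loop_height 0 (2 * PI) = 0.
Proof.
destruct h_adm as [_ [rho [phi [chi [psi [_ [_ [_ Hh]]]]]]]].
set (I := RInt loop_height 0 (2 * PI)).
assert (HC := loop_height_continuous); assert (HP := loop_height_periodic).
assert (HA : forall e v t, continuous (fun t => loop_height (e * t + v)) t).
{ intros e v t; apply (continuous_comp (fun t => e * t + v) loop_height); [|apply HC].
  eapply is_derive_cont with (l := e); auto_derive; [trivial|ring]. }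
assert (I1 : RInt (fun t => loop_height (-1 * t + PI)) 0 (2 * PI) = I)
  by (apply affine_period_integral; auto).
assert (I2 : RInt (fun t => loop_height (-1 * t + 0)) 0 (2 * PI) = I)
  by (apply affine_period_integral; auto).
assert (I3 : RInt (fun t => loop_height (1 * t + PI)) 0 (2 * PI) = I)
  by (apply affine_period_integral; auto).
assert (Hs : RInt (fun t => plus (plus (loop_height t) (loop_height (-1 * t + PI)))
   (plus (loop_height (-1 * t + 0)) (loop_height (1 * t + PI)))) 0 (2 * PI) = I + I + (I + I)).
{ rewrite (RInt_plus (V := R_CompleteNormedModule)).
  - rewrite !(RInt_plus (V := R_CompleteNormedModule)) by (apply cont_ex_RInt; auto).
    now rewrite I1, I2, I3.
  - apply cont_ex_RInt; intros t. apply (continuous_plus loop_height); auto.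
  - apply cont_ex_RInt; intros t. apply (continuous_plus (fun t => loop_height (-1 * t + 0))); auto. }
rewrite (RInt_ext _ (fun _ => 0)) in Hs.
- rewrite RInt_const in Hs; unfold scal in Hs; simpl in Hs; unfold mult in Hs; simpl in Hs; lra.
- intros t _; unfold plus; simpl; unfold loop_height.
  replace (-1 * t + PI) with (PI - t) by ring; replace (-1 * t + 0) with (- t) by ring.
  replace (1 * t + PI) with (t + PI) by ring.
  rewrite neg_cos, neg_sin, cos_neg, sin_neg, sin_PI_x.
  rewrite (Rtrigo_facts.cos_pi_minus t).
  assert (Hcs := cos_sin_sqr t); set (c := cos t) in *; set (s := sin t) in *.
  rewrite !Hh; try (intros E; injection E; intros; nra).
  replace ((- c) ^ 2) with (c ^ 2) by ring; replace ((- s) ^ 2) with (s ^ 2) by ring.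
  ring.
Qed.

End Height.

(** * First order expansions in the scale [s] *)

Definition for_small (P : R -> Prop) : Prop :=
  exists s1, 0 < s1 /\ forall s, 0 < s <= s1 -> P s.

Lemma for_small_imp (P Q : R -> Prop) :
  (forall s, 0 < s -> P s -> Q s) -> for_small P -> for_small Q.
Proof.
intros H [s1 [Hs1 HP]]; exists s1; split; [exact Hs1|].
intros s Hs; apply H; [lra|now apply HP].
Qed.

Lemma for_small_and (P Q : R -> Prop) :
  for_small P -> for_small Q -> for_small (fun s => P s /\ Q s).
Proof.
intros [s1 [Hs1 HP]] [s2 [Hs2 HQ]]; exists (Rmin s1 s2); split; [now apply Rmin_pos|].
assert (M1 := Rmin_l s1 s2); assert (M2 := Rmin_r s1 s2).
intros s Hs; split; [apply HP|apply HQ]; lra.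
Qed.

Lemma for_small_linear C e : 0 < e -> for_small (fun s => C * s <= e).
Proof.
intros He; assert (HC := Rabs_pos C); assert (HC' := Rle_abs C).
exists (e / (Rabs C + 1)); split; [apply Rdiv_lt_0_compat; lra|].
intros s Hs.
assert ((Rabs C + 1) * s <= (Rabs C + 1) * (e / (Rabs C + 1))) by (apply Rmult_le_compat_l; lra).
replace ((Rabs C + 1) * (e / (Rabs C + 1))) with e in H by (field; lra).
nra.
Qed.

(** [f s t u y = f0 t + s * f1 t * y + O(s^2)] on the box [|u|, |y| <= 2], uniformly in
    the angle [t], where the remainder is moreover [O(s^2)]-Lipschitz in [(u, y)].
    There is no term [s * u], because the vector field sees [u] only through [s^3 * u]. *)
Definition jet_bounds (K s0 : R) (f : R -> R -> R -> R -> R) (f0 f1 : R -> R) : Prop :=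
  (forall t, Rabs (f0 t) <= K /\ Rabs (f1 t) <= K) /\
  forall s t, 0 < s <= s0 ->
    Rabs (f s t 0 0 - f0 t) <= K * s ^ 2 /\
    forall u y u' y', Rabs u <= 2 -> Rabs y <= 2 -> Rabs u' <= 2 -> Rabs y' <= 2 ->
      Rabs (f s t u y - f s t u' y' - s * f1 t * (y - y'))
      <= K * s ^ 2 * (Rabs (u - u') + Rabs (y - y')).

Definition jet f f0 f1 : Prop :=
  exists K s0, 0 <= K /\ 0 < s0 <= 1 /\ jet_bounds K s0 f f0 f1.

Lemma jet_bounds_weaken K s0 K' s0' f f0 f1 :
  K <= K' -> s0' <= s0 -> jet_bounds K s0 f f0 f1 -> jet_bounds K' s0' f f0 f1.
Proof.
intros HK Hs [Hb H]; split.
- intros t; destruct (Hb t); lra.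
- intros s t Hst; destruct (H s t) as [H1 H2]; [lra|].
  assert (0 <= s ^ 2) by apply pow2_ge_0; split.
  + nra.
  + intros u y u' y' A1 A2 A3 A4; eapply Rle_trans; [now apply H2|].
    assert (0 <= Rabs (u - u')) by apply Rabs_pos; assert (0 <= Rabs (y - y')) by apply Rabs_pos.
    apply Rmult_le_compat_r; [lra|]; nra.
Qed.

Lemma jet_common f f0 f1 g g0 g1 :
  jet f f0 f1 -> jet g g0 g1 ->
  exists K s0, 0 <= K /\ 0 < s0 <= 1 /\ jet_bounds K s0 f f0 f1 /\ jet_bounds K s0 g g0 g1.
Proof.
intros [K [s0 [HK [Hs Hf]]]] [K' [s0' [HK' [Hs' Hg]]]].
exists (Rmax K K'), (Rmin s0 s0').
assert (M1 := Rmax_l K K'); assert (M2 := Rmax_r K K').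
assert (M3 := Rmin_l s0 s0'); assert (M4 := Rmin_r s0 s0').
assert (0 < Rmin s0 s0') by (apply Rmin_pos; lra).
split; [lra|split; [lra|split]].
- now apply (jet_bounds_weaken K s0).
- now apply (jet_bounds_weaken K' s0').
Qed.

Lemma jet_near K s0 f f0 f1 s t u y :
  0 <= K -> s0 <= 1 -> jet_bounds K s0 f f0 f1 -> 0 < s <= s0 -> Rabs u <= 2 -> Rabs y <= 2 ->
  Rabs (f s t u y - f0 t) <= 7 * K * s.
Proof.
intros HK Hs0 [Hb H] Hs Hu Hy; destruct (H s t Hs) as [H1 H2].
assert (Z : Rabs 0 <= 2) by (rewrite Rabs_R0; lra).
specialize (H2 u y 0 0 Hu Hy Z Z); rewrite !Rminus_0_r in H2.
destruct (Hb t) as [_ B1].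
assert (Hp : Rabs (s * f1 t * y) <= s * K * 2).
{ rewrite !Rabs_mult, (Rabs_pos_eq s) by lra.
  apply Rmult_le_compat; [|apply Rabs_pos| |exact Hy].
  - apply Rmult_le_pos; [lra|apply Rabs_pos].
  - apply Rmult_le_compat_l; lra. }
replace (f s t u y - f0 t) with
  ((f s t u y - f s t 0 0 - s * f1 t * y) + s * f1 t * y + (f s t 0 0 - f0 t)) by ring.
eapply Rle_trans; [apply Rabs_triang|].
eapply Rle_trans; [apply Rplus_le_compat_r, Rabs_triang|].
assert (K * s ^ 2 <= K * s) by (apply Rmult_le_compat_l; nra).
assert (0 <= K * s ^ 2) by (apply Rmult_le_pos; [lra|apply pow2_ge_0]).
assert (K * s ^ 2 * (Rabs u + Rabs y) <= K * s ^ 2 * 4) by (apply Rmult_le_compat_l; lra).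
lra.
Qed.

Lemma jet_bounded K s0 f f0 f1 s t u y :
  0 <= K -> s0 <= 1 -> jet_bounds K s0 f f0 f1 -> 0 < s <= s0 -> Rabs u <= 2 -> Rabs y <= 2 ->
  Rabs (f s t u y) <= 8 * K.
Proof.
intros HK Hs0 J Hs Hu Hy.
assert (H := jet_near K s0 f f0 f1 s t u y HK Hs0 J Hs Hu Hy).
destruct J as [Hb _]; destruct (Hb t) as [H0 _].
replace (f s t u y) with ((f s t u y - f0 t) + f0 t) by ring.
eapply Rle_trans; [apply Rabs_triang|]; nra.
Qed.

Lemma jet_base (f0 : R -> R) K :
  (forall t, Rabs (f0 t) <= K) -> jet (fun _ t _ _ => f0 t) f0 (fun _ => 0).
Proof.
intros H; exists K, 1.
assert (HK : 0 <= K) by (eapply Rle_trans; [apply Rabs_pos|apply (H 0)]).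
split; [exact HK|split; [lra|split]].
- intros t; cbv beta; rewrite Rabs_R0; split; [apply H|exact HK].
- intros s t Hs; cbv beta; rewrite Rminus_diag, Rabs_R0.
  assert (0 <= K * s ^ 2) by (apply Rmult_le_pos; [lra|apply pow2_ge_0]).
  split; [assumption|]; intros u y u' y' _ _ _ _.
  replace (0 - s * 0 * (y - y')) with 0 by ring; rewrite Rabs_R0.
  apply Rmult_le_pos; [assumption|]; apply Rplus_le_le_0_compat; apply Rabs_pos.
Qed.

Lemma jet_const c : jet (fun _ _ _ _ => c) (fun _ => c) (fun _ => 0).
Proof. apply jet_base with (f0 := fun _ => c) (K := Rabs c); intros; apply Rle_refl. Qed.

Lemma jet_plus f f0 f1 g g0 g1 :
  jet f f0 f1 -> jet g g0 g1 ->
  jet (fun s t u y => f s t u y + g s t u y) (fun t => f0 t + g0 t) (fun t => f1 t + g1 t).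
Proof.
intros Hf Hg; destruct (jet_common _ _ _ _ _ _ Hf Hg) as [K [s0 [HK [Hs [[Bf Jf] [Bg Jg]]]]]].
exists (2 * K), s0; split; [lra|split; [exact Hs|split]].
- intros t; destruct (Bf t), (Bg t); split; (eapply Rle_trans; [apply Rabs_triang|lra]).
- intros s t Hst; destruct (Jf s t Hst) as [F1 F2]; destruct (Jg s t Hst) as [G1 G2]; split.
  + replace (f s t 0 0 + g s t 0 0 - (f0 t + g0 t)) with
      ((f s t 0 0 - f0 t) + (g s t 0 0 - g0 t)) by ring.
    eapply Rle_trans; [apply Rabs_triang|lra].
  + intros u y u' y' A1 A2 A3 A4.
    specialize (F2 u y u' y' A1 A2 A3 A4); specialize (G2 u y u' y' A1 A2 A3 A4).
    replace (f s t u y + g s t u y - (f s t u' y' + g s t u' y') - s * (f1 t + g1 t) * (y - y'))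
      with ((f s t u y - f s t u' y' - s * f1 t * (y - y')) +
            (g s t u y - g s t u' y' - s * g1 t * (y - y'))) by ring.
    eapply Rle_trans; [apply Rabs_triang|lra].
Qed.

(** Leibniz rule: the increment of [f * g] is [f * dg + df * g'], and replacing [f] and
    [g'] by [f0] and [g0] in front of the increments of size [s] costs [O(s^2)]. *)
Lemma jet_mult f f0 f1 g g0 g1 :
  jet f f0 f1 -> jet g g0 g1 ->
  jet (fun s t u y => f s t u y * g s t u y) (fun t => f0 t * g0 t)
      (fun t => f0 t * g1 t + f1 t * g0 t).
Proof.
intros Hf Hg; destruct (jet_common _ _ _ _ _ _ Hf Hg) as [K [s0 [HK [Hs [Jf Jg]]]]].
assert (Hs1 : s0 <= 1) by lra.
assert (KK : 0 <= K * K) by nra.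
exists (30 * (K * K)), s0; split; [lra|split; [exact Hs|split]].
- intros t; destruct Jf as [Bf _], Jg as [Bg _]; destruct (Bf t), (Bg t); split.
  + eapply Rle_trans; [apply Rabs_mult_le; eassumption|lra].
  + eapply Rle_trans; [apply Rabs_triang|].
    eapply Rle_trans; [apply Rplus_le_compat; apply Rabs_mult_le; eassumption|lra].
- intros s t Hst.
  assert (s2 : 0 <= s ^ 2) by apply pow2_ge_0.
  assert (Z : Rabs 0 <= 2) by (rewrite Rabs_R0; lra).
  assert (Nf := fun u y => jet_near K s0 f f0 f1 s t u y HK Hs1 Jf Hst).
  assert (Ng := fun u y => jet_near K s0 g g0 g1 s t u y HK Hs1 Jg Hst).
  assert (Bf := fun u y => jet_bounded K s0 f f0 f1 s t u y HK Hs1 Jf Hst).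
  assert (Bg := fun u y => jet_bounded K s0 g g0 g1 s t u y HK Hs1 Jg Hst).
  destruct Jf as [Cf Jf], Jg as [Cg Jg]; destruct (Cf t) as [Cf0 Cf1], (Cg t) as [Cg0 Cg1].
  destruct (Jf s t Hst) as [F1 F2]; destruct (Jg s t Hst) as [G1 G2]; split.
  + replace (f s t 0 0 * g s t 0 0 - f0 t * g0 t) with
      (f s t 0 0 * (g s t 0 0 - g0 t) + (f s t 0 0 - f0 t) * g0 t) by ring.
    eapply Rle_trans; [apply Rabs_triang|].
    assert (E1 := Rabs_mult_le _ _ _ _ (Bf 0 0 Z Z) G1).
    assert (E2 := Rabs_mult_le _ _ _ _ F1 Cg0).
    assert (0 <= K * K * s ^ 2) by (apply Rmult_le_pos; lra).
    lra.
  + intros u y u' y' A1 A2 A3 A4.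
    specialize (F2 u y u' y' A1 A2 A3 A4); specialize (G2 u y u' y' A1 A2 A3 A4).
    set (N := Rabs (u - u') + Rabs (y - y')) in *.
    assert (HN0 : 0 <= Rabs (u - u')) by apply Rabs_pos.
    assert (HN : Rabs (y - y') <= N) by (unfold N; lra).
    assert (HN1 : 0 <= N) by (eapply Rle_trans; [apply Rabs_pos|exact HN]).
    replace (f s t u y * g s t u y - f s t u' y' * g s t u' y'
             - s * (f0 t * g1 t + f1 t * g0 t) * (y - y')) with
      (f s t u y * (g s t u y - g s t u' y' - s * g1 t * (y - y')) +
       (f s t u y - f s t u' y' - s * f1 t * (y - y')) * g s t u' y' +
       (s * (g1 t * (f s t u y - f0 t)) * (y - y') +
        s * (f1 t * (g s t u' y' - g0 t)) * (y - y'))) by ring.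
    assert (Hss : Rabs s <= s) by (rewrite Rabs_pos_eq; lra).
    eapply Rle_trans; [apply Rabs_triang|].
    eapply Rle_trans; [apply Rplus_le_compat; [apply Rabs_triang|apply Rabs_triang]|].
    assert (E1 := Rabs_mult_le _ _ _ _ (Bf u y A1 A2) G2).
    assert (E2 := Rabs_mult_le _ _ _ _ F2 (Bg u' y' A3 A4)).
    assert (E3 := Rabs_mult_le _ _ _ _
      (Rabs_mult_le _ _ _ _ Hss (Rabs_mult_le _ _ _ _ Cg1 (Nf u y A1 A2))) HN).
    assert (E4 := Rabs_mult_le _ _ _ _
      (Rabs_mult_le _ _ _ _ Hss (Rabs_mult_le _ _ _ _ Cf1 (Ng u' y' A3 A4))) HN).
    ring_simplify in E1; ring_simplify in E2; ring_simplify in E3; ring_simplify in E4.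
    replace (30 * (K * K) * s ^ 2 * N) with (30 * (K ^ 2 * s ^ 2 * N)) by ring.
    assert (0 <= K ^ 2 * s ^ 2 * N) by (apply Rmult_le_pos; [apply Rmult_le_pos; apply pow2_ge_0|exact HN1]).
    lra.
Qed.

Lemma jet_scal c f f0 f1 :
  jet f f0 f1 -> jet (fun s t u y => c * f s t u y) (fun t => c * f0 t) (fun t => c * f1 t).
Proof.
intros Hf; destruct (jet_mult _ _ _ _ _ _ (jet_const c) Hf) as [K [s0 [HK [Hs [B J]]]]].
exists K, s0; split; [exact HK|split; [exact Hs|split]].
- intros t; destruct (B t) as [B0 B1]; split; [exact B0|].
  now replace (c * f1 t) with (c * f1 t + 0 * f0 t) by ring.
- intros s t Hst; destruct (J s t Hst) as [J0 J1]; cbv beta in *; split; [exact J0|].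
  intros u y u' y' A1 A2 A3 A4.
  replace (c * f1 t) with (c * f1 t + 0 * f0 t) by ring; now apply J1.
Qed.

Lemma jet_ext f f0 f1 g g0 g1 :
  (forall s t u y, f s t u y = g s t u y) -> (forall t, f0 t = g0 t) -> (forall t, f1 t = g1 t) ->
  jet f f0 f1 -> jet g g0 g1.
Proof.
intros E E0 E1 [K [s0 [HK [Hs [B J]]]]]; exists K, s0; split; [exact HK|split; [exact Hs|split]].
- intros t; rewrite <- E0, <- E1; apply B.
- intros s t Hst; rewrite <- E, <- E0, <- E1; destruct (J s t Hst) as [J0 J1].
  split; [exact J0|]; intros; rewrite <- !E; now apply J1.
Qed.

Lemma jet_minus f f0 f1 g g0 g1 :
  jet f f0 f1 -> jet g g0 g1 ->
  jet (fun s t u y => f s t u y - g s t u y) (fun t => f0 t - g0 t) (fun t => f1 t - g1 t).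
Proof.
intros Hf Hg; eapply jet_ext; [| | |apply jet_plus; [exact Hf|apply (jet_scal (-1)), Hg]];
  intros; simpl; ring.
Qed.

Lemma jet_pow f f0 f1 k :
  jet f f0 f1 ->
  jet (fun s t u y => f s t u y ^ k) (fun t => f0 t ^ k)
      (fun t => INR k * f0 t ^ pred k * f1 t).
Proof.
intros Hf; induction k as [|k IH].
- eapply jet_ext; [| | |apply (jet_const 1)]; intros; simpl; ring.
- eapply jet_ext; [| | |apply (jet_mult _ _ _ _ _ _ Hf IH)]; intros.
  + reflexivity.
  + reflexivity.
  + simpl pred; rewrite S_INR; destruct k as [|k]; [simpl; ring|simpl pred; simpl pow; ring].
Qed.

Lemma jet_sum_n (F : nat -> R -> R -> R -> R -> R) (F0 F1 : nat -> R -> R) d :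
  (forall k, jet (F k) (F0 k) (F1 k)) ->
  jet (fun s t u y => sum_n (fun k => F k s t u y) d)
      (fun t => sum_n (fun k => F0 k t) d) (fun t => sum_n (fun k => F1 k t) d).
Proof.
intros H; induction d as [|d IH].
- eapply jet_ext; [| | |apply (H 0%nat)]; intros; now rewrite sum_O.
- eapply jet_ext; [| | |apply (jet_plus _ _ _ _ _ _ IH (H (S d)))]; intros;
    now rewrite sum_Sn.
Qed.

Lemma jet_near_one f :
  jet f (fun _ => 1) (fun _ => 0) ->
  for_small (fun s => forall t u y, Rabs u <= 2 -> Rabs y <= 2 -> / 2 <= f s t u y).
Proof.
intros [K [s0 [HK [Hs J]]]].
apply (for_small_imp (fun s => s <= s0 /\ 14 * K * s <= 1)).
{ intros s Hs0 [H1 H2] t u y Hu Hy.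
  assert (H := jet_near K s0 f _ _ s t u y HK (proj2 Hs) J ltac:(lra) Hu Hy).
  apply Rabs_le_between in H; lra. }
apply for_small_and; [now exists s0|apply for_small_linear; lra].
Qed.

Lemma jet_inv f :
  jet f (fun _ => 1) (fun _ => 0) ->
  jet (fun s t u y => / f s t u y) (fun _ => 1) (fun _ => 0).
Proof.
intros Hf; destruct (jet_near_one f Hf) as [s1 [Hs1 Hhalf]].
destruct Hf as [K [s0 [HK [Hs J]]]].
exists (4 * K + 1), (Rmin s0 s1).
assert (M1 := Rmin_l s0 s1); assert (M2 := Rmin_r s0 s1).
assert (M0 : 0 < Rmin s0 s1) by (apply Rmin_pos; lra).
split; [lra|split; [lra|split]].
- intros t; cbv beta; rewrite Rabs_R1, Rabs_R0; lra.
- intros s t Hst; destruct J as [_ J]; destruct (J s t ltac:(lra)) as [J0 J1].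
  assert (Hst1 : 0 < s <= s1) by lra.
  assert (s2 : 0 <= s ^ 2) by apply pow2_ge_0.
  assert (Hinv : forall a, / 2 <= a -> Rabs (/ a) <= 2).
  { intros a Ha; rewrite Rabs_pos_eq by (left; apply Rinv_0_lt_compat; lra).
    replace 2 with (/ / 2) by field; apply Rinv_le_contravar; lra. }
  split.
  + assert (Z : Rabs 0 <= 2) by (rewrite Rabs_R0; lra).
    assert (H := Hhalf s Hst1 t 0 0 Z Z).
    replace (/ f s t 0 0 - 1) with ((f s t 0 0 - 1) * - / f s t 0 0) by (field; lra).
    eapply Rle_trans; [apply Rabs_mult_le; [exact J0|rewrite Rabs_Ropp; now apply Hinv]|].
    nra.
  + intros u y u' y' A1 A2 A3 A4.
    assert (H := Hhalf s Hst1 t u y A1 A2); assert (H' := Hhalf s Hst1 t u' y' A3 A4).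
    specialize (J1 u y u' y' A1 A2 A3 A4).
    replace (/ f s t u y - / f s t u' y' - s * 0 * (y - y')) with
      ((f s t u y - f s t u' y' - s * 0 * (y - y')) * (/ f s t u y * - / f s t u' y'))
      by (field; lra).
    eapply Rle_trans; [apply Rabs_mult_le; [exact J1|]|].
    * apply Rabs_mult_le; [now apply Hinv|rewrite Rabs_Ropp; now apply Hinv].
    * assert (0 <= s ^ 2 * (Rabs (u - u') + Rabs (y - y'))).
      { apply Rmult_le_pos; [exact s2|]; apply Rplus_le_le_0_compat; apply Rabs_pos. }
      nra.
Qed.

Lemma jet_small (f : R -> R -> R -> R -> R) f0 f1 k :
  (2 <= k)%nat -> jet f f0 f1 ->
  jet (fun s t u y => s ^ k * f s t u y) (fun _ => 0) (fun _ => 0).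
Proof.
intros Hk Hf.
assert (Hpow : jet (fun s _ _ _ => s ^ k) (fun _ => 0) (fun _ => 0)).
{ exists 1, 1; split; [lra|split; [lra|split]].
  - intros t; cbv beta; rewrite Rabs_R0; lra.
  - intros s t Hs.
    assert (H : 0 <= s ^ k) by (apply pow_le; lra); split.
    + rewrite Rminus_0_r, Rabs_pos_eq, Rmult_1_l by exact H.
      replace k with (2 + (k - 2))%nat by lia; rewrite pow_add.
      rewrite <- (Rmult_1_r (s ^ 2)) at 2; apply Rmult_le_compat_l; [apply pow2_ge_0|].
      rewrite <- (pow1 (k - 2)); apply pow_incr; lra.
    + intros u y u' y' _ _ _ _.
      replace (s ^ k - s ^ k - s * 0 * (y - y')) with 0 by ring; rewrite Rabs_R0.
      apply Rmult_le_pos; [rewrite Rmult_1_l; apply pow2_ge_0|].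
      apply Rplus_le_le_0_compat; apply Rabs_pos. }
eapply jet_ext; [| | |apply (jet_mult _ _ _ _ _ _ Hpow Hf)]; intros; simpl; ring.
Qed.

Lemma jet_poly3 d a X X0 Y Y0 Z Z0 Z1 :
  jet X X0 (fun _ => 0) -> jet Y Y0 (fun _ => 0) -> jet Z Z0 Z1 ->
  jet (fun s t u y => poly3 d a (X s t u y, Y s t u y, Z s t u y))
      (fun t => poly3 d a (X0 t, Y0 t, Z0 t))
      (fun t => dz_poly3 d a (X0 t) (Y0 t) (Z0 t) * Z1 t).
Proof.
intros HX HY HZ; unfold poly3, dz_poly3.
eapply jet_ext; [intros; reflexivity|intros; reflexivity| |].
2:{ apply jet_sum_n; intros i; apply jet_sum_n; intros j; apply jet_sum_n; intros k.
    apply jet_mult; [|apply jet_pow, HZ].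
    apply jet_mult; [|apply jet_pow, HY].
    apply jet_mult; [apply jet_const|apply jet_pow, HX]. }
intros t; symmetry; cbv beta.
rewrite Rmult_comm; rewrite <- (sum_n_mult_l (K := R_Ring)); apply sum_n_ext; intros i.
rewrite <- (sum_n_mult_l (K := R_Ring)); apply sum_n_ext; intros j.
rewrite <- (sum_n_mult_l (K := R_Ring)); apply sum_n_ext; intros k.
unfold mult; simpl; ring.
Qed.

(** * The perturbed system in scaled polar coordinates *)

Section Model.
Variables (h : R -> R -> R) (m n p : nat) (a b c : nat -> nat -> nat -> R) (z0 sg : R).
Hypothesis h_adm : admissible h.
Hypothesis A_h_zero : forall t, 0 <= t < 2 * PI -> A_h h t = 0.
Hypothesis sg_unit : sg * sg = 1.

Lemma sg_abs : Rabs sg = 1.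
Proof.
assert (H : Rabs sg * Rabs sg = 1) by (rewrite <- Rabs_mult, sg_unit; apply Rabs_R1).
assert (H' := Rabs_pos sg); nra.
Qed.

(** The height of the unperturbed orbit above the angle [t]. *)
Definition base (t : R) : R := z0 + RInt (fun v => h (cos v) (sin v)) 0 t.
Definition eps_of (s : R) : R := sg * s ^ 4.
Definition rad (s u : R) : R := 1 + s ^ 3 * u.

(** In these coordinates, with [eps = sg * s^4], the flow reads
      [t' = omega],
      [u' = rad * (rad + 1) * u + sg * s * radial],
      [y' = sg * s^3 * omega * drift],
    as [cartesian_flow] and [polar_flow] below show.  The term [bump] is the change of
    [h] along the ray divided by [eps]. *)
Definition at_polar (d : nat) (e : nat -> nat -> nat -> R) (s t u y : R) : R :=
  poly3 d e (rad s u * cos t, rad s u * sin t, base t + s * y).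
Definition radial (s t u y : R) : R :=
  cos t * at_polar m a s t u y + sin t * at_polar n b s t u y.
Definition angular (s t u y : R) : R :=
  (cos t * at_polar n b s t u y - sin t * at_polar m a s t u y) * / rad s u.
Definition omega (s t u y : R) : R := 1 + eps_of s * angular s t u y.
Definition bump (s t u : R) : R :=
  sg * (h (rad s u * cos t) (rad s u * sin t) - loop_height h t) * / s ^ 4.
Definition drift (s t u y : R) : R :=
  (bump s t u + at_polar p c s t u y - loop_height h t * angular s t u y) * / omega s t u y.

(** The limits of [drift] and of its derivative in [s * y] as [s] tends to 0.  The
    integral of [drift0] over a turn is [- Mbar z0]. *)
Definition drift0 (t : R) : R :=
  poly3 p c (cos t, sin t, base t) -
  loop_height h t * (cos t * poly3 n b (cos t, sin t, base t) -
                     sin t * poly3 m a (cos t, sin t, base t)).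
Definition drift1 (t : R) : R :=
  dz_poly3 p c (cos t) (sin t) (base t) -
  loop_height h t * (cos t * dz_poly3 n b (cos t) (sin t) (base t) -
                     sin t * dz_poly3 m a (cos t) (sin t) (base t)).

Lemma base_derive t : is_derive base t (loop_height h t).
Proof.
evar_last.
- apply (is_derive_plus (fun _ => z0) (prim (loop_height h))); [apply is_derive_const|].
  apply prim_derive, loop_height_continuous, h_adm.
- unfold plus, zero; simpl; ring.
Qed.

Lemma base_continuous t : continuous base t.
Proof. eapply is_derive_cont, base_derive. Qed.

Lemma base_periodic : periodic (2 * PI) base.
Proof.
intros t; unfold base; f_equal; apply (prim_periodic (loop_height h)).
- apply loop_height_periodic.
- intros; apply loop_height_continuous, h_adm.
- apply loop_height_mean_zero, h_adm.
Qed.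

Lemma jet_rad : jet (fun s _ u _ => rad s u) (fun _ => 1) (fun _ => 0).
Proof.
exists 1, 1; split; [lra|split; [lra|split]].
- intros t; cbv beta; rewrite Rabs_R1, Rabs_R0; lra.
- intros s t Hs; unfold rad; split.
  + replace (1 + s ^ 3 * 0 - 1) with 0 by ring; rewrite Rabs_R0; nra.
  + intros u y u' y' _ _ _ _.
    replace (1 + s ^ 3 * u - (1 + s ^ 3 * u') - s * 0 * (y - y')) with (s ^ 3 * (u - u')) by ring.
    assert (H := Rabs_pos (u - u')); assert (H' := Rabs_pos (y - y')).
    rewrite Rabs_mult, Rabs_pos_eq by (apply pow_le; lra).
    apply Rmult_le_compat; try lra; [apply pow_le; lra|].
    simpl; nra.
Qed.

Lemma jet_height : jet (fun s t _ y => base t + s * y) base (fun _ => 1).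
Proof.
destruct (loop_bounded base base_periodic base_continuous) as [K HK].
exists (Rmax K 1), 1; assert (H1 := Rmax_l K 1); assert (H2 := Rmax_r K 1).
split; [lra|split; [lra|split]].
- intros t; rewrite Rabs_R1; specialize (HK t); lra.
- intros s t Hs.
  assert (Hp : 0 <= Rmax K 1 * s ^ 2) by (apply Rmult_le_pos; [lra|apply pow2_ge_0]).
  split.
  + replace (base t + s * 0 - base t) with 0 by ring; now rewrite Rabs_R0.
  + intros u y u' y' _ _ _ _.
    replace (base t + s * y - (base t + s * y') - s * 1 * (y - y')) with 0 by ring.
    rewrite Rabs_R0; apply Rmult_le_pos; [exact Hp|].
    apply Rplus_le_le_0_compat; apply Rabs_pos.
Qed.

Lemma jet_cos : jet (fun _ t _ _ => cos t) cos (fun _ => 0).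
Proof.
apply (jet_base cos 1); intros t; apply Rabs_le; split; apply COS_bound.
Qed.

Lemma jet_sin : jet (fun _ t _ _ => sin t) sin (fun _ => 0).
Proof.
apply (jet_base sin 1); intros t; apply Rabs_le; split; apply SIN_bound.
Qed.

Lemma jet_loop_height : jet (fun _ t _ _ => loop_height h t) (loop_height h) (fun _ => 0).
Proof.
destruct (loop_bounded (loop_height h) (loop_height_periodic h)
            (loop_height_continuous h h_adm)) as [K HK].
now apply (jet_base (loop_height h) K).
Qed.

Lemma jet_at_polar d e :
  jet (at_polar d e) (fun t => poly3 d e (cos t, sin t, base t))
      (fun t => dz_poly3 d e (cos t) (sin t) (base t)).
Proof.
unfold at_polar; eapply jet_ext; [| | |apply jet_poly3].
- intros; reflexivity.
- intros; reflexivity.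
- intros; apply Rmult_1_r.
- eapply jet_ext; [| | |apply (jet_mult _ _ _ _ _ _ jet_rad jet_cos)]; intros; simpl; ring.
- eapply jet_ext; [| | |apply (jet_mult _ _ _ _ _ _ jet_rad jet_sin)]; intros; simpl; ring.
- apply jet_height.
Qed.

Lemma jet_inv_rad : jet (fun s _ u _ => / rad s u) (fun _ => 1) (fun _ => 0).
Proof. apply jet_inv, jet_rad. Qed.

Lemma jet_angular :
  jet angular
    (fun t => cos t * poly3 n b (cos t, sin t, base t) - sin t * poly3 m a (cos t, sin t, base t))
    (fun t => cos t * dz_poly3 n b (cos t) (sin t) (base t)
              - sin t * dz_poly3 m a (cos t) (sin t) (base t)).
Proof.
eapply jet_ext; [| | |apply jet_mult; [apply jet_minus; apply jet_mult|apply jet_inv_rad]].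
4: apply jet_cos. 4: apply (jet_at_polar n b). 4: apply jet_sin. 4: apply (jet_at_polar m a).
- intros; reflexivity.
- intros; simpl; ring.
- intros; simpl; ring.
Qed.

Lemma jet_omega : jet omega (fun _ => 1) (fun _ => 0).
Proof.
eapply jet_ext; [| | |apply jet_plus; [apply (jet_const 1)|
  apply (jet_scal sg), (jet_small _ _ _ 4 ltac:(lia) jet_angular)]].
- intros; unfold omega, eps_of; ring.
- intros; simpl; ring.
- intros; simpl; ring.
Qed.

(** Radial flatness makes [h] vary by [O(s^3 * s^3)], and [eps] is of size [s^4]. *)
Lemma jet_bump : jet (fun s t u _ => bump s t u) (fun _ => 0) (fun _ => 0).
Proof.
destruct (radial_flatness h h_adm A_h_zero) as [K [HK Hf]].
assert (Hsg := sg_abs).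
exists (4 * K), (/ 4); split; [lra|split; [lra|split]].
- intros t; cbv beta; rewrite Rabs_R0; lra.
- intros s t Hs; unfold bump, rad.
  assert (s2 : 0 <= s ^ 2) by apply pow2_ge_0.
  assert (s3 : 0 < s ^ 3) by (apply pow_lt; lra).
  assert (s3' : s ^ 3 <= / 4) by (simpl; nra).
  assert (s4 : 0 < s ^ 4) by (apply pow_lt; lra).
  split.
  + unfold loop_height; rewrite Rmult_0_r, Rplus_0_r, !Rmult_1_l.
    replace (sg * (h (cos t) (sin t) - h (cos t) (sin t)) * / s ^ 4 - 0) with 0 by ring.
    rewrite Rabs_R0; apply Rmult_le_pos; lra.
  + intros u y u' y' A1 _ A2 _.
    assert (B : forall v, Rabs v <= 2 -> Rabs (s ^ 3 * v) <= s ^ 3 * 2).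
    { intros v Hv; apply Rabs_mult_le; [rewrite Rabs_pos_eq; lra|exact Hv]. }
    assert (B1 := B u A1); assert (B2 := B u' A2).
    specialize (Hf t (s ^ 3 * u) (s ^ 3 * u') ltac:(lra) ltac:(lra)).
    set (h1 := h ((1 + s ^ 3 * u) * cos t) ((1 + s ^ 3 * u) * sin t)) in *.
    set (h2 := h ((1 + s ^ 3 * u') * cos t) ((1 + s ^ 3 * u') * sin t)) in *.
    replace (sg * (h1 - loop_height h t) * / s ^ 4 - sg * (h2 - loop_height h t) * / s ^ 4
             - s * 0 * (y - y')) with (sg * / s ^ 4 * (h1 - h2)) by ring.
    rewrite !Rabs_mult, Hsg, Rmult_1_l, Rabs_inv, (Rabs_pos_eq (s ^ 4)) by lra.
    assert (Hd : Rabs (h1 - h2) <= K * (4 * s ^ 3) * (s ^ 3 * Rabs (u - u'))).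
    { eapply Rle_trans; [exact Hf|].
      replace (s ^ 3 * u - s ^ 3 * u') with (s ^ 3 * (u - u')) by ring.
      rewrite (Rabs_mult (s ^ 3) (u - u')), (Rabs_pos_eq (s ^ 3)) by lra.
      apply Rmult_le_compat_r; [apply Rmult_le_pos; [lra|apply Rabs_pos]|].
      apply Rmult_le_compat_l; lra. }
    apply Rle_trans with (/ s ^ 4 * (K * (4 * s ^ 3) * (s ^ 3 * Rabs (u - u')))).
    * apply Rmult_le_compat_l; [left; now apply Rinv_0_lt_compat|exact Hd].
    * replace (/ s ^ 4 * (K * (4 * s ^ 3) * (s ^ 3 * Rabs (u - u')))) with
        (4 * K * s ^ 2 * Rabs (u - u')) by (field; lra).
      assert (H := Rabs_pos (y - y')).
      apply Rmult_le_compat_l; [apply Rmult_le_pos; lra|lra].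
Qed.

Lemma jet_drift : jet drift drift0 drift1.
Proof.
eapply jet_ext; [| | |apply jet_mult; [apply jet_minus; [apply jet_plus; [apply jet_bump|
  apply (jet_at_polar p c)]|apply (jet_mult _ _ _ _ _ _ jet_loop_height jet_angular)]
  |apply (jet_inv _ jet_omega)]].
- intros; reflexivity.
- intros; unfold drift0; ring.
- intros; unfold drift1; simpl; ring.
Qed.

Lemma jet_radial_over_omega :
  exists f0 f1, jet (fun s t u y => radial s t u y * / omega s t u y) f0 f1.
Proof.
do 2 eexists; apply jet_mult; [apply jet_plus; apply jet_mult|apply (jet_inv _ jet_omega)].
- apply jet_cos.
- apply (jet_at_polar m a).
- apply jet_sin.
- apply (jet_at_polar n b).
Qed.

Lemma jet_expansion :
  jet (fun s t u y => rad s u * (rad s u + 1) * / omega s t u y) (fun _ => 2) (fun _ => 0).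
Proof.
eapply jet_ext; [| | |apply jet_mult; [apply jet_mult; [apply jet_rad|
  apply (jet_plus _ _ _ _ _ _ jet_rad (jet_const 1))]|apply (jet_inv _ jet_omega)]].
- intros; reflexivity.
- intros; simpl; ring.
- intros; simpl; ring.
Qed.

Lemma at_polar_periodic d e s t u y : at_polar d e s (t + 2 * PI) u y = at_polar d e s t u y.
Proof. unfold at_polar; now rewrite base_periodic, cos_2PI_periodic, sin_2PI_periodic. Qed.

Lemma angular_periodic s t u y : angular s (t + 2 * PI) u y = angular s t u y.
Proof.
unfold angular; now rewrite !at_polar_periodic, cos_2PI_periodic, sin_2PI_periodic.
Qed.

Lemma omega_periodic s t u y : omega s (t + 2 * PI) u y = omega s t u y.
Proof. unfold omega; now rewrite angular_periodic. Qed.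

Lemma omega_continuous s (u y : R -> R) t :
  rad s (u t) <> 0 -> continuous u t -> continuous y t ->
  continuous (fun t => omega s t (u t) (y t)) t.
Proof.
intros Hr Hu Hy; assert (Hb := base_continuous t).
assert (Hrad : continuous (fun t => rad s (u t)) t) by (unfold rad; cont).
unfold omega, angular, at_polar; cont.
now apply (cont_inv (fun t => rad s (u t))).
Qed.

Lemma drift_continuous s (u y : R -> R) t :
  rad s (u t) <> 0 -> omega s t (u t) (y t) <> 0 -> continuous u t -> continuous y t ->
  continuous (fun t => drift s t (u t) (y t)) t.
Proof.
intros Hr Ho Hu Hy; assert (Hb := base_continuous t).
assert (Hl := loop_height_continuous h h_adm t).
assert (Hrad : continuous (fun t => rad s (u t)) t) by (unfold rad; cont).
unfold drift; cont.
- unfold bump; cont.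
  apply (continuous_comp_2 (fun t => rad s (u t) * cos t) (fun t => rad s (u t) * sin t) h);
    [cont|cont|].
  apply continuity_2d_continuous, (h_continuity h h_adm), ray_nonzero;
    [exact Hr|apply cos_sin_sqr].
- unfold at_polar; cont.
- unfold angular, at_polar; cont. now apply (cont_inv (fun t => rad s (u t))).
- apply (cont_inv (fun t => omega s t (u t) (y t))); [exact Ho|].
  now apply omega_continuous.
Qed.

Lemma drift0_continuous t : continuous drift0 t.
Proof.
assert (H := base_continuous t); assert (H' := loop_height_continuous h h_adm t).
unfold drift0; cont.
Qed.

Lemma drift1_continuous t : continuous drift1 t.
Proof.
assert (H := base_continuous t); assert (H' := loop_height_continuous h h_adm t).
unfold drift1; cont.
Qed.

Lemma drift0_periodic : periodic (2 * PI) drift0.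
Proof.
intros t; unfold drift0.
now rewrite base_periodic, (loop_height_periodic h), cos_2PI_periodic, sin_2PI_periodic.
Qed.

Lemma drift1_periodic : periodic (2 * PI) drift1.
Proof.
intros t; unfold drift1.
now rewrite base_periodic, (loop_height_periodic h), cos_2PI_periodic, sin_2PI_periodic.
Qed.

Lemma Mbar_drift0 : Mbar h m n p a b c z0 = - prim drift0 (2 * PI).
Proof.
unfold Mbar, prim; apply f_equal, RInt_ext; intros t _.
apply Rminus_diag_uniq; unfold drift0, cylinder_solution, loop_height, base; ring.
Qed.

(** * The averaged system and its estimates *)

Section Coordinates.
Hypothesis drift0_mean_zero : prim drift0 (2 * PI) = 0.
Hypothesis drift1_mean_nonzero : prim drift1 (2 * PI) <> 0.

Definition mean_drift1 : R := prim drift1 (2 * PI) / (2 * PI).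
Definition corrector : R -> R := prim drift0.
Definition oscillation : R -> R := prim (fun t => drift1 t - mean_drift1).
Definition gauge (s t : R) : R := exp (eps_of s * oscillation t).

(** The averaging change of variable.  The equation
    [dy/dt = sg s^3 (drift0 t + s * drift1 t * y + O(s^2))] has a forcing and a linear
    coefficient that depend on [t]; [corrector] absorbs the first and [gauge] replaces
    the second by its mean.  Both are periodic because what they integrate has mean
    zero. *)
Definition height (s t v : R) : R := sg * s ^ 3 * corrector t + gauge s t * v.

Definition rest_u (s t u v : R) : R :=
  u * (rad s u * (rad s u + 1) * / omega s t u (height s t v) - 2) +
  sg * s * (radial s t u (height s t v) * / omega s t u (height s t v)).
Definition rest_v (s t u v : R) : R :=
  sg * s ^ 3 * / gauge s t *
  (drift s t u (height s t v) - drift0 t - s * drift1 t * (gauge s t * v)).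

Lemma corrector_derive t : is_derive corrector t (drift0 t).
Proof. apply prim_derive, drift0_continuous. Qed.

Lemma corrector_periodic : periodic (2 * PI) corrector.
Proof. apply prim_periodic; [apply drift0_periodic|apply drift0_continuous|exact drift0_mean_zero]. Qed.

Lemma drift1_centered_continuous t : continuous (fun t => drift1 t - mean_drift1) t.
Proof. assert (H := drift1_continuous t); cont. Qed.

Lemma oscillation_derive t : is_derive oscillation t (drift1 t - mean_drift1).
Proof. apply (prim_derive (fun t => drift1 t - mean_drift1)), drift1_centered_continuous. Qed.

Lemma oscillation_periodic : periodic (2 * PI) oscillation.
Proof.
apply prim_periodic; [|exact drift1_centered_continuous|].
- intros t; now rewrite drift1_periodic.
- assert (E : RInt (fun t => drift1 t - mean_drift1) 0 (2 * PI) =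
              RInt drift1 0 (2 * PI) - RInt (fun _ => mean_drift1) 0 (2 * PI)).
  { apply (RInt_minus (V := R_CompleteNormedModule) drift1 (fun _ => mean_drift1)).
    - apply cont_ex_RInt, drift1_continuous.
    - apply cont_ex_RInt; intros; apply cont_const. }
  unfold prim; rewrite E, RInt_const; unfold scal; simpl; unfold mult; simpl.
  unfold mean_drift1, prim; assert (H := PI_RGT_0); field; lra.
Qed.

Lemma corrector_continuous t : continuous corrector t.
Proof. eapply is_derive_cont, corrector_derive. Qed.

Lemma oscillation_continuous t : continuous oscillation t.
Proof. eapply is_derive_cont, oscillation_derive. Qed.

Lemma gauge_pos s t : 0 < gauge s t.
Proof. apply exp_pos. Qed.

Lemma gauge_periodic s t : gauge s (t + 2 * PI) = gauge s t.
Proof. unfold gauge; now rewrite oscillation_periodic. Qed.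

Lemma height_periodic s t v : height s (t + 2 * PI) v = height s t v.
Proof. unfold height; now rewrite gauge_periodic, corrector_periodic. Qed.

Lemma height_continuous s (v : R -> R) t :
  continuous v t -> continuous (fun t => height s t (v t)) t.
Proof.
intros Hv; assert (H1 := corrector_continuous t); assert (H2 := oscillation_continuous t).
unfold height, gauge; cont.
Qed.

Lemma mean_drift1_pos : 0 < Rabs mean_drift1.
Proof.
apply Rabs_pos_lt; unfold mean_drift1; assert (H := twoPI_pos); intros E.
apply drift1_mean_nonzero, (Rmult_eq_reg_r (/ (2 * PI))); [|apply Rinv_neq_0_compat; lra].
rewrite Rmult_0_l; exact E.
Qed.

Lemma pow_le_self s k : 0 < s <= / 4 -> 0 < s ^ S k <= s.
Proof.
intros Hs; split; [apply pow_lt; lra|].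
assert (H : s ^ k <= 1) by (rewrite <- (pow1 k); apply pow_incr; lra).
assert (0 <= s ^ k) by (apply pow_le; lra); simpl; nra.
Qed.

Lemma eps_of_abs s : 0 < s -> Rabs (eps_of s) = s ^ 4.
Proof.
intros Hs; unfold eps_of; rewrite Rabs_mult, sg_abs, Rabs_pos_eq by (apply pow_le; lra); ring.
Qed.

Lemma sg_pow_abs s k : 0 < s -> Rabs (sg * s ^ k) <= s ^ k.
Proof.
intros Hs; rewrite Rabs_mult, sg_abs, Rabs_pos_eq by (apply pow_le; lra); lra.
Qed.

(** What the change of variables needs at a given scale in order to be regular on the
    box where the loop and its competitors live. *)
Definition tame (s : R) : Prop :=
  s <= / 4 /\
  (forall t u y, Rabs u <= 2 -> Rabs y <= 2 -> / 2 <= omega s t u y /\ / 2 <= rad s u) /\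
  (forall t, / 2 <= gauge s t <= 2) /\
  (forall t v, Rabs v <= 1 -> Rabs (height s t v) <= 2).

Lemma tame_for_small : for_small tame.
Proof.
destruct (loop_bounded corrector corrector_periodic corrector_continuous) as [KW HW].
destruct (loop_bounded oscillation oscillation_periodic oscillation_continuous) as [KO HO].
assert (HC := jet_near_one _ jet_omega); assert (HD := jet_near_one _ jet_rad).
assert (L1 := for_small_linear 1 (/ 4) ltac:(lra)).
assert (L2 := for_small_linear KW (/ 4) ltac:(lra)).
assert (L3 := for_small_linear KO (/ 2) ltac:(lra)).
assert (H := for_small_and _ _ (for_small_and _ _ HC HD)
               (for_small_and _ _ L1 (for_small_and _ _ L2 L3))).
revert H; apply for_small_imp; intros s Hs [[Hom Hrad] [S1 [S2 S3]]].
assert (Hs4 : 0 < s <= / 4) by lra.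
assert (Hgauge : forall t, / 2 <= gauge s t <= 7 / 4).
{ assert (Hosc : forall t, Rabs (eps_of s * oscillation t) <= / 2).
  { intros t; rewrite Rabs_mult, eps_of_abs by exact Hs.
    assert (s4 := pow_le_self s 3 Hs4); specialize (HO t).
    assert (Hp := Rabs_pos (oscillation t)); nra. }
  intros t; split; [|apply exp_half_bound, Hosc].
  assert (H : exp (- (eps_of s * oscillation t)) <= 7 / 4)
    by (apply exp_half_bound; rewrite Rabs_Ropp; apply Hosc).
  rewrite exp_Ropp in H; fold (gauge s t) in H; assert (Hp := gauge_pos s t).
  apply Rmult_le_reg_l with (/ gauge s t); [now apply Rinv_0_lt_compat|].
  rewrite Rinv_l; lra. }
split; [lra|split; [|split]].
- intros t u y Hu Hy; split; [now apply Hom|now apply (Hrad t u y)].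
- intros t; specialize (Hgauge t); lra.
- intros t v Hv; unfold height; eapply Rle_trans; [apply Rabs_triang|].
  assert (H1 := Rabs_mult_le _ _ _ _ (sg_pow_abs s 3 Hs) (HW t)).
  assert (H2 : Rabs (gauge s t * v) <= 7 / 4 * 1).
  { apply Rabs_mult_le; [|exact Hv].
    specialize (Hgauge t); rewrite Rabs_pos_eq; lra. }
  assert (s3 := pow_le_self s 2 Hs4).
  assert (0 <= KW) by (eapply Rle_trans; [apply Rabs_pos|apply (HW 0)]).
  assert (s ^ 3 * KW <= s * KW) by (apply Rmult_le_compat_r; lra); lra.
Qed.

Lemma height_increment s t u v u' v' :
  tame s ->
  Rabs (u - u') + Rabs (height s t v - height s t v') <= 2 * (Rabs (u - u') + Rabs (v - v')).
Proof.
intros [_ [_ [Hg _]]]; unfold height.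
replace (sg * s ^ 3 * corrector t + gauge s t * v - (sg * s ^ 3 * corrector t + gauge s t * v'))
  with (gauge s t * (v - v')) by ring.
rewrite Rabs_mult, (Rabs_pos_eq (gauge s t)) by (specialize (Hg t); lra).
assert (P1 := Rabs_pos (u - u')); assert (P2 := Rabs_pos (v - v')); specialize (Hg t); nra.
Qed.

(** In [rest_u] the factor of [u] is [2 + O(s)] minus 2, and the forcing carries a
    factor [s]. *)
Lemma rest_u_weakly_coupled : for_small (fun s => weakly_coupled (2 * PI) 2 (rest_u s)).
Proof.
destruct jet_radial_over_omega as [L0 [L1 JL]].
destruct (jet_common _ _ _ _ _ _ JL jet_expansion) as [K [s0 [HK [Hs0 [BL BJ]]]]].
assert (Hsmall : for_small (fun s => s <= s0)) by (exists s0; split; [|intros]; lra).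
assert (H := for_small_and _ _ tame_for_small
               (for_small_and _ _ Hsmall (for_small_linear K (/ 100) ltac:(lra)))).
revert H; apply for_small_imp; intros s Hs [Htame [Hss0 HKs]].
assert (Hs' : 0 < s <= s0) by lra.
assert (Hh := fun t u v u' v' => height_increment s t u v u' v' Htame).
destruct Htame as [Hs4 [Hbox [_ Hheight]]].
assert (Hsgs : Rabs (sg * s) <= s) by (rewrite Rabs_mult, sg_abs, Rabs_pos_eq; lra).
split.
- lra.
- intros t u v; unfold rest_u, radial.
  now rewrite height_periodic, !omega_periodic, !at_polar_periodic, cos_2PI_periodic,
    sin_2PI_periodic.
- intros u v Cu Cv Bu Bv t.
  assert (Hy := height_continuous s v t (Cv t)); assert (Cut := Cu t).
  assert (Hb := base_continuous t).
  destruct (Hbox t (u t) (height s t (v t))) as [Ho Hr];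
    [specialize (Bu t); lra|apply Hheight; specialize (Bv t); lra|].
  assert (Hinv : continuous (fun t => / omega s t (u t) (height s t (v t))) t).
  { apply (cont_inv (fun t => omega s t (u t) (height s t (v t)))); [lra|].
    apply (omega_continuous s u (fun t => height s t (v t))); auto; lra. }
  unfold rest_u, radial, at_polar, rad; cont.
- intros t u v Hu Hv; assert (Hy := Hheight t v Hv).
  assert (E1 := jet_near K s0 _ _ _ s t u (height s t v) HK (proj2 Hs0) BJ Hs' ltac:(lra) Hy).
  assert (E2 := jet_bounded K s0 _ _ _ s t u (height s t v) HK (proj2 Hs0) BL Hs' ltac:(lra) Hy).
  cbv beta in E1, E2.
  assert (E3 := Rabs_mult_le _ _ _ _ Hu E1).
  assert (E4 := Rabs_mult_le _ _ _ _ Hsgs E2).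
  rewrite (Rabs_pos_eq 2) by lra.
  unfold rest_u; eapply Rle_trans; [apply Rabs_triang|lra].
- intros t u v u' v' Hu Hv Hu' Hv'.
  assert (Hy := Hheight t v Hv); assert (Hy' := Hheight t v' Hv').
  assert (E1 := jet_near K s0 _ _ _ s t u (height s t v) HK (proj2 Hs0) BJ Hs' ltac:(lra) Hy).
  destruct BJ as [_ BJ]; destruct (BJ s t Hs') as [_ E2].
  specialize (E2 u (height s t v) u' (height s t v') ltac:(lra) Hy ltac:(lra) Hy').
  destruct BL as [BL0 BL]; destruct (BL s t Hs') as [_ E3].
  specialize (E3 u (height s t v) u' (height s t v') ltac:(lra) Hy ltac:(lra) Hy').
  destruct (BL0 t) as [_ E4].
  cbv beta in E1, E2, E3.
  specialize (Hh t u v u' v'); set (N := Rabs (u - u') + Rabs (v - v')) in *.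
  set (N' := Rabs (u - u') + Rabs (height s t v - height s t v')) in *.
  assert (P1 := Rabs_pos (u - u')); assert (P2 := Rabs_pos (height s t v - height s t v')).
  unfold rest_u.
  set (J := rad s u * (rad s u + 1) * / omega s t u (height s t v)) in *.
  set (J' := rad s u' * (rad s u' + 1) * / omega s t u' (height s t v')) in *.
  set (L := radial s t u (height s t v) * / omega s t u (height s t v)) in *.
  set (L' := radial s t u' (height s t v') * / omega s t u' (height s t v')) in *.
  set (dh := height s t v - height s t v') in *.
  assert (HN0 : 0 <= N') by (unfold N'; lra).
  assert (s2 := pow_le_self s 1 ltac:(lra)).
  assert (HJ : Rabs (J - J') <= K * s ^ 2 * N').
  { replace (J - J') with (J - J' - s * 0 * dh) by ring; exact E2. }
  assert (HL : Rabs (L - L') <= 2 * K * N').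
  { replace (L - L') with ((L - L' - s * L1 t * dh) + s * (L1 t * dh)) by ring.
    eapply Rle_trans; [apply Rabs_triang|].
    assert (Hs1 : Rabs s <= 1) by (rewrite Rabs_pos_eq; lra).
    assert (E5 := Rabs_mult_le _ _ _ _ Hs1 (Rabs_mult_le _ _ _ _ E4 (Rle_refl (Rabs dh)))).
    assert (K * s ^ 2 * N' <= K * 1 * N').
    { apply Rmult_le_compat_r; [lra|]; apply Rmult_le_compat_l; lra. }
    assert (K * Rabs dh <= K * N') by (apply Rmult_le_compat_l; unfold N'; lra).
    lra. }
  replace (u * (J - 2) + sg * s * L - (u' * (J' - 2) + sg * s * L')) with
    ((u - u') * (J - 2) + u' * (J - J') + sg * s * (L - L')) by ring.
  assert (D1 := Rabs_mult_le _ _ _ _ (Rle_refl (Rabs (u - u'))) E1).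
  assert (D2 := Rabs_mult_le _ _ _ _ Hu' HJ).
  assert (D3 := Rabs_mult_le _ _ _ _ Hsgs HL).
  eapply Rle_trans; [apply Rabs_triang|].
  eapply Rle_trans; [apply Rplus_le_compat_r, Rabs_triang|].
  rewrite (Rabs_pos_eq 2) by lra.
  assert (HKs2 : K * s ^ 2 <= K * s) by (apply Rmult_le_compat_l; lra).
  assert (T1 : Rabs (u - u') * (7 * K * s) <= 7 / 100 * N').
  { rewrite Rmult_comm; apply Rmult_le_compat; try lra; [|unfold N'; lra].
    repeat apply Rmult_le_pos; lra. }
  assert (T2 : K * s ^ 2 * N' <= / 100 * N') by (apply Rmult_le_compat_r; lra).
  assert (T3 : s * (2 * K * N') <= 2 / 100 * N').
  { replace (s * (2 * K * N')) with (2 * (K * s) * N') by ring.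
    apply Rmult_le_compat_r; lra. }
  lra.
Qed.

(** [rest_v] is [s^3] times the remainder of the expansion of [drift], hence of size
    [s^5], against a linear rate of size [s^4]. *)
Lemma rest_v_weakly_coupled :
  for_small (fun s => weakly_coupled (2 * PI) (eps_of s * mean_drift1) (rest_v s)).
Proof.
destruct jet_drift as [K [s0 [HK [Hs0 BG]]]].
destruct (loop_bounded corrector corrector_periodic corrector_continuous) as [KW HW].
assert (HKW : 0 <= KW) by (eapply Rle_trans; [apply Rabs_pos|apply (HW 0)]).
assert (Hg := mean_drift1_pos); set (g := Rabs mean_drift1) in *.
assert (Hsmall : for_small (fun s => s <= s0)) by (exists s0; split; [|intros]; lra).
assert (H := for_small_and _ _ tame_for_small (for_small_and _ _ Hsmall
  (for_small_and _ _ (for_small_linear K (g / 100) ltac:(lra))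
                     (for_small_linear (K * KW) (g / 100) ltac:(lra))))).
revert H; apply for_small_imp; intros s Hs [Htame [Hss0 [HKs HKWs]]].
assert (Hs' : 0 < s <= s0) by lra.
assert (Hh := fun t u v u' v' => height_increment s t u v u' v' Htame).
destruct Htame as [Hs4 [Hbox [Hgauge Hheight]]].
assert (Heps := eps_of_abs s Hs).
assert (s2 := pow_le_self s 1 ltac:(lra)); assert (s3 := pow_le_self s 2 ltac:(lra)).
assert (s4 := pow_le_self s 3 ltac:(lra)).
assert (Hfactor : forall t, Rabs (sg * s ^ 3 * / gauge s t) <= s ^ 3 * 2).
{ intros t; apply Rabs_mult_le; [now apply sg_pow_abs|].
  specialize (Hgauge t); rewrite Rabs_pos_eq by (left; apply Rinv_0_lt_compat; lra).
  replace 2 with (/ / 2) by field; apply Rinv_le_contravar; lra. }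
split.
- intros E; destruct (Rmult_integral _ _ E) as [E1|E1].
  + rewrite E1, Rabs_R0 in Heps; lra.
  + unfold g in Hg; rewrite E1, Rabs_R0 in Hg; lra.
- intros t u v; unfold rest_v, drift, bump.
  now rewrite height_periodic, !omega_periodic, !angular_periodic, !at_polar_periodic,
    gauge_periodic, (loop_height_periodic h), cos_2PI_periodic, sin_2PI_periodic,
    drift0_periodic, drift1_periodic.
- intros u v Cu Cv Bu Bv t.
  assert (Cut := Cu t); assert (Cvt := Cv t).
  destruct (Hbox t (u t) (height s t (v t))) as [Ho Hr];
    [specialize (Bu t); lra|apply Hheight; specialize (Bv t); lra|].
  assert (H0 := drift0_continuous t); assert (H1 := drift1_continuous t).
  assert (H2 := oscillation_continuous t).
  assert (Hga : continuous (fun t => gauge s t) t) by (unfold gauge; cont).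
  assert (Hgi : continuous (fun t => / gauge s t) t).
  { apply (cont_inv (fun t => gauge s t)); [|exact Hga].
    assert (Hp := gauge_pos s t); lra. }
  assert (Hd : continuous (fun t => drift s t (u t) (height s t (v t))) t).
  { apply (drift_continuous s u (fun t => height s t (v t))); auto; try lra.
    now apply height_continuous. }
  unfold rest_v; cont.
- intros t u v Hu Hv; assert (Hy := Hheight t v Hv).
  assert (Z : Rabs 0 <= 2) by (rewrite Rabs_R0; lra).
  destruct BG as [BG0 BG]; destruct (BG s t Hs') as [E1 E2]; destruct (BG0 t) as [_ E3].
  specialize (E2 u (height s t v) 0 0 ltac:(lra) Hy Z Z).
  rewrite !Rminus_0_r in E2.
  assert (Hcor := Rabs_mult_le _ _ _ _ (sg_pow_abs s 3 Hs) (HW t)).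
  assert (Hss : Rabs s <= s) by (rewrite Rabs_pos_eq; lra).
  assert (E4 := Rabs_mult_le _ _ _ _ Hss (Rabs_mult_le _ _ _ _ E3 Hcor)).
  unfold rest_v.
  replace (drift s t u (height s t v) - drift0 t - s * drift1 t * (gauge s t * v)) with
    ((drift s t u (height s t v) - drift s t 0 0 - s * drift1 t * height s t v) +
     (drift s t 0 0 - drift0 t) + s * (drift1 t * (sg * s ^ 3 * corrector t)))
    by (unfold height; ring).
  set (D := _ + _ + _).
  assert (E5 : K * s ^ 2 * (Rabs u + Rabs (height s t v)) <= K * s ^ 2 * 3).
  { apply Rmult_le_compat_l; [apply Rmult_le_pos|]; lra. }
  assert (E6 : s * (K * (s ^ 3 * KW)) <= K * KW * s ^ 2).
  { replace (s * (K * (s ^ 3 * KW))) with (K * KW * (s ^ 2 * s ^ 2)) by ring.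
    apply Rmult_le_compat_l; [now apply Rmult_le_pos|nra]. }
  assert (HD : Rabs D <= (4 * K + K * KW) * s ^ 2).
  { unfold D; eapply Rle_trans; [apply Rabs_triang|].
    eapply Rle_trans; [apply Rplus_le_compat_r, Rabs_triang|]; lra. }
  eapply Rle_trans; [apply (Rabs_mult_le _ _ _ _ (Hfactor t) HD)|].
  rewrite Rabs_mult, Heps; fold g.
  replace (s ^ 3 * 2 * ((4 * K + K * KW) * s ^ 2)) with
    (s ^ 4 * (8 * (K * s) + 2 * (K * KW * s))) by ring.
  replace (s ^ 4 * g / 2) with (s ^ 4 * (g / 2)) by field.
  apply Rmult_le_compat_l; lra.
- intros t u v u' v' Hu Hv Hu' Hv'.
  assert (Hy := Hheight t v Hv); assert (Hy' := Hheight t v' Hv').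
  destruct BG as [_ BG]; destruct (BG s t Hs') as [_ E2].
  specialize (E2 u (height s t v) u' (height s t v') ltac:(lra) Hy ltac:(lra) Hy').
  specialize (Hh t u v u' v'); set (N := Rabs (u - u') + Rabs (v - v')) in *.
  set (N' := Rabs (u - u') + Rabs (height s t v - height s t v')) in *.
  assert (P1 := Rabs_pos (u - u')); assert (P2 := Rabs_pos (height s t v - height s t v')).
  unfold rest_v.
  replace (sg * s ^ 3 * / gauge s t *
           (drift s t u (height s t v) - drift0 t - s * drift1 t * (gauge s t * v)) -
           sg * s ^ 3 * / gauge s t *
           (drift s t u' (height s t v') - drift0 t - s * drift1 t * (gauge s t * v'))) with
    (sg * s ^ 3 * / gauge s t *
     (drift s t u (height s t v) - drift s t u' (height s t v')
      - s * drift1 t * (height s t v - height s t v'))) by (unfold height; ring).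
  eapply Rle_trans; [apply (Rabs_mult_le _ _ _ _ (Hfactor t) E2)|].
  rewrite Rabs_mult, Heps; fold g.
  assert (HN0 : 0 <= N') by (unfold N'; lra).
  replace (s ^ 3 * 2 * (K * s ^ 2 * N')) with (s ^ 4 * (2 * (K * s) * N')) by ring.
  replace (s ^ 4 * g / 4 * N) with (s ^ 4 * (g / 4 * N)) by field.
  apply Rmult_le_compat_l; [lra|].
  assert (H1 : 2 * (K * s) * N' <= g / 50 * N') by (apply Rmult_le_compat_r; lra).
  assert (H2 : g / 50 * N' <= g / 50 * (2 * N)) by (apply Rmult_le_compat_l; lra).
  assert (0 <= g * N) by (apply Rmult_le_pos; lra).
  lra.
Qed.

Lemma gauge_derive s t :
  is_derive (gauge s) t (gauge s t * (eps_of s * (drift1 t - mean_drift1))).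
Proof.
eapply is_derive_eq.
- apply (is_derive_Rcomp exp (fun t => eps_of s * oscillation t)); [apply is_derive_exp|].
  apply (is_derive_scal oscillation); apply oscillation_derive.
- unfold gauge; ring.
Qed.

Lemma height_derive s (th V : R -> R) (t w dV : R) :
  is_derive th t w -> is_derive V t dV ->
  is_derive (fun t => height s (th t) (V t)) t
    (sg * s ^ 3 * (w * drift0 (th t)) +
     gauge s (th t) * (w * (eps_of s * (drift1 (th t) - mean_drift1)) * V t + dV)).
Proof.
intros Hth HV; unfold height; eapply is_derive_eq.
- apply is_derive_Rplus; [|apply is_derive_Rmult; [|exact HV]].
  + apply (is_derive_scal (fun t => corrector (th t))).
    apply (is_derive_Rcomp corrector th); [apply corrector_derive|exact Hth].
  + apply (is_derive_Rcomp (gauge s) th); [apply gauge_derive|exact Hth].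
- cbv beta; ring.
Qed.

Lemma height_flow s (th U V : R -> R) (t w : R) :
  is_derive th t w ->
  is_derive V t (w * (eps_of s * mean_drift1 * V t + rest_v s (th t) (U t) (V t))) ->
  is_derive (fun t => height s (th t) (V t)) t
    (sg * s ^ 3 * (w * drift s (th t) (U t) (height s (th t) (V t)))).
Proof.
intros Hth HV; eapply is_derive_eq; [apply (height_derive s th V t _ _ Hth HV)|].
unfold rest_v; assert (Hg := gauge_pos s (th t)).
unfold eps_of; field; lra.
Qed.

Definition height_inv (s t y : R) : R := (y - sg * s ^ 3 * corrector t) * / gauge s t.

Lemma height_invK s t y : height s t (height_inv s t y) = y.
Proof. unfold height, height_inv; assert (Hg := gauge_pos s t); field; lra. Qed.

Lemma height_inv_flow s (th U Y : R -> R) (t w : R) :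
  is_derive th t w ->
  is_derive Y t (sg * s ^ 3 * (w * drift s (th t) (U t) (Y t))) ->
  is_derive (fun t => height_inv s (th t) (Y t)) t
    (w * (eps_of s * mean_drift1 * height_inv s (th t) (Y t)
          + rest_v s (th t) (U t) (height_inv s (th t) (Y t)))).
Proof.
intros Hth HY; assert (Hg := gauge_pos s (th t)); eapply is_derive_eq.
- unfold height_inv; apply is_derive_Rmult; [apply is_derive_Rminus; [exact HY|]|].
  + apply (is_derive_scal (fun t => corrector (th t))).
    apply (is_derive_Rcomp corrector th); [apply corrector_derive|exact Hth].
  + apply (is_derive_inv (fun t => gauge s (th t))); [|lra].
    apply (is_derive_Rcomp (gauge s) th); [apply gauge_derive|exact Hth].
- unfold rest_v; rewrite height_invK; unfold height_inv, eps_of; field; lra.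
Qed.

(** * From scaled polar to Cartesian coordinates *)

Definition scaled_field (s : R) : R3 -> R3 := perturbed_field h (poly_map m n p a b c) (eps_of s).

Definition spot (s t u y : R) : R3 := (rad s u * cos t, rad s u * sin t, base t + s * y).

Lemma spot_in_phase_space s t u y : rad s u <> 0 -> phase_space h (spot s t u y).
Proof. intros H; left; apply ray_nonzero; [exact H|apply cos_sin_sqr]. Qed.

Lemma cartesian_flow s (th U Y : R -> R) (t : R) :
  0 < s -> rad s (U t) <> 0 -> omega s (th t) (U t) (Y t) <> 0 ->
  is_derive th t (omega s (th t) (U t) (Y t)) ->
  is_derive U t (rad s (U t) * (rad s (U t) + 1) * U t
                 + sg * s * radial s (th t) (U t) (Y t)) ->
  is_derive Y t (sg * s ^ 3 * (omega s (th t) (U t) (Y t) * drift s (th t) (U t) (Y t))) ->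
  is_derive (fun t => spot s (th t) (U t) (Y t)) t (scaled_field s (spot s (th t) (U t) (Y t))).
Proof.
intros Hs Hr Ho Hth HU HY.
assert (HR : is_derive (fun t => rad s (U t)) t
  (s ^ 3 * (rad s (U t) * (rad s (U t) + 1) * U t + sg * s * radial s (th t) (U t) (Y t)))).
{ eapply is_derive_eq.
  - apply (is_derive_Rplus (fun _ => 1) (fun t => s ^ 3 * U t)); [apply (is_derive_const 1)|].
    apply (is_derive_scal U), HU.
  - apply Rplus_0_l. }
assert (Hcs := cos_sin_sqr (th t)).
assert (HU3 : s ^ 3 * U t = rad s (U t) - 1) by (unfold rad; ring).
unfold scaled_field, perturbed_field, spot; simpl unperturbed_field; unfold poly_map.
fold (at_polar m a s (th t) (U t) (Y t)); fold (at_polar n b s (th t) (U t) (Y t)).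
fold (at_polar p c s (th t) (U t) (Y t)).
unfold scal, plus; simpl; unfold prod_scal, prod_plus; simpl.
unfold scal, plus; simpl; unfold prod_scal, prod_plus; simpl.
unfold scal, plus, mult; simpl; unfold mult; simpl.
apply (is_derive_R3 (fun t => rad s (U t) * cos (th t)) (fun t => rad s (U t) * sin (th t))
  (fun t => base (th t) + s * Y t)).
split; [|split].
- eapply is_derive_eq; [apply is_derive_Rmult; [exact HR|apply is_derive_cos_comp, Hth]|].
  unfold omega, angular, radial, eps_of.
  set (A := at_polar m a s (th t) (U t) (Y t)); set (B := at_polar n b s (th t) (U t) (Y t)).
  set (r := rad s (U t)) in *; set (C := cos (th t)) in *; set (S := sin (th t)) in *.
  replace (s ^ 3 * (r * (r + 1) * U t + sg * s * (C * A + S * B))) with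
    (r * (r + 1) * (s ^ 3 * U t) + sg * s ^ 4 * (C * A + S * B)) by ring.
  rewrite HU3; apply Rminus_diag_uniq.
  transitivity ((C * C + S * S - 1) * (sg * s ^ 4 * A - r * C * r * r)); [field; exact Hr|].
  rewrite Hcs; ring.
- eapply is_derive_eq; [apply is_derive_Rmult; [exact HR|apply is_derive_sin_comp, Hth]|].
  unfold omega, angular, radial, eps_of.
  set (A := at_polar m a s (th t) (U t) (Y t)); set (B := at_polar n b s (th t) (U t) (Y t)).
  set (r := rad s (U t)) in *; set (C := cos (th t)) in *; set (S := sin (th t)) in *.
  replace (s ^ 3 * (r * (r + 1) * U t + sg * s * (C * A + S * B))) with
    (r * (r + 1) * (s ^ 3 * U t) + sg * s ^ 4 * (C * A + S * B)) by ring.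
  rewrite HU3; apply Rminus_diag_uniq.
  transitivity ((C * C + S * S - 1) * (sg * s ^ 4 * B - r * S * r * r)); [field; exact Hr|].
  rewrite Hcs; ring.
- eapply is_derive_eq; [apply is_derive_Rplus|].
  + apply (is_derive_Rcomp base th); [apply base_derive|exact Hth].
  + apply (is_derive_scal Y), HY.
  + unfold drift.
    set (om := omega s (th t) (U t) (Y t)) in *.
    replace (om * ((bump s (th t) (U t) + at_polar p c s (th t) (U t) (Y t)
      - loop_height h (th t) * angular s (th t) (U t) (Y t)) * / om)) with
      (bump s (th t) (U t) + at_polar p c s (th t) (U t) (Y t)
      - loop_height h (th t) * angular s (th t) (U t) (Y t)) by (field; exact Ho).
    unfold om, omega, bump, eps_of.
    set (l := loop_height h (th t)); set (hh := h _ _); set (an := angular _ _ _ _).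
    set (Rz := at_polar p c _ _ _ _).
    transitivity (l + sg * sg * (hh - l) + sg * s ^ 4 * Rz); [field; lra|].
    rewrite sg_unit; ring.
Qed.

Lemma polar_flow s (X : R -> R3) :
  0 < s ->
  is_solution (phase_space h) (scaled_field s) X ->
  (forall t, 0 < fst (fst (X t)) * fst (fst (X t)) + snd (fst (X t)) * snd (fst (X t))) ->
  exists th U Y : R -> R, forall t,
    X t = spot s (th t) (U t) (Y t) /\ 0 < rad s (U t) /\
    is_derive th t (omega s (th t) (U t) (Y t)) /\
    is_derive U t (rad s (U t) * (rad s (U t) + 1) * U t
                   + sg * s * radial s (th t) (U t) (Y t)) /\
    (omega s (th t) (U t) (Y t) <> 0 ->
     is_derive Y t (sg * s ^ 3 * (omega s (th t) (U t) (Y t) * drift s (th t) (U t) (Y t)))).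
Proof.
intros Hs HX Hp.
pose (x := fun t => fst (fst (X t))); pose (y := fun t => snd (fst (X t))).
pose (z := fun t => snd (X t)).
assert (EX : forall t, X t = (x t, y t, z t)).
{ intros t; unfold x, y, z; now destruct (X t) as [[? ?] ?]. }
pose (A := fun t => poly3 m a (x t, y t, z t)); pose (B := fun t => poly3 n b (x t, y t, z t)).
pose (G := fun t => poly3 p c (x t, y t, z t)).
pose (dx := fun t => - y t + x t * (x t * x t + y t * y t - 1) + eps_of s * A t).
pose (dy := fun t => x t + y t * (x t * x t + y t * y t - 1) + eps_of s * B t).
assert (D : forall t, is_derive x t (dx t) /\ is_derive y t (dy t) /\
              is_derive z t (h (x t) (y t) + eps_of s * G t)).
{ intros t; apply is_derive_R3.
  destruct (HX t) as [_ HD].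
  apply (is_derive_ext X); [exact EX|].
  evar_last; [exact HD|].
  rewrite EX; unfold scaled_field, perturbed_field, poly_map; simpl unperturbed_field.
  unfold scal, plus; simpl; unfold prod_scal, prod_plus; simpl.
  unfold scal, plus; simpl; unfold prod_scal, prod_plus; simpl.
  unfold scal, plus, mult; simpl; unfold mult; simpl.
  unfold dx, dy, A, B, G, poly3; f_equal; f_equal; ring. }
assert (Cx : forall t, continuous x t) by (intros t; exact (is_derive_cont _ _ _ (proj1 (D t)))).
assert (Cy : forall t, continuous y t)
  by (intros t; exact (is_derive_cont _ _ _ (proj1 (proj2 (D t))))).
assert (Cz : forall t, continuous z t)
  by (intros t; exact (is_derive_cont _ _ _ (proj2 (proj2 (D t))))).
destruct (polar_lift x y dx dy) as [th Hth].
- intros t; apply D.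
- intros t; apply D.
- intros t; assert (H1 := Cx t); assert (H2 := Cy t); assert (H3 := Cz t).
  unfold dx, A; cont.
- intros t; assert (H1 := Cx t); assert (H2 := Cy t); assert (H3 := Cz t).
  unfold dy, B; cont.
- exact Hp.
- pose (r := fun t => sqrt (x t * x t + y t * y t)).
  pose (U := fun t => (r t - 1) * / s ^ 3).
  pose (Y := fun t => (z t - base (th t)) * / s).
  assert (s3 : 0 < s ^ 3) by (apply pow_lt; lra).
  assert (HU : forall t, rad s (U t) = r t) by (intros; unfold rad, U; field; lra).
  assert (HY : forall t, base (th t) + s * Y t = z t) by (intros; unfold Y; field; lra).
  exists th, U, Y; intros t.
  destruct (Hth t) as [Dth [Ex Ey]]; fold (r t) in Ex, Ey.
  assert (Hr : 0 < r t) by (apply sqrt_lt_R0, Hp).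
  assert (Hrr : r t * r t = x t * x t + y t * y t).
  { apply sqrt_sqrt; left; apply Hp. }
  assert (Hcs := cos_sin_sqr (th t)).
  assert (EA : at_polar m a s (th t) (U t) (Y t) = A t).
  { unfold at_polar, A; now rewrite HU, HY, <- Ex, <- Ey. }
  assert (EB : at_polar n b s (th t) (U t) (Y t) = B t).
  { unfold at_polar, B; now rewrite HU, HY, <- Ex, <- Ey. }
  assert (EG : at_polar p c s (th t) (U t) (Y t) = G t).
  { unfold at_polar, G; now rewrite HU, HY, <- Ex, <- Ey. }
  assert (Eth : (x t * dy t - y t * dx t) / (x t * x t + y t * y t) =
                omega s (th t) (U t) (Y t)).
  { rewrite <- Hrr; unfold omega, angular; rewrite EA, EB, HU; unfold dx, dy.
    rewrite <- Hrr.
    set (C := cos (th t)) in *; set (S := sin (th t)) in *; set (rr := r t) in *.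
    replace (x t * (x t + y t * (rr * rr - 1) + eps_of s * B t) -
      y t * (- y t + x t * (rr * rr - 1) + eps_of s * A t)) with
      (x t * x t + y t * y t + eps_of s * (x t * B t - y t * A t)) by ring.
    rewrite <- Hrr, Ex, Ey; field; lra. }
  rewrite Eth in Dth.
  split; [|split; [|split; [|split]]].
  + unfold spot; rewrite HU, HY, <- Ex, <- Ey; apply EX.
  + rewrite HU; exact Hr.
  + exact Dth.
  + eapply is_derive_eq.
    * apply is_derive_Rmult; [apply is_derive_Rminus|apply (is_derive_const (/ s ^ 3))].
      -- apply (is_derive_radius x y t (dx t) (dy t)); [apply Hp|apply D|apply D].
      -- apply (is_derive_const 1).
    * fold (r t); change (@zero R_NormedModule) with 0.
      unfold radial; rewrite EA, EB, HU; unfold dx, dy, eps_of; rewrite <- Hrr.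
      replace (x t * (- y t + x t * (r t * r t - 1) + sg * s ^ 4 * A t) +
               y t * (x t + y t * (r t * r t - 1) + sg * s ^ 4 * B t)) with
        ((x t * x t + y t * y t) * (r t * r t - 1) + sg * s ^ 4 * (x t * A t + y t * B t)) by ring.
      rewrite <- Hrr, Ex, Ey; unfold U; field; lra.
  + intros Ho; eapply is_derive_eq.
    * apply is_derive_Rmult; [apply is_derive_Rminus|apply (is_derive_const (/ s))].
      -- apply D.
      -- apply (is_derive_Rcomp base th); [apply base_derive|exact Dth].
    * change (@zero R_NormedModule) with 0.
      unfold drift; set (om := omega s (th t) (U t) (Y t)) in *.
      replace (om * ((bump s (th t) (U t) + at_polar p c s (th t) (U t) (Y t)
        - loop_height h (th t) * angular s (th t) (U t) (Y t)) * / om)) with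
        (bump s (th t) (U t) + at_polar p c s (th t) (U t) (Y t)
        - loop_height h (th t) * angular s (th t) (U t) (Y t)) by (field; exact Ho).
      unfold om, omega, bump, eps_of; rewrite EG, HU, <- Ex, <- Ey.
      set (l := loop_height h (th t)); set (hh := h _ _); set (an := angular _ _ _ _).
      apply Rminus_diag_uniq.
      transitivity ((1 - sg * sg) * (hh - l) * / s); [field; lra|].
      rewrite sg_unit; ring.
Qed.

(** * The limit cycle at a fixed scale *)

Section Branch.
Variables (s : R) (u v : R -> R).
Hypothesis s_pos : 0 < s.
Hypothesis s_tame : tame s.
Hypothesis W_u : weakly_coupled (2 * PI) 2 (rest_u s).
Hypothesis W_v : weakly_coupled (2 * PI) (eps_of s * mean_drift1) (rest_v s).
Hypothesis loop_u : half_loop (2 * PI) u.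
Hypothesis loop_v : half_loop (2 * PI) v.
Hypothesis flow_u : forall t, is_derive u t (2 * u t + rest_u s t (u t) (v t)).
Hypothesis flow_v : forall t,
  is_derive v t (eps_of s * mean_drift1 * v t + rest_v s t (u t) (v t)).

Lemma s_small : s <= / 4. Proof. apply s_tame. Qed.

Definition level (t : R) : R := height s t (v t).
Definition curve (t : R) : R3 := spot s t (u t) (level t).
Definition branch_orbit (P : R3) : Prop := exists t, P = curve t.

Lemma u_bound t : Rabs (u t) <= / 2. Proof. apply loop_u. Qed.
Lemma v_bound t : Rabs (v t) <= / 2. Proof. apply loop_v. Qed.
Lemma level_bound t : Rabs (level t) <= 2.
Proof. apply s_tame; assert (H := v_bound t); lra. Qed.
Lemma branch_bounds t : / 2 <= omega s t (u t) (level t) /\ / 2 <= rad s (u t).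
Proof. apply s_tame; [assert (H := u_bound t); lra|apply level_bound]. Qed.

Lemma level_derive t :
  is_derive level t (sg * s ^ 3 * drift s t (u t) (level t)).
Proof.
eapply is_derive_eq.
- apply (height_flow s (fun t => t) u v t 1); [apply (is_derive_id (K := R_AbsRing) t)|].
  rewrite Rmult_1_l; apply flow_v.
- unfold level; ring.
Qed.

Lemma level_continuous t : continuous level t.
Proof. eapply is_derive_cont, level_derive. Qed.
Lemma u_continuous t : continuous u t.
Proof. apply loop_u. Qed.

Lemma level_periodic : periodic (2 * PI) level.
Proof. intros t; unfold level; rewrite height_periodic; f_equal; apply loop_v. Qed.

Lemma curve_periodic t : curve (t + 2 * PI) = curve t.
Proof.
unfold curve, spot; rewrite level_periodic, base_periodic, cos_2PI_periodic, sin_2PI_periodic.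
now rewrite (proj1 loop_u).
Qed.

Lemma rest_u_flow t U V :
  omega s t U (height s t V) <> 0 ->
  omega s t U (height s t V) * (2 * U + rest_u s t U V) =
  rad s U * (rad s U + 1) * U + sg * s * radial s t U (height s t V).
Proof. intros H; unfold rest_u; field; exact H. Qed.

(** The loop is parametrised by the angle; running along it with the true time means
    following the angle at speed [omega]. *)
Lemma branch_is_periodic_orbit :
  is_periodic_orbit (phase_space h) (scaled_field s) branch_orbit.
Proof.
set (w := fun t => omega s t (u t) (level t)).
assert (Cw : forall t, continuous w t).
{ intros t; apply (omega_continuous s u level); [|apply u_continuous|apply level_continuous].
  destruct (branch_bounds t); lra. }
assert (Pw : periodic (2 * PI) w).
{ intros t; unfold w; rewrite omega_periodic, level_periodic; f_equal; apply loop_u. }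
destruct (loop_bounded w Pw Cw) as [K HK].
assert (Hw : forall t, / 2 <= w t <= K).
{ intros t; split; [apply branch_bounds|]; eapply Rle_trans; [apply Rle_abs|apply HK]. }
destruct (autonomous_flow w (/ 2) K) as [th [Dth [Tth thT]]]; [lra|exact Cw|exact Hw|].
set (T := prim (fun x => / w x)) in *.
assert (CT : forall t, continuous (fun x => / w x) t).
{ intros t; apply cont_inv; [specialize (Hw t); lra|apply Cw]. }
assert (HT : forall x, T (x + 2 * PI) - T x = T (2 * PI)).
{ intros x; apply (period_integral (fun x => / w x)); [intros t; now rewrite Pw|exact CT]. }
exists (fun t => curve (th t)), (T (2 * PI)); split; [|split; [|split; [|split]]].
- intros t; split.
  + apply spot_in_phase_space; destruct (branch_bounds (th t)); lra.
  + assert (B := branch_bounds (th t)).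
    apply (cartesian_flow s th (fun t => u (th t)) (fun t => level (th t))); try lra.
    * apply Dth.
    * eapply is_derive_eq; [apply (is_derive_Rcomp u th); [apply flow_u|apply Dth]|].
      apply rest_u_flow; fold (level (th t)); lra.
    * eapply is_derive_eq; [apply (is_derive_Rcomp level th); [apply level_derive|apply Dth]|].
      unfold w; ring.
- assert (HK0 : 0 < / K) by (apply Rinv_0_lt_compat; specialize (Hw 0); lra).
  destruct (speed_surjective T (fun x => / w x) (/ K) HK0) as [Hm _].
  + intros x; apply (prim_derive (fun x => / w x)), CT.
  + intros x; specialize (Hw x); apply Rinv_le_contravar; lra.
  + assert (HPI := twoPI_pos); specialize (Hm 0 (2 * PI) ltac:(lra)).
    replace (T 0) with 0 in Hm by (unfold T, prim; now rewrite RInt_point).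
    assert (0 < / K * (2 * PI - 0)) by (apply Rmult_lt_0_compat; lra); lra.
- intros t; replace (th (t + T (2 * PI))) with (th t + 2 * PI); [apply curve_periodic|].
  rewrite <- (thT (th t + 2 * PI)); f_equal.
  assert (H := HT (th t)); rewrite Tth in H; lra.
- (* half a turn later the position is on the opposite side of the axis *)
  exists (T (th 0 + PI)); rewrite thT; unfold curve, spot; intros E.
  assert (E1 := f_equal (fun P : R3 => fst (fst P)) E).
  assert (E2 := f_equal (fun P : R3 => snd (fst P)) E); simpl in E1, E2.
  rewrite neg_cos in E1; rewrite neg_sin in E2.
  destruct (branch_bounds (th 0)) as [_ B1]; destruct (branch_bounds (th 0 + PI)) as [_ B2].
  assert (Hcs := cos_sin_sqr (th 0)).
  assert (C0 : cos (th 0) = 0).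
  { apply (Rmult_eq_reg_l (rad s (u (th 0)) + rad s (u (th 0 + PI)))); lra. }
  assert (S0 : sin (th 0) = 0).
  { apply (Rmult_eq_reg_l (rad s (u (th 0)) + rad s (u (th 0 + PI)))); lra. }
  rewrite C0, S0 in Hcs; lra.
- intros P; split.
  + intros [x ->]; exists (T x); now rewrite thT.
  + intros [t ->]; now exists (th t).
Qed.

Definition altitude (t : R) : R := base t + s * level t.

(** A competitor inside a thin tube has coordinates [U], [V] in the box where the system
    is weakly coupled, so it agrees with the loop above its own angle [th].  The
    closeness of [V] compares the competitor with the point of the loop at angle [th t],
    whereas the tube provides a point at another angle [q]; [circle_uniform] bridges the
    two. *)
Lemma branch_isolated :
  exists delta : posreal, forall O' : R3 -> Prop,
    is_periodic_orbit (phase_space h) (scaled_field s) O' ->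
    (forall P, O' P -> tube branch_orbit delta P) ->
    forall P, O' P <-> branch_orbit P.
Proof.
assert (Calt : forall t, continuous altitude t).
{ intros t; assert (H1 := base_continuous t); assert (H2 := level_continuous t).
  unfold altitude; cont. }
assert (Palt : periodic (2 * PI) altitude).
{ intros t; unfold altitude; now rewrite base_periodic, level_periodic. }
assert (s4 := s_small); destruct (pow_le_self s 2) as [s3 s3s]; [lra|].
destruct (circle_uniform altitude Palt Calt (s / 8)) as [d [Hd Hcirc]]; [lra|].
(* [s^3 / 8] keeps the radius within [s^3 / 4], hence [U] within 1/4 of the loop; [d / 8]
   makes the points of the circle below the two curves [d]-close, which takes [6 * de]. *)
pose (de := Rmin (s ^ 3 / 8) (d / 8)).
assert (Hde : 0 < de) by (apply Rmin_pos; lra).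
assert (Hde1 : de <= s ^ 3 / 8) by apply Rmin_l; assert (Hde2 : de <= d / 8) by apply Rmin_r.
exists (mkposreal de Hde); intros O' [X [S [HX [HS [HP [_ HO]]]]]] Htube.
assert (Hnear : forall t, exists q,
  Rabs (fst (fst (X t)) - rad s (u q) * cos q) < de /\
  Rabs (snd (fst (X t)) - rad s (u q) * sin q) < de /\
  Rabs (snd (X t) - altitude q) < de).
{ intros t; destruct (Htube (X t)) as [Q [[q ->] HQ]]; [apply HO; now exists t|].
  exists q; now apply ball_R3 in HQ. }
assert (Hpos : forall t,
  0 < fst (fst (X t)) * fst (fst (X t)) + snd (fst (X t)) * snd (fst (X t))).
{ intros t; destruct (Hnear t) as [q [H1 [H2 _]]].
  destruct (branch_bounds q) as [_ Hr]; assert (Hcs := cos_sin_sqr q).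
  set (x := fst (fst (X t))) in *; set (y := snd (fst (X t))) in *; set (r := rad s (u q)) in *.
  apply Rnot_le_lt; intros Hle.
  assert (x = 0) by nra; assert (y = 0) by nra.
  assert (Hrr : r * r = r * cos q * (r * cos q) + r * sin q * (r * sin q)).
  { transitivity (r * r * (cos q * cos q + sin q * sin q)); [rewrite Hcs; ring|ring]. }
  apply Rabs_def2 in H1; apply Rabs_def2 in H2.
  assert (de <= / 8) by lra.
  assert (r * cos q * (r * cos q) <= / 64) by nra.
  assert (r * sin q * (r * sin q) <= / 64) by nra.
  nra. }
destruct (polar_flow s X s_pos HX Hpos) as [th [U [Y Hflow]]].
pose (V := fun t => height_inv s (th t) (Y t)).
assert (HVY : forall t, height s (th t) (V t) = Y t) by (intros; apply height_invK).
assert (Hclose : forall t, Rabs (U t) <= 1 /\ Rabs (V t) <= 1).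
{ intros t; destruct (Hnear t) as [q [H1 [H2 H3]]].
  destruct (Hflow t) as [EX [Hr _]]; rewrite EX in H1, H2, H3; simpl in H1, H2, H3.
  destruct (branch_bounds q) as [_ Hrq].
  destruct (polar_close _ _ _ _ _ Hr Hrq H1 H2) as [C1 [C2 C3]].
  split.
  - replace (rad s (U t) - rad s (u q)) with (s ^ 3 * (U t - u q)) in C1 by (unfold rad; ring).
    rewrite Rabs_mult, (Rabs_pos_eq (s ^ 3)) in C1 by lra.
    assert (Rabs (U t - u q) <= / 4) by (apply (Rmult_le_reg_l (s ^ 3)); lra).
    assert (Hu := u_bound q).
    replace (U t) with ((U t - u q) + u q) by ring.
    eapply Rle_trans; [apply Rabs_triang|lra].
  - assert (C4 : Rabs (altitude (th t) - altitude q) < s / 8) by (apply Hcirc; lra).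
    assert (C5 : Rabs (s * (Y t - level (th t))) <= s / 4).
    { replace (s * (Y t - level (th t))) with
        ((base (th t) + s * Y t - altitude q) + - (altitude (th t) - altitude q))
        by (unfold altitude; ring).
      eapply Rle_trans; [apply Rabs_triang|]; rewrite Rabs_Ropp; lra. }
    rewrite Rabs_mult, (Rabs_pos_eq s) in C5 by lra.
    assert (C6 : Rabs (Y t - level (th t)) <= / 4) by (apply (Rmult_le_reg_l s); lra).
    rewrite <- HVY in C6; unfold level, height in C6.
    replace (sg * s ^ 3 * corrector (th t) + gauge s (th t) * V t -
      (sg * s ^ 3 * corrector (th t) + gauge s (th t) * v (th t))) with
      (gauge s (th t) * (V t - v (th t))) in C6 by ring.
    assert (G1 : / 2 <= gauge s (th t)) by apply s_tame.
    rewrite Rabs_mult, (Rabs_pos_eq (gauge s (th t))) in C6 by lra.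
    assert (P := Rabs_pos (V t - v (th t))).
    assert (Rabs (V t - v (th t)) <= / 2) by nra.
    assert (Hv := v_bound (th t)).
    replace (V t) with ((V t - v (th t)) + v (th t)) by ring.
    eapply Rle_trans; [apply Rabs_triang|lra]. }
pose (om := fun t => omega s (th t) (U t) (Y t)).
assert (Hom : forall t, / 2 <= om t).
{ intros t; destruct (Hclose t) as [C1 C2]; apply s_tame; [lra|].
  rewrite <- HVY; now apply s_tame. }
assert (Dth : forall t, is_derive th t (om t)) by (intros t; apply Hflow).
assert (Hper : forall t, cos (th (t + S)) = cos (th t) /\ sin (th (t + S)) = sin (th t) /\
                 U (t + S) = U t /\ base (th (t + S)) + s * Y (t + S) = base (th t) + s * Y t).
{ intros t; destruct (Hflow t) as [E1 [R1 _]]; destruct (Hflow (t + S)) as [E2 [R2 _]].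
  rewrite HP, E1 in E2.
  assert (Ex := f_equal (fun P : R3 => fst (fst P)) E2).
  assert (Ey := f_equal (fun P : R3 => snd (fst P)) E2).
  assert (Ez := f_equal (fun P : R3 => snd P) E2); simpl in Ex, Ey, Ez.
  destruct (polar_unique _ _ _ _ R1 R2 Ex Ey) as [Er [Ec Es]].
  split; [easy|split; [easy|split; [|easy]]].
  unfold rad in Er; apply (Rmult_eq_reg_l (s ^ 3)); lra. }
assert (Hcf : forall f, periodic (2 * PI) f -> (forall t, continuous f t) ->
          forall t, f (th (t + S)) = f (th t)).
{ intros f Pf Cf t; destruct (Hper t) as [E1 [E2 _]]; now apply circle_function. }
assert (HUV : forall t, U t = u (th t) /\ V t = v (th t)).
{ apply (weakly_coupled_unique (2 * PI) 2 (eps_of s * mean_drift1) (rest_u s) (rest_v s)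
           W_u W_v S th om U V (fun t => u (th t)) (fun t => v (th t))).
  - exact HS.
  - intros t; specialize (Hom t); lra.
  - apply Hclose.
  - apply Hclose.
  - intros t; assert (H := u_bound (th t)); lra.
  - intros t; assert (H := v_bound (th t)); lra.
  - intros t; destruct (Hper t) as [_ [_ [-> _]]].
    rewrite (Hcf u); [easy| |]; apply loop_u.
  - intros t; unfold V, height_inv, gauge; destruct (Hper t) as [_ [_ [_ EY]]].
    rewrite (Hcf _ base_periodic base_continuous) in EY.
    assert (EY' : Y (t + S) = Y t) by (apply (Rmult_eq_reg_l s); lra).
    rewrite EY', (Hcf _ corrector_periodic corrector_continuous),
      (Hcf _ oscillation_periodic oscillation_continuous), (Hcf v); [easy| |]; apply loop_v.
  - intros t; destruct (Hflow t) as [_ [_ [_ [DU _]]]].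
    eapply is_derive_eq; [exact DU|].
    unfold om; rewrite <- HVY; symmetry; apply rest_u_flow.
    rewrite HVY; specialize (Hom t); unfold om in Hom; lra.
  - intros t; destruct (Hflow t) as [_ [_ [_ [_ DY]]]].
    apply height_inv_flow; [apply Dth|apply DY].
    specialize (Hom t); unfold om in Hom; lra.
  - intros t; apply (is_derive_Rcomp u th); [apply flow_u|apply Dth].
  - intros t; apply (is_derive_Rcomp v th); [apply flow_v|apply Dth]. }
assert (HXc : forall t, X t = curve (th t)).
{ intros t; destruct (Hflow t) as [-> _]; destruct (HUV t) as [E1 E2].
  unfold curve, level; now rewrite <- E1, <- E2, HVY. }
destruct (speed_surjective th om (/ 2)) as [_ Hsurj]; [lra|exact Dth|exact Hom|].
intros P; split.
- intros HPO; apply HO in HPO; destruct HPO as [t ->]; exists (th t); apply HXc.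
- intros [x ->]; apply HO; destruct (Hsurj x) as [t <-]; exists t; symmetry; apply HXc.
Qed.

Lemma curve_near_cylinder t (eta : posreal) :
  2 * s < eta -> ball (cylinder_solution h z0 t) eta (curve t) /\
                 ball (curve t) eta (cylinder_solution h z0 t).
Proof.
intros He.
assert (s4 := s_small); destruct (pow_le_self s 2) as [s3 s3s]; [lra|].
assert (Hu := u_bound t); assert (Hl := level_bound t).
assert (Hr : forall e, Rabs e <= 1 -> Rabs (rad s (u t) * e - e) < eta).
{ intros e Hee; replace (rad s (u t) * e - e) with (s ^ 3 * u t * e) by (unfold rad; ring).
  assert (Hs3 : Rabs (s ^ 3) <= s) by (rewrite Rabs_pos_eq; lra).
  assert (H := Rabs_mult_le _ _ _ _ (Rabs_mult_le _ _ _ _ Hs3 Hu) Hee); lra. }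
assert (H1 := Hr (cos t) ltac:(apply Rabs_le; apply COS_bound)).
assert (H2 := Hr (sin t) ltac:(apply Rabs_le; apply SIN_bound)).
assert (H3 : Rabs (base t + s * level t - base t) < eta).
{ replace (base t + s * level t - base t) with (s * level t) by ring.
  rewrite Rabs_mult, (Rabs_pos_eq s) by lra; nra. }
split; apply ball_R3; split.
- exact H1.
- split; [exact H2|exact H3].
- rewrite Rabs_minus_sym; exact H1.
- split; rewrite Rabs_minus_sym; [exact H2|exact H3].
Qed.

End Branch.

Lemma limit_cycle_branch :
  for_small (fun s => exists O,
    is_limit_cycle (phase_space h) (scaled_field s) O /\
    forall eta : posreal, 2 * s < eta ->
      (forall P, O P -> tube (cylinder_orbit h z0) eta P) /\
      (forall P, cylinder_orbit h z0 P -> tube O eta P)).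
Proof.
assert (H := for_small_and _ _ tame_for_small
               (for_small_and _ _ rest_u_weakly_coupled rest_v_weakly_coupled)).
revert H; apply for_small_imp; intros s Hs [Htame [Wu Wv]].
destruct (weakly_coupled_periodic_solution (2 * PI) 2 (eps_of s * mean_drift1)
            (rest_u s) (rest_v s) twoPI_pos Wu Wv) as [u [v [Lu [Lv [Du Dv]]]]].
exists (branch_orbit s u v); split; [split|].
- now apply branch_is_periodic_orbit.
- now apply branch_isolated.
- intros eta Heta.
  assert (Hnear := fun t => curve_near_cylinder s u v Hs Htame Lu Lv t eta Heta).
  split; intros P [t ->]; destruct (Hnear t) as [H1 H2].
  + exists (cylinder_solution h z0 t); split; [now exists t|exact H1].
  + exists (curve s u v t); split; [now exists t|exact H2].
Qed.

End Coordinates.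

End Model.

(** * The derivative of [Mbar] *)

Section MbarDerivative.
Variables (h : R -> R -> R) (m n p : nat) (a b c : nat -> nat -> nat -> R) (z0 : R).
Hypothesis h_adm : admissible h.

Lemma base_translate t x : base h (z0 + x) t = base h z0 t + x.
Proof. unfold base; ring. Qed.

(** Here [s] is the size of a displacement of [z] and [y] its direction: the expansion of
    the integrand in [z], uniform in [t], gives the derivative of its integral. *)
Lemma jet_drift0 :
  jet (fun s t _ y => drift0 h m n p a b c (z0 + s * y) t)
      (drift0 h m n p a b c z0) (drift1 h m n p a b c z0).
Proof.
assert (JP : forall d e, jet (fun s t _ y => poly3 d e (cos t, sin t, base h z0 t + s * y))
  (fun t => poly3 d e (cos t, sin t, base h z0 t))
  (fun t => dz_poly3 d e (cos t) (sin t) (base h z0 t))).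
{ intros d e; eapply jet_ext; [| | |apply (jet_poly3 d e _ _ _ _ _ _ _ jet_cos jet_sin
    (jet_height h z0 h_adm))]; intros; try reflexivity; apply Rmult_1_r. }
eapply jet_ext; [| | |apply jet_minus; [apply (JP p c)|apply jet_mult;
  [apply (jet_loop_height h h_adm)|apply jet_minus; apply jet_mult]]].
4: apply jet_cos. 4: apply (JP n b). 4: apply jet_sin. 4: apply (JP m a).
- intros; unfold drift0; now rewrite base_translate.
- intros; reflexivity.
- intros; unfold drift1; simpl; ring.
Qed.

Lemma Mbar_derive :
  is_derive (Mbar h m n p a b c) z0 (- prim (drift1 h m n p a b c z0) (2 * PI)).
Proof.
destruct jet_drift0 as [K [s0 [HK [Hs [_ J]]]]].
set (g := fun z => drift0 h m n p a b c z) in *.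
set (g1 := drift1 h m n p a b c z0) in *.
assert (Cg : forall z t, continuous (g z) t) by (intros; apply drift0_continuous, h_adm).
assert (Cg1 : forall t, continuous g1 t) by (intros; apply drift1_continuous, h_adm).
assert (HPI := twoPI_pos).
assert (Hpt : forall x t, x <> 0 -> Rabs x <= s0 ->
  Rabs (g (z0 + x) t - g z0 t - x * g1 t) <= K * x ^ 2).
{ intros x t Hx Hx0.
  assert (Hs1 : 0 < Rabs x <= s0) by (split; [now apply Rabs_pos_lt|exact Hx0]).
  destruct (J (Rabs x) t Hs1) as [_ J1].
  specialize (J1 0 (sign x) 0 0).
  assert (Hsx : Rabs x * sign x = x).
  { destruct (Rdichotomy _ _ Hx) as [H|H].
    - rewrite (sign_eq_m1 _ H), Rabs_left by exact H; ring.
    - rewrite (sign_eq_1 _ H), Rabs_pos_eq by lra; ring. }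
  assert (Has : Rabs (sign x) = 1).
  { destruct (Rdichotomy _ _ Hx) as [H|H].
    - rewrite (sign_eq_m1 _ H), Rabs_left; lra.
    - rewrite (sign_eq_1 _ H), Rabs_R1; lra. }
  rewrite !Rabs_R0, !Rminus_0_r, Rabs_R0, Has, Hsx, Rmult_0_r, Rplus_0_r in J1.
  replace (Rabs x * g1 t * sign x) with (x * g1 t) in J1 by (rewrite <- Hsx at 1; ring).
  replace (Rabs x ^ 2) with (x ^ 2) in J1 by (symmetry; apply pow2_abs).
  replace (K * x ^ 2 * (0 + 1)) with (K * x ^ 2) in J1 by ring.
  apply J1; lra. }
assert (HM : forall z, Mbar h m n p a b c z = - RInt (g z) 0 (2 * PI)).
{ intros z; apply Mbar_drift0. }
assert (Hint : forall x, x <> 0 -> Rabs x <= s0 ->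
  Rabs (Mbar h m n p a b c (z0 + x) - Mbar h m n p a b c z0 + x * prim g1 (2 * PI))
  <= 2 * PI * (K * x ^ 2)).
{ intros x Hx Hx0; rewrite !HM.
  assert (E : RInt (fun t => g (z0 + x) t - g z0 t - x * g1 t) 0 (2 * PI) =
              RInt (g (z0 + x)) 0 (2 * PI) - RInt (g z0) 0 (2 * PI) - x * prim g1 (2 * PI)).
  { assert (E3 : RInt (fun t => x * g1 t) 0 (2 * PI) = x * RInt g1 0 (2 * PI)).
    { apply (RInt_scal (V := R_CompleteNormedModule) g1); now apply cont_ex_RInt. }
    assert (E2 : RInt (fun t => g (z0 + x) t - g z0 t) 0 (2 * PI) =
                 RInt (g (z0 + x)) 0 (2 * PI) - RInt (g z0) 0 (2 * PI)).
    { apply (RInt_minus (V := R_CompleteNormedModule) (g (z0 + x)) (g z0));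
        apply cont_ex_RInt, Cg. }
    unfold prim; rewrite <- E3, <- E2.
    apply (RInt_minus (V := R_CompleteNormedModule) (fun t => g (z0 + x) t - g z0 t)
       (fun t => x * g1 t)); apply cont_ex_RInt; intros; cont; auto; apply Cg. }
  replace (- RInt (g (z0 + x)) 0 (2 * PI) - - RInt (g z0) 0 (2 * PI) + x * prim g1 (2 * PI))
    with (- RInt (fun t => g (z0 + x) t - g z0 t - x * g1 t) 0 (2 * PI)) by (rewrite E; ring).
  rewrite Rabs_Ropp; replace (2 * PI * (K * x ^ 2)) with ((2 * PI - 0) * (K * x ^ 2)) by ring.
  apply abs_RInt_le_const; [lra| |intros t _; now apply Hpt].
  apply cont_ex_RInt; intros; cont; auto; apply Cg. }
apply is_derive_Reals; intros eps Heps.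
pose (C := 2 * PI * K + 1); assert (HC : 0 < C) by (unfold C; nra).
assert (Hd : 0 < Rmin s0 (eps / C)).
{ apply Rmin_pos; [lra|apply Rdiv_lt_0_compat; lra]. }
exists (mkposreal _ Hd); intros x Hx Hxd; simpl in Hxd.
assert (H1 := Rmin_l s0 (eps / C)); assert (H2 := Rmin_r s0 (eps / C)).
specialize (Hint x Hx ltac:(lra)).
assert (Hx' := Rabs_pos_lt x Hx).
replace ((Mbar h m n p a b c (z0 + x) - Mbar h m n p a b c z0) / x - - prim g1 (2 * PI))
  with ((Mbar h m n p a b c (z0 + x) - Mbar h m n p a b c z0 + x * prim g1 (2 * PI)) * / x)
  by (field; exact Hx).
rewrite Rabs_mult, Rabs_inv.
apply Rmult_lt_reg_r with (Rabs x); [exact Hx'|].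
rewrite Rmult_assoc, Rinv_l, Rmult_1_r by lra.
eapply Rle_lt_trans; [exact Hint|].
rewrite <- (pow2_abs x).
assert (Hm : Rabs x * C < eps).
{ apply Rlt_le_trans with (eps / C * C); [apply Rmult_lt_compat_r; lra|right; field; lra]. }
unfold C in Hm; simpl; nra.
Qed.

End MbarDerivative.

(** * The number of zeros of [Mbar] *)

(** Functions [F z t] polynomial in [z] of degree at most [d], with coefficients that are
    continuous in [t].  The Horner form makes sums, products and divisions by a linear
    factor structural recursions, without any handling of coefficient sequences. *)
Fixpoint poly_family (d : nat) (F : R -> R -> R) : Prop :=
  match d with
  | O => exists e : R -> R, (forall t, continuous e t) /\ forall z t, F z t = e t
  | S d => exists (e : R -> R) (G : R -> R -> R),
      (forall t, continuous e t) /\ poly_family d G /\ forall z t, F z t = e t + z * G z t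
  end.

Lemma poly_family_ext d F G :
  (forall z t, F z t = G z t) -> poly_family d F -> poly_family d G.
Proof.
intros E; destruct d as [|d]; simpl.
- intros [e [Ce He]]; exists e; split; [exact Ce|intros; now rewrite <- E].
- intros [e [K [Ce [HK He]]]]; exists e, K; repeat split; auto; intros; now rewrite <- E.
Qed.

Lemma poly_family_const d (e : R -> R) :
  (forall t, continuous e t) -> poly_family d (fun _ t => e t).
Proof.
revert e; induction d as [|d IH]; intros e Ce; simpl.
- now exists e.
- exists e, (fun _ _ => 0); split; [exact Ce|split].
  + apply (IH (fun _ => 0)); intros; apply cont_const.
  + intros; ring.
Qed.

Lemma poly_family_plus d F G :
  poly_family d F -> poly_family d G -> poly_family d (fun z t => F z t + G z t).
Proof.
revert F G; induction d as [|d IH]; intros F G; simpl.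
- intros [e [Ce He]] [e' [Ce' He']]; exists (fun t => e t + e' t); split.
  + intros t; now apply cont_plus.
  + intros; now rewrite He, He'.
- intros [e [K [Ce [HK He]]]] [e' [K' [Ce' [HK' He']]]].
  exists (fun t => e t + e' t), (fun z t => K z t + K' z t); split; [|split].
  + intros t; now apply cont_plus.
  + now apply IH.
  + intros; rewrite He, He'; ring.
Qed.

Lemma poly_family_scale d (e : R -> R) F :
  (forall t, continuous e t) -> poly_family d F -> poly_family d (fun z t => e t * F z t).
Proof.
intros Ce; revert F; induction d as [|d IH]; intros F; simpl.
- intros [e' [Ce' He']]; exists (fun t => e t * e' t); split.
  + intros t; now apply cont_mult.
  + intros; now rewrite He'.
- intros [e' [K [Ce' [HK He']]]]; exists (fun t => e t * e' t), (fun z t => e t * K z t).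
  split; [|split].
  + intros t; now apply cont_mult.
  + now apply IH.
  + intros; rewrite He'; ring.
Qed.

Lemma poly_family_S d F : poly_family d F -> poly_family (S d) F.
Proof.
revert F; induction d as [|d IH]; intros F H.
- destruct H as [e [Ce He]]; exists e, (fun _ _ => 0); split; [exact Ce|split].
  + apply (poly_family_const 0 (fun _ => 0)); intros; apply cont_const.
  + intros; rewrite He; ring.
- destruct H as [e [K [Ce [HK He]]]]; exists e, K; split; [exact Ce|split; [now apply IH|exact He]].
Qed.

Lemma poly_family_weaken d d' F : (d <= d')%nat -> poly_family d F -> poly_family d' F.
Proof. intros H HF; induction H; [exact HF|now apply poly_family_S]. Qed.

Lemma poly_family_shift_mul d (e : R -> R) F :
  (forall t, continuous e t) -> poly_family d F ->
  poly_family (S d) (fun z t => (z + e t) * F z t).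
Proof.
intros Ce HF.
apply (poly_family_ext _ (fun z t => z * F z t + e t * F z t)); [intros; ring|].
apply poly_family_plus.
- exists (fun _ => 0), F; split; [intros; apply cont_const|split; [exact HF|intros; ring]].
- now apply poly_family_S, poly_family_scale.
Qed.

Lemma poly_family_pow k (e : R -> R) :
  (forall t, continuous e t) -> poly_family k (fun z t => (z + e t) ^ k).
Proof.
intros Ce; induction k as [|k IH].
- apply (poly_family_const 0 (fun _ => 1)); intros; apply cont_const.
- now apply (poly_family_shift_mul k e (fun z t => (z + e t) ^ k)).
Qed.

Lemma poly_family_sum_n d (F : nat -> R -> R -> R) N :
  (forall k, (k <= N)%nat -> poly_family d (F k)) ->
  poly_family d (fun z t => sum_n (fun k => F k z t) N).
Proof.
induction N as [|N IH]; intros H.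
- apply (poly_family_ext _ (F 0%nat)); [intros; now rewrite sum_O|apply H; lia].
- apply (poly_family_ext _ (fun z t => sum_n (fun k => F k z t) N + F (S N) z t)).
  + intros; now rewrite sum_Sn.
  + apply poly_family_plus; [apply IH; intros; apply H; lia|apply H; lia].
Qed.

Lemma poly_family_continuous d F : poly_family d F -> forall z t, continuous (F z) t.
Proof.
revert F; induction d as [|d IH]; intros F.
- intros [e [Ce He]] z t; apply (continuous_ext e); [intros; now rewrite He|apply Ce].
- intros [e [K [Ce [HK He]]]] z t.
  apply (continuous_ext (fun t => e t + z * K z t)); [intros; now rewrite He|].
  apply cont_plus; [apply Ce|]; apply cont_mult; [apply cont_const|now apply IH].
Qed.

Lemma poly_family_poly3 d a (H : R -> R) :
  (forall t, continuous H t) ->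
  poly_family d (fun z t => poly3 d a (cos t, sin t, z + H t)).
Proof.
intros CH; unfold poly3.
apply poly_family_sum_n; intros i Hi; apply poly_family_sum_n; intros j Hj.
apply poly_family_sum_n; intros k Hk.
apply (poly_family_scale d (fun t => a i j k * cos t ^ i * sin t ^ j) (fun z t => (z + H t) ^ k)).
- intros t; cont; apply continuous_pow; cont.
- apply (poly_family_weaken k); [lia|now apply poly_family_pow].
Qed.

Fixpoint polynomial_le (d : nat) (f : R -> R) : Prop :=
  match d with
  | O => exists e, forall z, f z = e
  | S d => exists e g, polynomial_le d g /\ forall z, f z = e + z * g z
  end.

Lemma poly_family_integral d F al be :
  poly_family d F -> polynomial_le d (fun z => RInt (F z) al be).
Proof.
revert F; induction d as [|d IH]; intros F.
- intros [e [Ce He]]; exists (RInt e al be); intros z; apply RInt_ext; intros; apply He.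
- intros [e [K [Ce [HK He]]]]; exists (RInt e al be), (fun z => RInt (K z) al be).
  split; [now apply IH|]; intros z.
  assert (CK := poly_family_continuous _ _ HK z).
  rewrite (RInt_ext (F z) (fun t => plus (e t) (scal z (K z t)))) by (intros; apply He).
  rewrite (RInt_plus (V := R_CompleteNormedModule) e (fun t => scal z (K z t))).
  + now rewrite (RInt_scal (V := R_CompleteNormedModule) (K z)) by now apply cont_ex_RInt.
  + now apply cont_ex_RInt.
  + apply cont_ex_RInt; intros t; apply (cont_mult (fun _ => z) (K z)); [apply cont_const|apply CK].
Qed.

Lemma polynomial_le_opp d f : polynomial_le d f -> polynomial_le d (fun z => - f z).
Proof.
revert f; induction d as [|d IH]; intros f; simpl.
- intros [e He]; exists (- e); intros; now rewrite He.
- intros [e [g [Hg He]]]; exists (- e), (fun z => - g z); split; [now apply IH|].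
  intros; rewrite He; ring.
Qed.

Lemma polynomial_le_factor d f r :
  polynomial_le (S d) f ->
  exists q, polynomial_le d q /\ forall z, f z - f r = (z - r) * q z.
Proof.
revert f; induction d as [|d IH]; intros f [e [g [Hg He]]].
- destruct Hg as [k Hk]; exists (fun _ => k); split; [now exists k|].
  intros z; rewrite !He, !Hk; ring.
- destruct (IH g Hg) as [q [Hq Eq]].
  exists (fun z => g r + z * q z); split; [now exists (g r), q|].
  intros z; rewrite !He.
  replace (e + z * g z - (e + r * g r)) with (z * (g z - g r) + (z - r) * g r) by ring.
  rewrite Eq; ring.
Qed.

Lemma polynomial_le_roots d f l :
  polynomial_le d f -> (exists z, f z <> 0) -> NoDup l ->
  (forall z, In z l -> f z = 0) -> (length l <= d)%nat.
Proof.
revert f l; induction d as [|d IH]; intros f l Hf [z0 Hz0] Hl Hroots.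
- destruct l as [|r l]; [apply Nat.le_refl|]; exfalso; apply Hz0.
  destruct Hf as [e He]; rewrite He, <- (He r); apply Hroots; now left.
- destruct l as [|r l]; [apply Nat.le_0_l|].
  destruct (polynomial_le_factor d f r Hf) as [q [Hq Eq]].
  assert (Hr : f r = 0) by (apply Hroots; now left).
  inversion_clear Hl as [|x l' Hnin Hnd].
  simpl; apply le_n_S, (IH q l Hq).
  + exists z0; intros E; specialize (Eq z0); rewrite E, Hr, Rmult_0_r in Eq; lra.
  + exact Hnd.
  + intros z Hz; specialize (Eq z); rewrite Hr, (Hroots z) in Eq by now right.
    destruct (Rmult_integral (z - r) (q z)) as [E|E]; [lra| |exact E].
    exfalso; apply Hnin; now replace r with z by lra.
Qed.

Lemma Mbar_polynomial h m n p a b c :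
  admissible h -> polynomial_le (Nat.max m (Nat.max n p)) (Mbar h m n p a b c).
Proof.
intros Hh; set (d := Nat.max m (Nat.max n p)).
assert (HF : poly_family d (drift0 h m n p a b c)).
{ assert (HP : forall d' e, (d' <= d)%nat ->
    poly_family d (fun z t => poly3 d' e (cos t, sin t, base h z t))).
  { intros d' e Hd'; apply (poly_family_weaken d'); [exact Hd'|].
    apply (poly_family_poly3 d' e (prim (loop_height h))); intros t.
    eapply is_derive_cont, prim_derive, loop_height_continuous, Hh. }
  assert (Ch := loop_height_continuous h Hh).
  apply (poly_family_ext _ (fun z t => poly3 p c (cos t, sin t, base h z t) +
    ((- (loop_height h t * cos t)) * poly3 n b (cos t, sin t, base h z t) +
     loop_height h t * sin t * poly3 m a (cos t, sin t, base h z t))));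
    [intros; unfold drift0; ring|].
  apply poly_family_plus; [apply HP; lia|apply poly_family_plus].
  - apply (poly_family_scale d (fun t => - (loop_height h t * cos t))); [|apply HP; lia].
    intros t; specialize (Ch t); cont.
  - apply (poly_family_scale d (fun t => loop_height h t * sin t)); [|apply HP; lia].
    intros t; specialize (Ch t); cont. }
assert (HI := polynomial_le_opp _ _ (poly_family_integral _ _ 0 (2 * PI) HF)).
replace (Mbar h m n p a b c) with (fun z => - RInt (drift0 h m n p a b c z) 0 (2 * PI)); [exact HI|].
apply functional_extensionality; intros z; symmetry; apply Mbar_drift0.
Qed.

(** * The bifurcation theorem *)

Lemma quartic_scale eps s1 :
  eps <> 0 -> 0 < s1 -> Rabs eps < s1 ^ 4 ->
  exists sg s, (sg = 1 \/ sg = -1) /\ 0 < s <= s1 /\ s ^ 4 = Rabs eps /\ sg * s ^ 4 = eps.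
Proof.
intros He Hs1 Hlt; assert (Hp := Rabs_pos_lt _ He).
assert (P1 := sqrt_lt_R0 _ Hp); assert (P2 := sqrt_lt_R0 _ P1).
assert (E : sqrt (sqrt (Rabs eps)) ^ 4 = Rabs eps).
{ replace (sqrt (sqrt (Rabs eps)) ^ 4) with
    ((sqrt (sqrt (Rabs eps)) * sqrt (sqrt (Rabs eps))) * (sqrt (sqrt (Rabs eps)) * sqrt (sqrt (Rabs eps)))) by ring.
  rewrite !sqrt_sqrt; lra. }
assert (Hs : sqrt (sqrt (Rabs eps)) <= s1).
{ apply Rnot_lt_le; intros Hgt.
  assert (s1 ^ 4 <= sqrt (sqrt (Rabs eps)) ^ 4) by (apply pow_incr; lra). lra. }
exists (sign eps), (sqrt (sqrt (Rabs eps))); split; [|split; [lra|split; [exact E|]]].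
- destruct (Rdichotomy _ _ He) as [H|H]; [right; now apply sign_eq_m1|left; now apply sign_eq_1].
- rewrite E; destruct (Rdichotomy _ _ He) as [H|H].
  + rewrite (sign_eq_m1 _ H), Rabs_left by exact H; ring.
  + rewrite (sign_eq_1 _ H), Rabs_pos_eq by lra; ring.
Qed.

Theorem theorem3 (h : R -> R -> R) (m n p : nat)
    (ap bp cp am bm cm : nat -> nat -> nat -> R)
    (h_adm : admissible h)
    (A_h_zero : forall theta : R, 0 <= theta < 2 * PI -> A_h h theta = 0)
    (g_eq : forall X : R3, poly_map m n p ap bp cp X = poly_map m n p am bm cm X) :
  (forall z0 : R,
     Mbar h m n p ap bp cp z0 = 0 ->
     Derive (Mbar h m n p ap bp cp) z0 <> 0 ->
     exists Gamma : R -> R3 -> Prop,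
       locally' 0 (fun eps =>
         is_limit_cycle (phase_space h)
           (perturbed_field h (poly_map m n p ap bp cp) eps) (Gamma eps)) /\
       orbits_tend_to Gamma (cylinder_orbit h z0)) /\
  ((exists z : R, Mbar h m n p ap bp cp z <> 0) ->
   forall l : list R, NoDup l ->
     (forall z : R, In z l -> Mbar h m n p ap bp cp z = 0) ->
     (length l <= Nat.max m (Nat.max n p))%nat).
Proof.
split.
2:{ intros Hnz l Hl Hr; apply (polynomial_le_roots _ (Mbar h m n p ap bp cp)); auto.
    now apply Mbar_polynomial. }
intros z0 HM HD.
assert (H0 : prim (drift0 h m n p ap bp cp z0) (2 * PI) = 0).
{ rewrite Mbar_drift0 in HM; lra. }
assert (H1 : prim (drift1 h m n p ap bp cp z0) (2 * PI) <> 0).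
{ intros E; apply HD; erewrite is_derive_unique by (apply Mbar_derive, h_adm); rewrite E; ring. }
destruct (limit_cycle_branch h m n p ap bp cp z0 1 h_adm A_h_zero ltac:(ring) H0 H1)
  as [s1 [Hs1 B1]].
destruct (limit_cycle_branch h m n p ap bp cp z0 (-1) h_adm A_h_zero ltac:(ring) H0 H1)
  as [s2 [Hs2 B2]].
pose (s0 := Rmin s1 s2).
assert (Hs0 : 0 < s0) by now apply Rmin_pos.
assert (Hs01 : s0 <= s1) by apply Rmin_l; assert (Hs02 : s0 <= s2) by apply Rmin_r.
assert (Hbranch : forall eps, exists O : R3 -> Prop, eps <> 0 -> Rabs eps < s0 ^ 4 ->
  is_limit_cycle (phase_space h) (perturbed_field h (poly_map m n p ap bp cp) eps) O /\
  forall eta : posreal, Rabs eps < (eta / 2) ^ 4 ->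
    (forall P, O P -> tube (cylinder_orbit h z0) eta P) /\
    (forall P, cylinder_orbit h z0 P -> tube O eta P)).
{ intros eps; destruct (Req_dec eps 0) as [E|E].
  { exists (fun _ => False); intros N; now elim N. }
  destruct (Rlt_le_dec (Rabs eps) (s0 ^ 4)) as [L|L].
  2:{ exists (fun _ => False); intros _ N; exfalso; lra. }
  destruct (quartic_scale eps s0 E Hs0 L) as [sg [s [Hsg [Hs [Hs4 Heps]]]]].
  assert (B : exists O, is_limit_cycle (phase_space h)
      (scaled_field h m n p ap bp cp sg s) O /\
    forall eta : posreal, 2 * s < eta ->
      (forall P, O P -> tube (cylinder_orbit h z0) eta P) /\
      (forall P, cylinder_orbit h z0 P -> tube O eta P)).
  { destruct Hsg as [-> | ->]; [apply B1|apply B2]; lra. }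
  destruct B as [O [HO Hclose]]; exists O; intros _ _.
  unfold scaled_field, eps_of in HO; rewrite Heps in HO; split; [exact HO|].
  intros eta Heta; apply Hclose.
  apply Rnot_le_lt; intros Hle; rewrite <- Hs4 in Heta.
  assert ((eta / 2) ^ 4 <= s ^ 4) by (apply pow_incr; assert (P := cond_pos eta); lra).
  lra. }
destruct (functional_choice _ Hbranch) as [Gamma HG]; exists Gamma.
assert (Hs4 : 0 < s0 ^ 4) by now apply pow_lt.
split.
- exists (mkposreal _ Hs4); intros eps Heps Hne.
  change (Rabs (eps - 0) < s0 ^ 4) in Heps; rewrite Rminus_0_r in Heps.
  now apply HG.
- intros eta.
  assert (He4 : 0 < (eta / 2) ^ 4) by (apply pow_lt; assert (P := cond_pos eta); lra).
  exists (mkposreal _ (Rmin_pos _ _ Hs4 He4)); intros eps Heps Hne.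
  change (Rabs (eps - 0) < Rmin (s0 ^ 4) ((eta / 2) ^ 4)) in Heps; rewrite Rminus_0_r in Heps.
  assert (M1 := Rmin_l (s0 ^ 4) ((eta / 2) ^ 4)); assert (M2 := Rmin_r (s0 ^ 4) ((eta / 2) ^ 4)).
  apply HG; [exact Hne|lra|lra].
Qed.
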